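(* Let $A$ be a subanalytic set-germ at $0\in\mathbb{R}^n$ with $0\in\overline{A}$. Then $A$ is $ST$-equivalent to $LD(A)$.
   Context: Direction set: $D(A)=\{a\in S^{n-1} : \exists\, \{x_i\}\subset A\setminus\{0\},\ x_i\to 0,\ x_i/\|x_i\|\to a\}$. For $E\subset S^{n-1}$, $L(E)=\{ta : a\in E,\ t\ge 0\}$, and $LD(A):=L(D(A))$. Sea-tangle neighbourhood: for $d,C>0$, $ST_d(A;C)=\{x\in\mathbb{R}^n : \mathrm{dist}(x,A)\le C|x|^d\}$. Two set-germs $A,B$ at $0$ with $0\in\overline{A}\cap\overline{B}$ are $ST$-equivalent if there are $d_1,d_2>1$ and $C_1,C_2>0$ such that $B\subset ST_{d_1}(A;C_1)$ and $A\subset ST_{d_2}(B;C_2)$ as germs at $0$ (i.e. after intersecting with some neighbourhood of $0$).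
   Formalization: The hypothesis that 0 lies in the closure of A is replaced by 0 lying in the closure of A∖{0}; for the germ A={0} the set LD(A) is empty, so the statement as written fails there, and this is the only germ excluded. *)

(* Defs.v *)
From HB Require Import structures.
From mathcomp Require Import all_boot all_order all_algebra.
From mathcomp Require Import all_classical all_reals all_analysis.
From mathcomp Require Import Rstruct.
Set Implicit Arguments. Unset Strict Implicit. Unset Printing Implicit Defensive.
Import Order.TTheory GRing.Theory Num.Theory.
Local Open Scope classical_set_scope.
Local Open Scope ring_scope.

Section Subanalytic.
Variable R : realType.

Definition vec (n : nat) := 'I_n -> R.

Definition vsub n (x y : vec n) : vec n := fun i => x i - y i.
Definition vscale n (t : R) (x : vec n) : vec n := fun i => t * x i.
Definition vzero n : vec n := fun _ => 0.

Definition enorm n (x : vec n) : R := Num.sqrt (\sum_(i < n) x i ^+ 2).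

Definition dist n (x : vec n) (A : set (vec n)) : R :=
  inf [set enorm (vsub x y) | y in A].

Definition zero_in_closure n (A : set (vec n)) : Prop :=
  forall e : R, 0 < e -> exists2 x, A x & enorm x < e.

Definition dirset n (A : set (vec n)) : set (vec n) :=
  [set a | enorm a = 1 /\
    exists xs : nat -> vec n,
      (forall k, A (xs k) /\ xs k <> @vzero n) /\
      (forall e : R, 0 < e -> exists N : nat, forall k, (N <= k)%N ->
          enorm (xs k) < e /\
          enorm (vsub (vscale (enorm (xs k))^-1 (xs k)) a) < e)].

Definition coneL n (E : set (vec n)) : set (vec n) :=
  [set x | exists t : R, exists2 a, E a & 0 <= t /\ x = vscale t a].

Definition LD n (A : set (vec n)) := coneL (dirset A).

Definition ST n (d C : R) (A : set (vec n)) : set (vec n) :=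
  [set x | dist x A <= C * (enorm x) `^ d].

Definition germ_subset n (B X : set (vec n)) : Prop :=
  exists2 r : R, 0 < r & forall x, B x -> enorm x < r -> X x.

Definition ST_equiv n (A B : set (vec n)) : Prop :=
  zero_in_closure A /\ zero_in_closure B /\
  exists d1 d2 C1 C2 : R, [/\ 1 < d1, 1 < d2, 0 < C1 & 0 < C2] /\
     germ_subset B (ST d1 C1 A) /\ germ_subset A (ST d2 C2 B).

Definition open_set n (U : set (vec n)) : Prop :=
  forall a, U a -> exists2 r : R, 0 < r &
    forall x, enorm (vsub x a) < r -> U x.

Definition multi_index n := {ffun 'I_n -> nat}.

(* unconditional (= absolute, in R) convergence of a family indexed by a
   countable type: sum over finite sets of indices tends to s *)
Definition has_sum (M : eqType) (u : M -> R) (s : R) : Prop :=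
  forall e : R, 0 < e -> exists F : seq M, forall G : seq M,
    uniq G -> {subset F <= G} -> `|\sum_(m <- G) u m - s| < e.

Definition analytic_on n (U : set (vec n)) (f : vec n -> R) : Prop :=
  forall a, U a -> exists2 r : R, 0 < r &
    exists c : multi_index n -> R, forall x, enorm (vsub x a) < r ->
      has_sum (fun al : multi_index n =>
                 c al * \prod_(i < n) (x i - a i) ^+ (al i)) (f x).

Definition semianalytic n (X : set (vec n)) : Prop :=
  forall a : vec n, exists U : set (vec n), [/\ open_set U, U a &
    exists (p q : nat) (f g : 'I_p -> 'I_q -> vec n -> R),
      (forall i j, analytic_on U (f i j) /\ analytic_on U (g i j)) /\
      X `&` U = [set x | U x /\ exists i, forall j, f i j x = 0 /\ 0 < g i j x]].

Definition proj_first n m (y : vec (n + m)) : vec n := fun i => y (lshift m i).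

(* X is subanalytic in R^n: locally a projection of a relatively compact
   (= bounded) semianalytic set *)
Definition subanalytic n (X : set (vec n)) : Prop :=
  forall a : vec n, exists U : set (vec n), [/\ open_set U, U a &
    exists (m : nat) (Y : set (vec (n + m))),
      [/\ semianalytic Y, (exists M : R, forall y, Y y -> enorm y <= M) &
          X `&` U = (@proj_first n m) @` Y]].

Definition subanalytic_germ n (A : set (vec n)) : Prop :=
  exists2 r : R, 0 < r & subanalytic [set x | A x /\ enorm x < r].

End Subanalytic.

(* Main.v *)
(** Near the origin, [A] is the image under a coordinate projection of a set
    [F = 0, h <> 0] with [F] and [h] analytic, since [g > 0] can be replaced by
    [g = z^2, z <> 0].  Translations, power substitutions and blow-up charts
    bring analytic germs to the form monomial times unit; this is an induction
    on the number of variables and on the order in one variable, which drops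
    after a Tschirnhaus translation.  Hence [A] is covered by charts in which
    [x = w^s g(w)], with [g] analytic and nonvanishing.  In such a chart the
    direction [g / |g|] of [x], up to sign, is Lipschitz in [w].  Replacing by
    [0] the smallest coordinate occurring in [w^s], which is [O(|x|^(1/deg s))],
    gives a direction of [D(A)] close to that of [x].  Pushing all coordinates
    to absolute value at least [r] gives, for a suitable [r = O(t^(1/deg s))], a
    point of [A] of norm [t] whose direction is close to that of [x].  Both
    estimates are proved along an arbitrary sequence of points of [A] and a
    fixed ultrafilter, so that a single chart suffices. *)

Require Import Defs.
From mathcomp Require Import all_boot all_order all_algebra.
From mathcomp Require Import all_classical all_reals all_analysis.
From mathcomp Require Import Rstruct.
From mathcomp Require Import ring lra zify.
Import Order.TTheory GRing.Theory Num.Theory.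
Import numFieldNormedType.Exports.
Local Open Scope classical_set_scope.
Local Open Scope ring_scope.
Set Implicit Arguments. Unset Strict Implicit. Unset Printing Implicit
  Defensive.
(** * Analytic germs *)

(** The exponent comes from one inequality. If [B = deg s] and [b] is the smallest [|w_i|] occurring
    in [w^s], then [c b^B <= |x|]; changing coordinates by at most [b] turns the direction by
    [O(b)], and multiplying by [|x|] gives [d = 1 + 1/B]. The harder inclusion is that of [LD(A)] in
    a neighbourhood of [A]: a direction of [D(A)] is only a limit of directions of points of [A] and
    need not be visible in any chart. It is approached by points [x] of [A], and the ray through
    each of them is followed from norm [|x|] up to a scale [t0] independent of [x]; the estimate
    then passes to the limit. That [t0], the exponent and the constant can be chosen uniformly for
    all small points of [A] is proved by contradiction, from a sequence that violates worse and
    worse constants. Resolution is therefore needed only at one point and along one sequence,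
    without properness or gluing of charts, and the signs introduced by power substitutions are
    constant along the ultrafilter. *)

Section AnalyticBound.
Variable R : realType.

(* [abound r f M]: on the closed polydisc of polyradius [r], [f] is the sum of
   a power series whose coefficients satisfy [sum |c_a| r^a <= M].  Generating
   these pairs inductively makes closure under composition immediate. *)
Inductive abound (I : Type) (r : I -> R) : ((I -> R) -> R) -> R -> Prop :=
| abound_cst c : abound r (fun=> c) `|c|
| abound_coord i : abound r (fun x => x i) (r i)
| abound_add f g M N :
    abound r f M -> abound r g N -> abound r (fun x => f x + g x) (M + N)
| abound_mul f g M N :
    abound r f M -> abound r g N -> abound r (fun x => f x * g x) (M * N)
| abound_lim (f : nat -> (I -> R) -> R) (M : nat -> R) g N :
    (forall k, abound r (f k) (M k)) ->
    (forall n, series M n <= N) ->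
    (forall x, (forall i, `|x i| <= r i) ->
      series (f ^~ x) @ \oo --> g x) ->
    abound r g N.

(** A series with one nonzero term: the limit constructor ignores values off the polydisc and lets
    the bound grow. *)
Lemma abound_ext I (r : I -> R) f g M N : abound r f M ->
  (forall x, (forall i, `|x i| <= r i) -> f x = g x) -> M <= N -> 0 <= M ->
  abound r g N.
Proof.
move=> fM fg MN M0.
apply: (@abound_lim I r (fun k => if k is 0%N then f else fun=> 0)
   (fun k => if k is 0%N then M else `|0 : R|)) => [[|k]//|n|x xr].
- exact: abound_cst.
- case: n => [|n]; first by rewrite /series /= big_geq // (le_trans M0).
  rewrite /series /= big_nat_recl//= big1 ?addr0// => i _; exact: normr0.
- rewrite -fg//; apply: cvg_near_cst.
  near=> n; rewrite /series /=.
  have : (0 < n)%N by near: n; exact: nbhs_infty_gt.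
  move=> n0; rewrite -(prednK n0) big_nat_recl//= big1 ?addr0//.
Unshelve. all: by end_near. Qed.

Lemma abound_ge0 I (r : I -> R) f M : (forall i, 0 <= r i) ->
  abound r f M -> 0 <= M.
Proof.
move=> r0; elim=> //.
- by move=> *; exact: addr_ge0.
- by move=> *; exact: mulr_ge0.
- by move=> {}f M' g N _ _ /(_ 0%N); rewrite /series /= big_geq.
Qed.

Lemma abound_le I (r : I -> R) f M N : (forall i, 0 <= r i) ->
  abound r f M -> M <= N -> abound r f N.
Proof.
by move=> r0 fM MN; apply: (abound_ext fM) => //; exact: abound_ge0 fM.
Qed.

Lemma norm_abound I (r : I -> R) f M : abound r f M ->
  forall x, (forall i, `|x i| <= r i) -> `|f x| <= M.
Proof.
elim=> // {f M}.
- move=> f g M N _ IHf _ IHg x xr; rewrite (le_trans (ler_normD _ _))//.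
  by rewrite lerD// ?IHf ?IHg.
- move=> f g M N _ IHf _ IHg x xr; rewrite normrM ler_pM// ?IHf ?IHg//.
- move=> f M g N _ IH MN fg x xr.
  rewrite -(cvg_lim (@Rhausdorff R) (cvg_norm (fg x xr))); apply: limr_le.
    by apply/cvg_ex; eexists; apply: cvg_norm; exact: fg.
  near=> n; apply: le_trans (MN n).
  rewrite /series /=; apply: le_trans (ler_norm_sum _ _ _) _.
  by apply: ler_sum => k _; exact: IH.
Unshelve. all: by end_near. Qed.

Lemma abound_series I (r : I -> R) (f : nat -> (I -> R) -> R) M N :
  (forall i, 0 <= r i) ->
  (forall k, abound r (f k) (M k)) -> (forall n, series M n <= N) ->
  exists g, abound r g N /\
    forall x, (forall i, `|x i| <= r i) -> series (f ^~ x) @ \oo --> g x.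
Proof.
move=> r0 fM MN.
have cv x : (forall i, `|x i| <= r i) -> cvgn (series (f ^~ x)).
  move=> xr; apply: normed_cvg; rewrite /normed_series_of /=.
  apply: nondecreasing_is_cvgn.
    by apply/nondecreasing_series => k _ _; exact: normr_ge0.
  exists N => _ [n _ <-]; apply: le_trans (MN n).
  by rewrite /series /=; apply: ler_sum => k _; exact: norm_abound (fM k) _ xr.
exists (fun x => limn (series (f ^~ x))); split.
  by apply: (abound_lim fM MN) => x xr; apply: cv.
by move=> x xr; apply: cv.
Qed.

Lemma abound_comp I J (r : I -> R) (s : J -> R) f M (a : I -> (J -> R) -> R) :
  (forall j, 0 <= s j) -> abound r f M ->
  (forall i, abound s (a i) (r i)) -> abound s (fun y => f (a ^~ y)) M.
Proof.
move=> s0 fM ar; elim: fM => {f M}.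
- exact: abound_cst.
- exact: ar.
- by move=> f g M N _ IHf _ IHg; exact: abound_add.
- by move=> f g M N _ IHf _ IHg; exact: abound_mul.
- move=> f M g N _ IH MN fg; apply: (abound_lim IH MN) => y ys.
  by apply: fg => i; exact: norm_abound (ar i) _ ys.
Qed.

(* The single estimate behind division, shrinking of norms, Lipschitz bounds
   and the implicit function theorem.  Keeping track of both norms [N <= M] is
   what makes the product case close up. *)
Lemma abound_diff I J (r m : I -> R) (s : J -> R) (kap : R)
    (a b q : I -> (J -> R) -> R) (T : (J -> R) -> R) f M :
  (forall j, 0 <= s j) -> 0 <= kap ->
  (forall i, abound s (a i) (r i)) -> (forall i, abound s (b i) (m i)) ->
  (forall i, m i <= r i) ->
  (forall i, abound s (q i) (kap * (r i - m i))) ->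
  (forall y, (forall j, `|y j| <= s j) ->
     forall i, a i y - b i y = T y * q i y) ->
  abound r f M ->
  exists N Q, [/\ abound s (fun y => f (b ^~ y)) N, N <= M,
    abound s Q (kap * (M - N)) &
    forall y, (forall j, `|y j| <= s j) ->
      f (a ^~ y) - f (b ^~ y) = T y * Q y].
Proof.
move=> s0 k0 ar bm mr qk abT fM.
have fa g G : abound r g G -> abound s (fun y => g (a ^~ y)) G.
  by move=> gG; exact: abound_comp gG _.
elim: fM => {f M}.
- move=> c; exists `|c|, (fun=> 0); split=> //.
  + exact: abound_cst.
  + by rewrite subrr mulr0 -[X in abound _ _ X](@normr0 R R); exact: abound_cst.
  + by move=> y _; rewrite subrr mulr0.
- by move=> i; exists (m i), (q i); split=> //; move=> y ys; exact: abT.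
- move=> f g M M' _ [N [Q [fN NM QN fQ]]] _ [N' [Q' [gN NM' QN' gQ]]].
  exists (N + N'), (fun y => Q y + Q' y); split.
  + exact: abound_add.
  + exact: lerD.
  + have -> : kap * (M + M' - (N + N')) = kap * (M - N) + kap * (M' - N').
      by ring.
    exact: abound_add.
  + by move=> y ys; rewrite mulrDr -fQ// -gQ//; ring.
- move=> f g M M' fM [N [Q [fN NM QN fQ]]] gM [N' [Q' [gN NM' QN' gQ]]].
  exists (N * N'), (fun y => f (b ^~ y) * Q' y + Q y * g (a ^~ y)); split.
  + exact: abound_mul.
  + by apply: ler_pM => //; [exact: abound_ge0 fN|exact: abound_ge0 gN].
  + have -> : kap * (M * M' - N * N') =
      N * (kap * (M' - N')) + kap * (M - N) * M' by ring.
    by apply: abound_add; apply: abound_mul => //; exact: fa.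
  + move=> y ys; rewrite mulrDr mulrCA -gQ// mulrA -fQ//; ring.
- move=> f M g G fM IH MG fg.
  pose P k (p : R * ((J -> R) -> R)) := [/\ abound s (fun y => f k (b ^~ y))
    p.1,
    p.1 <= M k, abound s p.2 (kap * (M k - p.1)) &
    forall y, (forall j, `|y j| <= s j) ->
      f k (a ^~ y) - f k (b ^~ y) = T y * p.2 y].
  have [p Pp] : {p & forall k, P k (p k)}.
    apply: (@choice _ _ P) => k; have [N [Q H]] := IH k.
    by exists (N, Q).
  pose N k := (p k).1.
  have N0 k : 0 <= N k by have [+ _ _ _] := Pp k; exact: abound_ge0.
  have NM k : N k <= M k by have [] := Pp k.
  have NG n : series N n <= G.
    by apply: le_trans (MG n); rewrite /series /=; apply: ler_sum => k _.
  have ndN : nondecreasing_seq (series N).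
    by apply/nondecreasing_series => k _ _.
  have cvN : cvgn (series N).
    by apply: nondecreasing_is_cvgn => //; exists G => _ [n _ <-].
  have ndMN : nondecreasing_seq (series (fun k => M k - N k)).
    by apply/nondecreasing_series => k _ _; rewrite subr_ge0.
  (* The budget left for the quotients: for [n <= l] the gaps up to [n] and the [N k] up to [l] add
     up to at most [G]; then [l] tends to infinity. *)
  have MNle n : series (fun k => M k - N k) n <= G - limn (series N).
    rewrite lerBrDr -lerBrDl; apply: limr_le => //.
    near=> l; rewrite lerBrDl.
    apply: le_trans (MG l).
    have nl : (n <= l)%N by near: l; exact: nbhs_infty_ge.
    apply: le_trans (lerD (ndMN _ _ nl) (lexx _)) _.
    rewrite /series /= -big_split /=.
    by apply: ler_sum => k _; rewrite subrK.
  have Qk k : abound s (p k).2 (kap * (M k - N k)) by have [] := Pp k.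
  have kMN n : series (fun k => kap * (M k - N k)) n <=
      kap * (G - limn (series N)).
    rewrite /series /= -mulr_sumr ler_wpM2l//; exact: MNle.
  have [Q [QB Qc]] := abound_series s0 Qk kMN.
  have bnd (c : I -> (J -> R) -> R) y : (forall i, abound s (c i) (r i)) ->
    (forall j, `|y j| <= s j) -> forall i, `|c i y| <= r i.
    by move=> cr ys i; exact: norm_abound (cr i) _ ys.
  have br i : abound s (b i) (r i) by exact: abound_le (bm i) (mr i).
  exists (limn (series N)), Q; split=> //.
  + apply: (@abound_lim _ _ (fun k y => f k (b ^~ y)) N).
    * by move=> k; have [] := Pp k.
    * by move=> n; exact: nondecreasing_cvgn_le.
    * by move=> y ys; apply: fg; exact: bnd.
  + by apply: limr_le => //; near=> n; exact: NG.
  + move=> y ys.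
    have ca := fg _ (bnd a y ar ys); have cb := fg _ (bnd b y br ys).
    have c1 : (fun n => series (fun k => f k (a ^~ y)) n -
        series (fun k => f k (b ^~ y)) n) @ \oo --> g (a ^~ y) - g (b ^~ y).
      exact: cvgB.
    have c2 : (fun n => series (fun k => f k (a ^~ y)) n -
        series (fun k => f k (b ^~ y)) n) @ \oo --> T y * Q y.
      rewrite (_ : (fun n => _) = (fun n => T y * series (fun k => (p k).2 y)
        n)).
        by apply: cvgMr; exact: Qc.
      apply/funext => n; rewrite /series /= -sumrB mulr_sumr.
      by apply: eq_bigr => k _; have [_ _ _ ->] := Pp k.
    by rewrite -(cvg_lim (@Rhausdorff R) c1) (cvg_lim (@Rhausdorff R) c2).
Unshelve. all: by end_near. Qed.

End AnalyticBound.

(** * Norm estimates and closure properties of analytic germs *)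

Section Germs.
Variable R : realType.

Lemma abound_mono (I : Type) (r s : I -> R) f M : (forall i, 0 <= s i) ->
  (forall i, s i <= r i) -> abound r f M -> abound s f M.
Proof.
move=> s0 sr fM.
apply: (@abound_comp _ I I r s f M (fun i x => x i)) => // i.
by apply: abound_le (sr i) => //; exact: abound_coord.
Qed.

Lemma abound0 (I : Type) (r : I -> R) M : 0 <= M -> abound r (fun=> 0) M.
Proof.
by move=> M0; apply: (abound_ext (abound_cst r 0)); rewrite ?normr0.
Qed.

Lemma abound1 (I : Type) (r : I -> R) M : 1 <= M -> abound r (fun=> 1) M.
Proof.
by move=> M1; apply: (abound_ext (abound_cst r 1));
  rewrite ?normr1 ?(le_trans _ M1).
Qed.

Lemma abound_opp (I : Type) (r : I -> R) f M : abound r f M ->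
  abound r (fun x => - f x) M.
Proof.
move=> fM; rewrite (_ : (fun _ => _) = fun x => -1 * f x); last first.
  by apply/funext => x; rewrite mulN1r.
have -> : M = `|-1 : R| * M by rewrite normrN1 mul1r.
by apply: abound_mul => //; exact: abound_cst.
Qed.

Lemma abound_sub (I : Type) (r : I -> R) f g M N : abound r f M ->
  abound r g N -> abound r (fun x => f x - g x) (M + N).
Proof. by move=> fM gN; apply: abound_add => //; exact: abound_opp. Qed.

Definition upd (I : eqType) (x : I -> R) (i : I) (v : R) : I -> R :=
  fun k => if k == i then v else x k.

(** Instance of [abound_diff] in which [b] sets the coordinate [i] to [0], [T] is that coordinate
    and [kap = 1 / rho]. *)
Lemma abound_div (I : eqType) (rho : R) (i : I) f M : 0 < rho ->
  abound (fun=> rho) f M ->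
  exists2 Q, abound (fun=> rho) Q (M / rho) &
    forall x, (forall k, `|x k| <= rho) -> f x = f (upd x i 0) + x i * Q x.
Proof.
move=> rho0 fM.
have rho0' := ltW rho0.
have [||k|k|k|k|x xr k|N [Q [fN NM QN fQ]]] := @abound_diff R I I (fun=> rho)
  (fun k => if k == i then 0 else rho) (fun=> rho) rho^-1 (fun k x => x k)
  (fun k x => upd x i 0 k) (fun k x => if k == i then 1 else 0) (fun x => x i)
  f M _ _ _ _ _ _ _ fM.
- by [].
- by rewrite invr_ge0.
- exact: abound_coord.
- by rewrite /upd; case: ifP => _; [exact: abound0|exact: abound_coord].
- by case: ifP.
- case: ifP => _; last by apply: abound0; rewrite subrr mulr0.
  by rewrite subr0 mulVf ?gt_eqF//; exact: abound1.
- by rewrite /upd; case: eqP => [->|_]; rewrite ?subr0 ?mulr1// subrr mulr0.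
exists Q; last by move=> x /fQ /= <-; rewrite addrC subrK.
apply: abound_le QN _ => //; rewrite mulrC ler_pM2r ?invr_gt0//.
by rewrite gerBl; exact: abound_ge0 fN.
Qed.

(** A Schwarz lemma for the coefficient norm: [abound_diff] between the point and the origin, with
    [T = 1] and the shrinking factor as [kap]. *)
Lemma abound_shrink (I : Type) (rho lam : R) f M : 0 < rho -> 0 <= lam <= 1 ->
  abound (fun=> rho) f M ->
  abound (fun _ : I => lam * rho) (fun x => f x - f (fun=> 0)) (lam * M).
Proof.
move=> rho0 /andP[lam0 lam1] fM.
have lr : 0 <= lam * rho by rewrite mulr_ge0// ltW.
have [||k|k|k|k|x xr k|N [Q [fN NM QN fQ]]] := @abound_diff R I I (fun=> rho)
  (fun k => 0) (fun=> lam * rho) lam (fun k x => x k)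
  (fun k x => 0) (fun k x => x k) (fun x => 1)
  f M _ _ _ _ _ _ _ fM.
- by [].
- by [].
- apply: (@abound_le _ _ _ _ (lam * rho)) => //; first exact: abound_coord.
  by rewrite ler_piMl// ltW.
- exact: abound0.
- exact: ltW.
- by rewrite subr0; exact: abound_coord.
- by rewrite subr0 mul1r.
apply: (abound_ext QN) => [x xr||]; first by rewrite fQ// mul1r.
  by rewrite ler_wpM2l// gerBl; exact: abound_ge0 fN.
by rewrite mulr_ge0// subr_ge0.
Qed.

(** [abound_diff] over the empty set of variables [void], where functions are numbers. The margin
    between the radii [rho] and [rho + rho] produces the Lipschitz constant [M / rho]. *)
Lemma abound_lip (I : Type) (rho D : R) f M (a b : I -> R) : 0 < rho ->
  0 <= D -> abound (fun=> rho + rho) f M ->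
  (forall i, `|a i| <= rho) -> (forall i, `|b i| <= rho) ->
  (forall i, `|a i - b i| <= D) -> `|f a - f b| <= D * (M / rho).
Proof.
move=> rho0 D0 fM ar br abD.
have [||k|k|k|k|x xr k|N [Q [fN NM QN fQ]]] := @abound_diff R I void
  (fun=> rho + rho) (fun k => rho) (fun=> 0) rho^-1
  (fun k x => a k) (fun k x => b k) (fun k x => (a k - b k) / D) (fun x => D)
  f M _ _ _ _ _ _ _ fM.
- by [].
- by rewrite invr_ge0 ltW.
- apply: (@abound_le _ _ _ _ `|a k|) => //; first exact: abound_cst.
  by rewrite (le_trans (ar k))// lerDl ltW.
- by apply: (@abound_le _ _ _ _ `|b k|) => //; exact: abound_cst.
- by rewrite lerDl ltW.
- apply: (@abound_le _ _ _ _ `|(a k - b k) / D|) => //; first exact: abound_cst.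
  rewrite addrK mulVf ?gt_eqF//.
  have [->|Dn0] := eqVneq D 0; first by rewrite invr0 mulr0 normr0.
  by rewrite normrM normfV (ger0_norm D0) ler_pdivrMr ?mul1r// lt0r Dn0.
(* For [D = 0] the points coincide and the quotients are [0] by the convention on inverses. *)
- have [D00|Dn0] := eqVneq D 0; last by rewrite mulrC divfK.
  by rewrite {1}D00 mul0r; apply/eqP; rewrite -normr_le0 -D00.
rewrite (fQ (fun=> 0)); last by case.
rewrite normrM (ger0_norm D0) ler_wpM2l//.
apply: le_trans (norm_abound QN _) _; first by case.
rewrite mulrC ler_pM2r ?invr_gt0// gerBl; exact: abound_ge0 fN.
Qed.

Definition near0 (I : Type) : set_system (I -> R) :=
  [set P | exists2 rho, 0 < rho & forall x, (forall i, `|x i| <= rho) -> P x].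

Global Instance near0_filter I : ProperFilter (@near0 I).
Proof.
split; first by case=> rho rho0 /(_ (fun=> 0)); apply => i; rewrite normr0 ltW.
split.
- by exists 1.
- move=> P Q [a a0 Pa] [b b0 Qb]; exists (Num.min a b).
    by rewrite lt_min a0.
  move=> x xab; split; [apply: Pa|apply: Qb] => i.
    by rewrite (le_trans (xab i))// ge_min lexx.
  by rewrite (le_trans (xab i))// ge_min lexx orbT.
- by move=> P Q PQ [a a0 Pa]; exists a => // x /Pa /PQ.
Qed.

Lemma near0_at0 I (P : set (I -> R)) : near0 P -> P (fun=> 0).
Proof. by case=> rho rho0; apply=> i; rewrite normr0 ltW. Qed.

Lemma finite_radius (I : finType) (P : I -> R -> Prop) :
  (forall i, exists2 rho0, 0 < rho0 &
     forall rho, 0 < rho -> rho <= rho0 -> P i rho) ->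
  exists2 rho0, 0 < rho0 &
     forall rho, 0 < rho -> rho <= rho0 -> forall i, P i rho.
Proof.
move=> H.
have [r rP] : {r : I -> R & forall i, 0 < r i /\
    forall rho, 0 < rho -> rho <= r i -> P i rho}.
  apply: (@choice _ _ (fun i r => 0 < r /\
    forall rho, 0 < rho -> rho <= r -> P i rho)) => i.
  by have [r] := H i; exists r.
exists (\big[Num.min/1]_i r i).
  elim/big_ind : _ => // [x y x0 y0|i _]; first by rewrite lt_min x0.
  by have [] := rP i.
move=> rho rho0 rhole i; have [_] := rP i; apply=> //.
by apply: le_trans rhole _; exact: bigmin_le_cond.
Qed.

Definition agerm I (f : (I -> R) -> R) :=
  exists2 rho, 0 < rho & exists M, abound (fun=> rho) f M.

(** By [abound_shrink] the norm tends to [|f 0|] as the radius shrinks, so any larger bound is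
    reached; compositions and the contraction below rest on this. *)
Lemma agerm_bound I (f : (I -> R) -> R) e : agerm f -> `|f (fun=> 0)| < e ->
  exists2 rho0, 0 < rho0 &
    forall rho, 0 < rho -> rho <= rho0 -> abound (fun=> rho) f e.
Proof.
case=> r r0 [M fM] fe.
have M0 : 0 <= M by apply: abound_ge0 fM => _; exact: ltW.
pose lam := Num.min 1 ((e - `|f (fun=> 0)|) / (M + 1)).
have lam0 : 0 < lam.
  by rewrite lt_min ltr01 divr_gt0// ?subr_gt0// ltr_wpDl.
have lam1 : lam <= 1 by rewrite ge_min lexx.
exists (lam * r); first exact: mulr_gt0.
move=> rho rho0 rhole; apply: (@abound_mono _ (fun=> lam * r)) => // [_|].
  exact: ltW.
have lamr : 0 <= lam * r by rewrite ltW// mulr_gt0.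
have fs := @abound_shrink I r lam f M r0 (introT andP (conj (ltW lam0) lam1))
  fM.
apply: (@abound_ext _ _ _ _ _ _ _ (abound_add fs (abound_cst _ (f (fun=> 0))))).
- by move=> x _; rewrite subrK.
- rewrite -lerBrDr.
  have : lam <= (e - `|f (fun=> 0)|) / (M + 1) by rewrite ge_min lexx orbT.
  rewrite ler_pdivlMr ?ltr_wpDl//; apply: le_trans.
  by rewrite ler_wpM2l ?ltW// ltrDl.
- by rewrite addr_ge0// mulr_ge0// ltW.
Qed.

Lemma agerm_abound I (f : (I -> R) -> R) : agerm f ->
  exists M, exists2 rho0, 0 < rho0 &
    forall rho, 0 < rho -> rho <= rho0 -> abound (fun=> rho) f M.
Proof.
move=> fg; exists (`|f (fun=> 0)| + 1); apply: agerm_bound => //.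
by rewrite ltrDl.
Qed.

Lemma agerm_cst I c : agerm (fun _ : I -> R => c).
Proof. by exists 1 => //; exists `|c|; exact: abound_cst. Qed.

Lemma agerm_coord I i : agerm (fun x : I -> R => x i).
Proof. by exists 1 => //; exists 1; exact: abound_coord. Qed.

Lemma agerm_add I (f g : (I -> R) -> R) : agerm f -> agerm g ->
  agerm (fun x => f x + g x).
Proof.
move=> /agerm_abound[M [a a0 fM]] /agerm_abound[N [b b0 gN]].
have ab0 : 0 < Num.min a b by rewrite lt_min a0.
exists (Num.min a b) => //; exists (M + N); apply: abound_add.
  by apply: fM; rewrite // ge_min lexx.
by apply: gN; rewrite // ge_min lexx orbT.
Qed.

Lemma agerm_mul I (f g : (I -> R) -> R) : agerm f -> agerm g ->
  agerm (fun x => f x * g x).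
Proof.
move=> /agerm_abound[M [a a0 fM]] /agerm_abound[N [b b0 gN]].
have ab0 : 0 < Num.min a b by rewrite lt_min a0.
exists (Num.min a b) => //; exists (M * N); apply: abound_mul.
  by apply: fM; rewrite // ge_min lexx.
by apply: gN; rewrite // ge_min lexx orbT.
Qed.

Lemma agerm_opp I (f : (I -> R) -> R) : agerm f -> agerm (fun x => - f x).
Proof. by case=> r r0 [M fM]; exists r => //; exists M; exact: abound_opp. Qed.

Lemma agerm_sub I (f g : (I -> R) -> R) : agerm f -> agerm g ->
  agerm (fun x => f x - g x).
Proof. by move=> ? ?; apply: agerm_add => //; exact: agerm_opp. Qed.

Lemma agerm_exp I (f : (I -> R) -> R) n : agerm f -> agerm (fun x => f x ^+ n).
Proof.
move=> fg; elim: n => [|n IH]; first exact: agerm_cst.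
rewrite (_ : (fun x => _) = (fun x => f x * f x ^+ n)); first exact: agerm_mul.
by apply/funext => x; rewrite exprS.
Qed.

Lemma agerm_sum I (K : Type) (s : seq K) (P : pred K)
    (f : K -> (I -> R) -> R) : (forall k, P k -> agerm (f k)) ->
  agerm (fun x => \sum_(k <- s | P k) f k x).
Proof.
move=> fg; elim: s => [|k s IH].
  by under eq_fun do rewrite big_nil; exact: agerm_cst.
under eq_fun do rewrite big_cons.
by case Pk: (P k) => //; apply: agerm_add => //; exact: fg.
Qed.

Lemma agerm_prod I (K : Type) (s : seq K) (P : pred K)
    (f : K -> (I -> R) -> R) : (forall k, P k -> agerm (f k)) ->
  agerm (fun x => \prod_(k <- s | P k) f k x).
Proof.
move=> fg; elim: s => [|k s IH].
  by under eq_fun do rewrite big_nil; exact: agerm_cst.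
under eq_fun do rewrite big_cons.
by case Pk: (P k) => //; apply: agerm_mul => //; exact: fg.
Qed.

Lemma agerm_ext I (f g : (I -> R) -> R) :
  near0 [set x | f x = g x] -> agerm f -> agerm g.
Proof.
move=> [a a0 fg] /agerm_abound[M [b b0 fM]].
have ab0 : 0 < Num.min a b by rewrite lt_min a0.
have fM' : abound (fun=> Num.min a b) f M.
  by apply: fM => //; rewrite ge_min lexx orbT.
exists (Num.min a b) => //; exists M; apply: (abound_ext fM') => //.
  by move=> x xr; apply: fg => i; rewrite (le_trans (xr i))// ge_min lexx.
by apply: abound_ge0 fM' => _; exact: ltW.
Qed.

Lemma agerm_near I (f : (I -> R) -> R) e : agerm f -> 0 < e ->
  near0 [set x | `|f x - f (fun=> 0)| <= e].
Proof.
move=> fg e0.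
have gg : agerm (fun x => f x - f (fun=> 0)).
  by apply: agerm_sub => //; exact: agerm_cst.
have [|r r0 fr] := @agerm_bound _ _ e gg; first by rewrite subrr normr0.
by exists r => // x; exact: norm_abound (fr r r0 (lexx _)) x.
Qed.

Lemma agerm_neq0 I (f : (I -> R) -> R) : agerm f -> f (fun=> 0) != 0 ->
  near0 [set x | `|f (fun=> 0)| / 2 <= `|f x|].
Proof.
move=> fg f0; have f0' : 0 < `|f (fun=> 0)| by rewrite normr_gt0.
apply: filterS (@agerm_near _ _ (`|f (fun=> 0)| / 2) fg _);
  last by rewrite divr_gt0.
move=> x /= h; have := ler_normD (f (fun=> 0) - f x) (f x).
by rewrite subrK distrC => ?; lra.
Qed.

Lemma near0_comp (I : finType) J (a : I -> (J -> R) -> R) (P : set (I -> R)) :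
  (forall i, agerm (a i)) -> (forall i, a i (fun=> 0) = 0) ->
  near0 P -> near0 [set y | P (a ^~ y)].
Proof.
move=> ag a0 [r r0 Pr].
have [i|s s0 ss] := @finite_radius I
  (fun i rho => forall y, (forall j, `|y j| <= rho) -> `|a i y| <= r).
  have [|s s0 ss] := @agerm_bound _ _ r (ag i); first by rewrite a0 normr0.
  by exists s => // t t0 ts y; exact: norm_abound (ss t t0 ts) y.
by exists s => // y ys; apply: Pr => i; exact: (ss s s0 (lexx _)).
Qed.

Lemma agerm_comp (I : finType) J (a : I -> (J -> R) -> R) f :
  (forall i, agerm (a i)) -> (forall i, a i (fun=> 0) = 0) ->
  agerm f -> agerm (fun y => f (a ^~ y)).
Proof.
move=> ag a0 [r r0 [M fM]].
have [i|s s0 ss] := @finite_radius I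
  (fun i rho => abound (fun=> rho) (a i) r).
  by apply: agerm_bound => //; rewrite a0 normr0.
exists s => //; exists M; apply: abound_comp fM _ => //; first by move=> _;
  exact: ltW.
by move=> i; exact: ss.
Qed.

End Germs.
(** * Expansions in one variable and the identity theorem *)

Section Expansion.
Variable R : realType.

Definition ocons I (t : R) (x : I -> R) : option I -> R :=
  fun o => if o is Some i then x i else t.

Definition otail I (x : option I -> R) : I -> R := fun i => x (Some i).

Lemma upd_ocons (I : eqType) (x : option I -> R) :
  upd x None 0 = ocons 0 (otail x).
Proof. by apply/funext => -[]. Qed.

Lemma near0_otail I (P : set (I -> R)) : near0 P -> near0 [set x | P (otail x)].
Proof. by case=> r r0 Pr; exists r => // x xr; apply: Pr => i; exact: xr. Qed.

Lemma agerm_otail I (f : (I -> R) -> R) : agerm f ->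
  agerm (fun x => f (otail x)).
Proof.
case=> r r0 [M fM]; exists r => //; exists M.
apply: abound_comp fM _; first by move=> _; exact: ltW.
by move=> i; exact: abound_coord.
Qed.

Definition expands I d (c : nat -> (I -> R) -> R) u f :=
  near0 [set x : option I -> R |
    f x = \sum_(j < d) c j (otail x) * x None ^+ j + x None ^+ d * u x].

Lemma abound_expand (I : eqType) (rho : R) f M d : 0 < rho ->
  abound (fun=> rho) f M ->
  exists c u, [/\ forall j : nat, agerm (c j),
    abound (fun=> rho) u (M / rho ^+ d) &
    forall x : option I -> R, (forall i, `|x i| <= rho) ->
      f x = \sum_(j < d) c j (otail x) * x None ^+ j + x None ^+ d * u x].
Proof.
move=> rho0 fM; elim: d => [|d [c [u [cg uM fE]]]].
  exists (fun _ _ => 0), f; split.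
  - by move=> _; exact: agerm_cst.
  - by rewrite expr0 divr1.
  - by move=> x _; rewrite big_ord0 add0r mul1r.
have [Q QM uE] := @abound_div _ _ rho None u _ rho0 uM.
exists (fun j => if j == d then (fun x => u (ocons 0 x)) else c j), Q; split.
- move=> j; case: eqP => _ //.
  exists rho => //; exists (M / rho ^+ d); apply: abound_comp uM _.
    by move=> _; exact: ltW.
  by case=> [i|]; [exact: abound_coord|apply: abound0; exact: ltW].
- by rewrite exprSr invfM mulrA.
- move=> x xr; rewrite fE// big_ord_recr /= eqxx uE// upd_ocons exprSr mulrDr.
  rewrite -!addrA mulrA; congr (_ + _); last by rewrite mulrC.
  by apply: eq_bigr => j _; rewrite ltn_eqF.
Qed.

Lemma agerm_expand (I : eqType) (f : (option I -> R) -> R) d : agerm f ->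
  exists c u, [/\ forall j : nat, agerm (c j), agerm u & expands d c u f].
Proof.
case=> rho rho0 [M /(abound_expand d rho0)[c [u [cg uM fE]]]].
exists c, u; split=> //; first by exists rho => //; eexists; exact: uM.
by exists rho.
Qed.

(** Weierstrass regularity: on the [None]-axis, [f] vanishes to order exactly [d]. *)
Definition regular I d (f : (option I -> R) -> R) := exists c u,
  [/\ forall j, agerm (c j), forall j, (j < d)%N -> c j (fun=> 0) = 0,
      agerm u, u (fun=> 0) != 0 & expands d c u f].

(** The least index [k] with [c k] nonzero at the origin is the order; all terms from [k] on collect
    into [x None ^+ k] times a unit. *)
Lemma regular_lower I d (f : (option I -> R) -> R) c u j :
  (forall j, agerm (c j)) -> agerm u -> expands d c u f ->
  (j < d)%N -> c j (fun=> 0) != 0 -> exists2 d', (d' < d)%N & regular d' f.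
Proof.
move=> cg ug fE jd cj0.
have ex : exists k, c k (fun=> 0) != 0 by exists j.
have [k ck0 kmin] := ex_minnP ex; have kd : (k < d)%N.
  by apply: leq_ltn_trans jd; exact: kmin.
exists k => //; exists c.
exists (fun x => \sum_(k <= l < d) c l (otail x) * x None ^+ (l - k) +
  x None ^+ (d - k) * u x); split=> //.
- move=> l lk; apply/eqP/negP => /negP /kmin; by rewrite leqNgt lk.
- apply: agerm_add.
    apply: agerm_sum => l _; apply: agerm_mul.
      by apply: agerm_otail.
    by apply: agerm_exp; exact: agerm_coord.
  by apply: agerm_mul => //; apply: agerm_exp; exact: agerm_coord.
- rewrite (expr0n _ (d - k)) subn_eq0 leqNgt kd mul0r addr0.
  rewrite big_ltn// subnn expr0 mulr1 big_nat_cond big1 ?addr0//.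
  move=> l /andP[/andP[kl _] _].
  by rewrite expr0n subn_eq0 leqNgt kl mulr0.
- apply: filterS fE => x /= ->.
  rewrite mulrDr mulrA -exprD subnKC; last exact: ltnW.
  rewrite addrA; congr (_ + _).
  rewrite -(big_mkord xpredT (fun j => c j (otail x) * x None ^+ j)).
  rewrite (@big_cat_nat _ _ _ k)//=; last exact: ltnW.
  rewrite big_mkord mulr_sumr; congr (_ + _).
  apply: eq_big_nat => l /andP[kl _].
  by rewrite mulrCA -exprD subnKC.
Qed.

Lemma regular_line I d (f : (option I -> R) -> R) (e : R) : regular d f -> 0 <
  e ->
  ~ (forall t, `|t| <= e -> f (ocons t (fun=> 0)) = 0).
Proof.
move=> [c [u [cg c0 ug u0 fE]]] e0 f0.
have [r r0 rE] : near0 (fun x : option I -> R => f x = \sum_(j < d) c j (otail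
  x) * x None ^+ j
    + x None ^+ d * u x /\ `|u (fun=> 0)| / 2 <= `|u x|).
  by apply: filterI => //; exact: agerm_neq0.
pose t := Num.min r e.
have t0 : 0 < t by rewrite lt_min r0.
have tE i : `|ocons t (fun _ : I => 0) i| <= r.
  case: i => [i|] /=; first by rewrite normr0 ltW.
  by rewrite gtr0_norm// ge_min lexx.
have [] := rE _ tE; rewrite f0; last by rewrite gtr0_norm// ge_min lexx orbT.
rewrite big1 => [|j _]; last first.
  by rewrite [otail _](_ : _ = fun=> 0)// c0 ?mul0r.
rewrite add0r => /esym/eqP; rewrite mulf_eq0 expf_eq0 /= (gt_eqF t0) andbF orFb.
move=> /eqP ->; rewrite normr0 leNgt => /negP; apply.
by rewrite divr_gt0// normr_gt0.
Qed.

Lemma geometric_bound_eq0 (q M y : R) : 0 <= q < 1 ->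
  (forall d, `|y| <= q ^+ d * M) -> y = 0.
Proof.
move=> /andP[q0 q1] H; apply/eqP; rewrite -normr_le0.
have c : (fun d => q ^+ d * M) @ \oo --> 0 * M.
  by apply: cvgMl; apply: cvg_expr; rewrite ger0_norm.
rewrite -[leRHS](mul0r M) -(cvg_lim (@Rhausdorff R) c); apply: limr_ge.
  by apply/cvg_ex; eexists; exact: c.
by near=> d; exact: H.
Unshelve. all: by end_near. Qed.

(** Without a finite order every coefficient vanishes at the origin, so only the remainder
    contributes on the axis; it is at most [(|t| / rho)^d M] for every [d], hence zero. *)
Lemma finite_order (I : eqType) (rho : R) (f : (option I -> R) -> R) M t :
  0 < rho -> abound (fun=> rho) f M -> `|t| < rho ->
  f (ocons t (fun=> 0)) != 0 -> exists d, regular d f.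
Proof.
move=> rho0 fM tr ft0; apply: contrapT => nreg.
move/eqP: ft0; apply; apply: (@geometric_bound_eq0 (`|t| / rho) M).
  by rewrite divr_ge0 ?(ltW rho0)//= ltr_pdivrMr// mul1r.
move=> d; have [c [u [cg uM fE]]] := abound_expand d rho0 fM.
have ug : agerm u by exists rho => //; eexists; exact: uM.
have fE' : expands d c u f by exists rho.
have tpoly i : `|ocons t (fun _ : I => 0) i| <= rho.
  by case: i => [i|] /=; rewrite ?normr0 ltW.
rewrite fE// big1 => [|j _]; last first.
  have [/eqP|c0] := eqVneq (c j (fun=> 0)) 0.
    by rewrite [otail _](_ : _ = fun=> 0)// => /eqP ->; rewrite mul0r.
  by have [d' _ rd] := regular_lower cg ug fE' (ltn_ord j) c0; case: nreg;
    exists d'.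
rewrite add0r /= normrM normrX expr_div_n -mulrA ler_wpM2l ?exprn_ge0//.
by rewrite mulrC; exact: norm_abound uM _ _.
Qed.

(** Restriction to the line through [x] leaves a function of the single variable [None] over [void]:
    a nonzero value gives it a finite order, which contradicts its vanishing near [0]. *)
Lemma abound_identity I (rho r : R) (f : (I -> R) -> R) M : 0 < r -> r < rho ->
  abound (fun=> rho) f M -> near0 [set x | f x = 0] ->
  forall x, (forall i, `|x i| <= r) -> f x = 0.
Proof.
move=> r0 rrho fM [e e0 fe] x xr.
pose h (y : option void -> R) := f (fun i => y None * x i).
have rho0 : 0 < rho by exact: lt_trans rrho.
have hM : abound (fun=> rho / r) h M.
  apply: (@abound_comp _ _ _ _ _ _ _ (fun i y => y None * x i)) fM _.
    by move=> _; rewrite divr_ge0 ?ltW.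
  move=> i; apply: (abound_le _ (abound_mul (abound_coord _ _) (abound_cst _
    _))).
    by move=> _; rewrite divr_ge0 ?ltW.
  by rewrite mulrAC ler_pdivrMr// ler_pM2l.
apply: contrapT => /eqP fx0.
have [||||d] := @finite_order _ (rho / r) h M 1.
- by rewrite divr_gt0.
- exact: hM.
- by rewrite normr1 ltr_pdivlMr// mul1r.
- by rewrite /h; under eq_fun do rewrite mul1r.
move=> /(@regular_line _ _ _ (e / r)); apply; first by rewrite divr_gt0.
move=> t te; rewrite /h; apply: fe => i /=.
by rewrite normrM (le_trans (ler_pM _ _ te (xr i)))// divfK// gt_eqF.
Qed.

(** Germs form a domain: around a point [p] with [f p != 0] the function [g] vanishes, and the
    identity theorem centred at [p] carries this back to the origin. *)
Lemma near0_mul_eq0 I (f g : (I -> R) -> R) : agerm f -> agerm g ->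
  near0 [set x | f x * g x = 0] ->
  near0 [set x | f x = 0] \/ near0 [set x | g x = 0].
Proof.
move=> /agerm_abound[M [a a0 fM]] /agerm_abound[N [b b0 gN]] [e e0 fge].
have [nf|nf] := pselect (near0 [set x | f x = 0]); [by left|right].
pose rho := Num.min a (Num.min b e).
have rho0 : 0 < rho by rewrite !lt_min a0 b0.
have rhoe : rho <= e by rewrite !ge_min lexx !orbT.
have {}fM : abound (fun=> rho) f M by apply: fM; rewrite // ge_min lexx.
have {}gN : abound (fun=> rho) g N by apply: gN; rewrite // !ge_min lexx orbT.
clearbody rho.
(* With [p] within [r], the recentred [g'] is controlled on radius [3 r], while the points [x - p]
   to be reached lie within [2 r]. *)
pose r := rho / 4; have r0 : 0 < r by rewrite divr_gt0.
have rE : rho = (r + r) + (r + r) by rewrite /r; lra.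
have [p pr fp] : exists2 p, (forall i, `|p i| <= r) & f p != 0.
  apply: contrapT => H; apply: nf; exists r => // x xr /=;
    apply: contrapT => fx.
  by apply: H; exists x => //; exact/eqP.
pose g' (y : I -> R) := g (fun i => p i + y i).
have g'N : abound (fun=> r + r + r) g' N.
  apply: (@abound_comp _ _ _ _ _ _ _ (fun i y => p i + y i)) gN _.
    by move=> _; rewrite !addr_ge0 ?ltW.
  move=> i; apply: (abound_le _ (abound_add (abound_cst _ _) (abound_coord _
    _))).
    by move=> _; rewrite !addr_ge0 ?ltW.
  by rewrite rE; have := pr i; lra.
have M0 : 0 <= M by apply: abound_ge0 fM => _; exact: ltW.
have fp' : 0 < `|f p| by rewrite normr_gt0.
pose D := Num.min r (`|f p| / 2 / (M / (r + r) + 1)).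
have D0 : 0 < D.
  by rewrite lt_min r0 !divr_gt0// ltr_wpDl// divr_ge0// addr_ge0// ltW.
have g'0 : near0 [set y | g' y = 0].
  exists D => // y yD /=.
  have yr i : `|y i| <= r by rewrite (le_trans (yD i))// ge_min lexx.
  have pyr i : `|p i + y i| <= r + r.
    by rewrite (le_trans (ler_normD _ _))// lerD.
  have /eqP : f (fun i => p i + y i) * g' y = 0.
    by apply: fge => i; rewrite (le_trans (pyr i))// (le_trans _ rhoe)// rE
      lerDl addr_ge0// ltW.
  rewrite mulf_eq0 => /orP[|/eqP//] /eqP fpy.
  have := @abound_lip _ _ (r + r) D f M p (fun i => p i + y i) _ (ltW D0) _ _
    pyr.
  rewrite -rE fpy subr0 => /(_ _ fM) H.
  have : `|f p| <= D * (M / (r + r)).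
    apply: H; first exact: addr_gt0.
      by move=> i; rewrite (le_trans (pr i))// lerDl ltW.
    by move=> i; rewrite opprD addNKr normrN.
  have : D * (M / (r + r) + 1) <= `|f p| / 2.
    rewrite -ler_pdivlMr; first by rewrite ge_min lexx orbT.
    by rewrite ltr_wpDl// divr_ge0// addr_ge0// ltW.
  rewrite mulrDr mulr1; lra.
exists r => // x xr /=.
have -> : g x = g' (fun i => x i - p i).
  by rewrite /g'; congr g; apply/funext => i; rewrite addrC subrK.
apply: (@abound_identity _ (r + r + r) (r + r) g' N) => //.
- exact: addr_gt0.
- by rewrite ltrDl.
- by move=> i; rewrite (le_trans (ler_normB _ _))// lerD.
Qed.

Lemma near0_coord_neq0 I (i : I) : ~ near0 [set x : I -> R | x i = 0].
Proof.
case=> r r0 /(_ (fun=> r)) H; have := r0; rewrite H ?ltxx// => j.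
by rewrite gtr0_norm.
Qed.

Lemma near0_cancel_coord I (f : (I -> R) -> R) i : agerm f ->
  near0 [set x | x i * f x = 0] -> near0 [set x | f x = 0].
Proof.
move=> fg xf; case: (near0_mul_eq0 (agerm_coord R i) fg xf) => [h|//].
by case: (near0_coord_neq0 h).
Qed.

Lemma agerm_upd (I : eqType) (f : (I -> R) -> R) i : agerm f ->
  agerm (fun x => f (upd x i 0)).
Proof.
case=> r r0 [M fM]; exists r => //; exists M.
apply: (@abound_comp _ _ _ _ _ _ _ (fun k x => upd x i 0 k)) fM _.
  by move=> _; exact: ltW.
move=> k; rewrite /upd; case: (k == i); last exact: abound_coord.
by apply: abound0; exact: ltW.
Qed.

Lemma near0_upd (I : eqType) (P : set (I -> R)) i : near0 P ->
  near0 [set x | P (upd x i 0)].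
Proof.
case=> r r0 Pr; exists r => // x xr; apply: Pr => k; rewrite /upd.
by case: ifP => // _; rewrite normr0 ltW.
Qed.

Lemma agerm_div (I : eqType) (f : (I -> R) -> R) i : agerm f ->
  exists2 g, agerm g & near0 [set x | f x = f (upd x i 0) + x i * g x].
Proof.
case=> r r0 [M /(abound_div i r0)[Q QM fQ]]; exists Q.
  by exists r => //; eexists; exact: QM.
by exists r.
Qed.

Lemma agerm_factor_coord (I : eqType) (f : (I -> R) -> R) i : agerm f ->
  near0 [set x | f (upd x i 0) = 0] ->
  exists2 g, agerm g & near0 [set x | f x = x i * g x].
Proof.
move=> /(agerm_div i)[g gg fE] f0; exists g => //.
by apply: filterS2 fE f0 => x /= -> ->; rewrite add0r.
Qed.

End Expansion.
(** * The implicit function theorem *)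

Section ImplicitFunction.
Variables (R : realType) (I : Type).

Section Contraction.
Variables (sigma rho : R) (C : (I -> R) -> R) (E : (option I -> R) -> R).
Hypotheses (sigma0 : 0 < sigma) (rho0 : 0 < rho) (rho_sigma : rho <= sigma).
Hypothesis CB : abound (fun=> rho) C (sigma / 2).
Hypothesis EB : abound (fun=> sigma + sigma) E 4^-1.

Let iota (p : (I -> R) -> R) : (I -> R) -> R :=
  fun x => E (ocons (p x) x).

(** Dividing [c + p e = 0] by [e 0] gives [p = C - p E] with [E] vanishing at the origin, hence
    small; [Phi] is the iteration for this equation. *)
Let Phi (p : (I -> R) -> R) : (I -> R) -> R := fun x => C x - p x * iota p x.

Let rho_ge0 : I -> 0 <= rho. Proof. by move=> _; exact: ltW. Qed.

Let rho_sigma2 : rho <= sigma + sigma.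
Proof. by rewrite (le_trans rho_sigma)// lerDl ltW. Qed.

Let iotaB p : abound (fun=> rho) p sigma -> abound (fun=> rho) (iota p) 4^-1.
Proof.
move=> pB.
apply: (@abound_comp _ _ _ _ _ _ _ (fun o x => ocons (p x) x o)) EB _ => //.
case=> [i|] /=; first exact: abound_le (abound_coord _ _) _.
by apply: abound_le pB _ => //; rewrite lerDl ltW.
Qed.

Let PhiB p : abound (fun=> rho) p sigma -> abound (fun=> rho) (Phi p) sigma.
Proof.
move=> pB; apply: abound_le (abound_sub CB (abound_mul pB (iotaB pB))) _ => //.
by have := sigma0; lra.
Qed.

(** In [p E(p) - q E(q) = (p - q) E(p) + q (E(p) - E(q))] each summand has norm at most [D / 4]; for
    the second, the slope [D / sigma] cancels the bound [sigma] of [q]. *)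
Let Phi_contract p q D : 0 <= D -> abound (fun=> rho) p sigma ->
  abound (fun=> rho) q sigma -> abound (fun=> rho) (fun x => p x - q x) D ->
  abound (fun=> rho) (fun x => Phi p x - Phi q x) (D / 2).
Proof.
move=> D0 pB qB pqB.
have [|||o|o|o|x xr o|N [Q [fN NM QN fQ]]] := @abound_diff R (option I) I
  (fun=> sigma + sigma) (fun=> sigma) (fun=> rho) (D / sigma)
  (fun o x => ocons (p x) x o) (fun o x => ocons (q x) x o)
  (fun o x => if o is None then p x - q x else 0) (fun=> 1) E 4^-1
  _ _ _ _ _ _ _ EB.
- exact: rho_ge0.
- by rewrite divr_ge0// ltW.
- case=> [i|] /=; first exact: abound_le (abound_coord _ _) _.
  by apply: abound_le pB _ => //; rewrite lerDl ltW.
- by case: o => [i|] //=; exact: abound_le (abound_coord _ _) _.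
- by rewrite lerDl ltW.
- rewrite addrK divfK ?gt_eqF//; case: o => [i|] //; exact: abound0.
- by rewrite mul1r; case: o => [i|] //=; rewrite subrr.
have N0 : 0 <= N by exact: abound_ge0 fN.
have B := abound_opp (abound_add (abound_mul pqB (iotaB pB)) (abound_mul qB
  QN)).
apply: (abound_ext B).
- by move=> x xr; rewrite -[Q x]mul1r -fQ// /Phi /iota; ring.
- rewrite [sigma * _]mulrA mulrCA divff ?gt_eqF// mulr1.
  have : D * (4^-1 - N) <= D * 4^-1 by rewrite ler_wpM2l// gerBl.
  by have := D0; lra.
- exact: abound_ge0 B.
Qed.

Let psi k := iter k Phi (fun=> 0).

Let psiB k : abound (fun=> rho) (psi k) sigma.
Proof. by elim: k => [|k]; [apply: abound0; exact: ltW|exact: PhiB]. Qed.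

Let psiD k : abound (fun=> rho) (fun x => psi k.+1 x - psi k x)
  (sigma / 2 ^+ k.+1).
Proof.
elim: k => [|k IH].
  apply: (abound_ext CB) => [x _||].
  - by rewrite /psi /= /Phi mul0r !subr0.
  - by rewrite expr1.
  - by rewrite divr_ge0 ?ltW.
have -> : sigma / 2 ^+ k.+2 = sigma / 2 ^+ k.+1 / 2.
  by rewrite (exprSr 2 k.+1) invfM mulrA.
apply: (@Phi_contract (psi k.+1) (psi k)); [|exact: psiB..|exact: IH].
by rewrite divr_ge0 ?exprn_ge0// ltW.
Qed.

(** The iterates are written as partial sums of a telescoping series, since [abound] is closed under
    dominated series; the bounds [sigma / 2 ^+ k.+1] add up to at most [sigma]. *)
Lemma contraction_fixpoint : C (fun=> 0) = 0 ->
  exists g, [/\ abound (fun=> rho) g sigma, g (fun=> 0) = 0 &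
    forall x, (forall i, `|x i| <= rho) -> g x = C x - g x * E (ocons (g x) x)].
Proof.
move=> C0.
have geo n : series (fun k => sigma / 2 ^+ k.+1) n <= sigma.
  suff -> : series (fun k => sigma / 2 ^+ k.+1) n = sigma - sigma / 2 ^+ n.
    by rewrite gerBl divr_ge0 ?exprn_ge0// ltW.
  rewrite /series /=; elim: n => [|n IH]; first by rewrite big_geq// expr0; lra.
  rewrite big_nat_recr//= IH exprS invfM; lra.
have [g [gB gc]] := abound_series rho_ge0 psiD geo.
have {}gc x : (forall i, `|x i| <= rho) -> psi ^~ x @ \oo --> g x.
  move=> /gc; rewrite (_ : series _ = psi ^~ x)//.
  by apply/funext => n; rewrite /series /= telescope_sumr// /psi /= subr0.
exists g; split=> //.
  have z : forall i : I, `|(fun=> 0) i : R| <= rho by move=> i;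
    rewrite normr0 ltW.
  have : psi ^~ (fun=> 0) @ \oo --> (0 : R).
    rewrite (_ : psi ^~ _ = fun=> 0); first exact: cvg_cst.
    apply/funext; elim=> [//|n IH]; rewrite /psi /= -/(psi n) /Phi C0 IH.
    by rewrite mul0r subr0.
  move=> h; rewrite -[LHS](cvg_lim (@Rhausdorff R) (gc _ z)).
  exact: (cvg_lim (@Rhausdorff R) h).
move=> x xr; have gx := gc x xr.
have Ec : (fun n => E (ocons (psi n x) x)) @ \oo --> E (ocons (g x) x).
  apply/cvgrPdist_le => eps eps0; near=> n.
  apply: (@le_trans _ _ (`|g x - psi n x| * (4^-1 / sigma))).
    apply: (abound_lip sigma0 _ EB).
    - exact: normr_ge0.
    - case=> [i|] /=; first by rewrite (le_trans (xr i)).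
      exact: norm_abound gB _ xr.
    - case=> [i|] /=; first by rewrite (le_trans (xr i)).
      exact: norm_abound (psiB n) _ xr.
    - by case=> [i|] //=; rewrite subrr normr0.
  rewrite -ler_pdivlMr; last by rewrite divr_gt0.
  near: n; move/cvgrPdist_le : gx; apply.
  by rewrite !divr_gt0.
have c1 : (fun n => psi n.+1 x) @ \oo --> g x by have := gx;
  rewrite -cvg_shiftS.
have c2 : (fun n => psi n.+1 x) @ \oo --> C x - g x * E (ocons (g x) x).
  rewrite (_ : (fun n => _) = fun n => C x - psi n x * E (ocons (psi n x) x))//.
  by apply: cvgB; [exact: cvg_cst|exact: cvgM].
rewrite -[LHS](cvg_lim (@Rhausdorff R) c1).
exact: (cvg_lim (@Rhausdorff R) c2).
Unshelve. all: by end_near. Qed.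

End Contraction.

Lemma implicit_function (c : (I -> R) -> R) (e : (option I -> R) -> R) :
  agerm c -> agerm e -> c (fun=> 0) = 0 -> e (fun=> 0) != 0 ->
  exists psi, [/\ agerm psi, psi (fun=> 0) = 0 &
    near0 [set x | c x + psi x * e (ocons (psi x) x) = 0]].
Proof.
move=> cg eg c0 e0.
pose E (y : option I -> R) := e y * (e (fun=> 0))^-1 - 1.
pose C (x : I -> R) := c x * - (e (fun=> 0))^-1.
have Eg : agerm E.
  by apply: agerm_sub; [apply: agerm_mul => //|]; exact: agerm_cst.
have Cg : agerm C by apply: agerm_mul => //; exact: agerm_cst.
have [|s s0 sE] := @agerm_bound _ _ _ 4^-1 Eg.
  by rewrite /E divff// subrr normr0.
pose sigma := s / 2; have sigma0 : 0 < sigma by rewrite divr_gt0.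
have [|r r0 rC] := @agerm_bound _ _ _ (sigma / 2) Cg.
  by rewrite /C c0 mul0r normr0 divr_gt0.
pose rho := Num.min r sigma; have rho0 : 0 < rho by rewrite lt_min r0.
have [||||||g [gB g0 gE]] := @contraction_fixpoint sigma rho C E.
- by [].
- by [].
- by rewrite ge_min lexx orbT.
- by apply: rC => //; rewrite ge_min lexx.
- by rewrite /sigma -splitr; exact: sE.
- by rewrite /C c0 mul0r.
exists g; split=> //; first by exists rho => //; exists sigma.
exists rho => // x /gE; rewrite /C /E /= => gx.
have : e (fun=> 0) * g x = e (fun=> 0) * (c x * - (e (fun=> 0))^-1 -
  g x * (e (ocons (g x) x) / e (fun=> 0) - 1)) by rewrite -gx.
have -> : e (fun=> 0) * (c x * - (e (fun=> 0))^-1 -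
  g x * (e (ocons (g x) x) / e (fun=> 0) - 1)) = e (fun=> 0) * g x -
  (c x + g x * e (ocons (g x) x)) by field.
by move=> h; have := congr1 (fun v => e (fun=> 0) * g x - v) h;
  rewrite subrr opprB addrC subrK => <-.
Qed.

End ImplicitFunction.
(** * Monomials times units *)

Section NormalCrossings.
Variable R : realType.

Definition mono (I : Type) (s : seq I) (x : I -> R) : R := \prod_(i <- s) x i.

Lemma mono_cons (I : Type) (i : I) s x : mono (i :: s) x = x i * mono s x.
Proof. by rewrite /mono big_cons. Qed.

Lemma mono_cat (I : Type) (s t : seq I) x : mono (s ++ t) x = mono s x * mono t
  x.
Proof. by rewrite /mono big_cat. Qed.

Lemma mono_flatten_nseq (I : Type) k (s : seq I) x :
  mono (flatten (nseq k s)) x = mono s x ^+ k.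
Proof.
elim: k => [|k IH]; first by rewrite /mono big_nil.
by rewrite /= mono_cat IH exprS.
Qed.

Lemma mono_nseq (I : Type) k (i : I) x : mono (nseq k i) x = x i ^+ k.
Proof.
elim: k => [|k IH]; first by rewrite /mono big_nil.
by rewrite /= mono_cons IH exprS.
Qed.

Lemma mono_map (I J : Type) (h : I -> J) s x : mono (map h s) x = mono s (x \o
  h).
Proof. by rewrite /mono big_map. Qed.

Lemma agerm_mono (I : Type) (s : seq I) : agerm (mono s).
Proof. by apply: agerm_prod => i _; exact: agerm_coord. Qed.

Lemma mono_neq0 (I : Type) (s : seq I) x : (forall i, x i != 0) -> mono s x !=
  0.
Proof.
move=> x0; elim: s => [|i s IH]; first by rewrite /mono big_nil oner_eq0.
by rewrite mono_cons mulf_neq0.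
Qed.

(* The monomial is recorded as the list of its factors. *)
Definition normal (I : Type) (f : (I -> R) -> R) := exists s u,
  [/\ agerm u, u (fun=> 0) != 0 & near0 [set x | f x = mono s x * u x]].

Lemma normal_ext (I : Type) (f g : (I -> R) -> R) :
  near0 [set x | f x = g x] -> normal f -> normal g.
Proof.
move=> fg [s [u [ug u0 fE]]]; exists s, u; split=> //.
by apply: filterS2 fg fE => x /= -> ->.
Qed.

Lemma normal_agerm (I : Type) (f : (I -> R) -> R) : normal f -> agerm f.
Proof.
move=> [s [u [ug u0 fE]]]; apply: (@agerm_ext _ _ (fun x => mono s x * u x)).
  by apply: filterS fE => x /= ->.
by apply: agerm_mul => //; exact: agerm_mono.
Qed.

Lemma normal_neq0 (I : Type) (f : (I -> R) -> R) : normal f ->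
  near0 [set x | (forall i, x i != 0) -> f x != 0].
Proof.
move=> [s [u [ug u0 fE]]]; apply: filterS2 (agerm_neq0 ug u0) fE => x /= ux ->
  x0.
rewrite mulf_neq0 ?mono_neq0//; rewrite -normr_gt0 (lt_le_trans _ ux)//.
by rewrite divr_gt0// normr_gt0.
Qed.

Lemma normal_not_near0 (I : Type) (f : (I -> R) -> R) : normal f ->
  ~ near0 [set x | f x = 0].
Proof.
move=> /normal_neq0 f0 f1.
have [r r0 rP] := filterI f0 f1.
have [|h1 h2] := rP (fun=> r); first by move=> i; rewrite gtr0_norm.
suff: f (fun=> r) != 0 by rewrite h2 eqxx.
by apply: h1 => i; rewrite gt_eqF.
Qed.

Lemma normal_mul (I : Type) (f g : (I -> R) -> R) :
  normal f -> normal g -> normal (fun x => f x * g x).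
Proof.
move=> [s [u [ug u0 fE]]] [t [v [vg v0 gE]]];
  exists (s ++ t), (fun x => u x * v x).
split; [exact: agerm_mul|exact: mulf_neq0|].
by apply: filterS2 fE gE => x /= -> ->; rewrite mono_cat mulrACA.
Qed.

Lemma normal_unit (I : Type) (u : (I -> R) -> R) :
  agerm u -> u (fun=> 0) != 0 -> normal u.
Proof.
move=> ug u0; exists [::], u; split=> //.
by apply: filterE => x /=; rewrite /mono big_nil mul1r.
Qed.

Lemma normal_mono (I : Type) (s : seq I) : normal (mono s).
Proof.
exists s, (fun=> 1); split; [exact: agerm_cst|exact: oner_neq0|].
by apply: filterE => x /=; rewrite mulr1.
Qed.

Lemma normal_coord (I : Type) (i : I) : normal (fun x => x i).
Proof.
apply: normal_ext (normal_mono [:: i]).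
by apply: filterE => x /=; rewrite /mono big_seq1.
Qed.

Lemma near0_cancel (I : Type) (f g : (I -> R) -> R) i : agerm f -> agerm g ->
  near0 [set x | x i * f x = x i * g x] -> near0 [set x | f x = g x].
Proof.
move=> fg gg fgE.
have h : near0 [set x | f x - g x = 0].
  apply: (@near0_cancel_coord _ _ _ i); first exact: agerm_sub.
  by apply: filterS fgE => x /= h; rewrite mulrBr h subrr.
by apply: filterS h => x /= /eqP; rewrite subr_eq0 => /eqP.
Qed.

Lemma near0_cancel_exp (I : Type) (f g : (I -> R) -> R) i k :
  agerm f -> agerm g -> near0 [set x | x i ^+ k * f x = x i ^+ k * g x] ->
  near0 [set x | f x = g x].
Proof.
move=> fg gg; elim: k => [|k IH] H.
  by apply: filterS H => x /=; rewrite !expr0 !mul1r.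
have kg : agerm (fun x : I -> R => x i ^+ k).
  by apply: agerm_exp; exact: agerm_coord.
apply: IH; apply: (@near0_cancel _ _ _ i); [exact: agerm_mul..|].
by apply: filterS H => x /=; rewrite exprS -!mulrA.
Qed.

(** Each coordinate is prime: if [x i] divides [f * g], the product vanishes on the hyperplane, so
    one factor does and can be divided by [x i]. *)
Lemma normal_factor (I : eqType) (f g : (I -> R) -> R) : agerm f -> agerm g ->
  normal (fun x => f x * g x) -> normal f /\ normal g.
Proof.
move=> fg gg [s [u [ug u0 fgE]]]; elim: s => [|i s IH] in f g fg gg fgE *.
  have := near0_at0 fgE; rewrite /= /mono big_nil mul1r => fgu.
  have : f (fun=> 0) * g (fun=> 0) != 0 by rewrite fgu.
  rewrite mulf_eq0 negb_or => /andP[f0 g0].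
  by split; exact: normal_unit.
have sug : agerm (fun x => mono s x * u x).
  by apply: agerm_mul => //; exact: agerm_mono.
have : near0 [set x | f (upd x i 0) * g (upd x i 0) = 0].
  apply: filterS (near0_upd i fgE) => x /= ->.
  by rewrite mono_cons {1}/upd eqxx !mul0r.
case/(near0_mul_eq0 (agerm_upd i fg) (agerm_upd i gg)).
- move=> /(agerm_factor_coord fg)[f1 f1g fE].
  have /(IH _ _ f1g gg)[nf1 ng] : near0 [set x | f1 x * g x = mono s x * u x].
    apply: (@near0_cancel _ _ _ i) => //; first exact: agerm_mul.
    by apply: filterS2 fE fgE => x /= fE; rewrite mono_cons -mulrA => <-;
      rewrite fE mulrA.
  split=> //; apply: normal_ext (normal_mul (normal_coord i) nf1).
  by apply: filterS fE.
- move=> /(agerm_factor_coord gg)[g1 g1g gE].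
  have /(IH _ _ fg g1g)[nf ng1] : near0 [set x | f x * g1 x = mono s x * u x].
    apply: (@near0_cancel _ _ _ i) => //; first exact: agerm_mul.
    by apply: filterS2 gE fgE => x /= gE; rewrite mono_cons -mulrA => <-;
      rewrite gE mulrCA.
  split=> //; apply: normal_ext (normal_mul (normal_coord i) ng1).
  by apply: filterS gE.
Qed.

(* Over the reals a vector vanishes with the sum of its squares; so bringing
   one scalar germ to normal form principalizes a whole family. *)
Lemma normal_sum_squares (I : eqType) (K : finType) (f : K -> (I -> R) -> R) :
  (forall k, agerm (f k)) -> normal (fun x => \sum_k f k x ^+ 2) ->
  exists s g, [/\ forall k, agerm (g k), exists k, g k (fun=> 0) != 0 &
    near0 [set x | forall k, f k x = mono s x * g k x]].
Proof.
move=> fg [s [u [ug u0 fE]]].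
have [n] := ubnP (size s); elim: n => // n IH in s f fg fE *;
  rewrite ltnS => sn.
case: s => [|i s] in sn fE *.
  exists [::], f; split=> //; last first.
    by apply: filterE => x k; rewrite /mono big_nil mul1r.
  apply: contrapT => H; move/eqP: u0; apply.
  have := near0_at0 fE; rewrite /= /mono big_nil mul1r => <-.
  rewrite big1// => k _; have [->|fk] := eqVneq (f k (fun=> 0)) 0.
    by rewrite expr0n.
  by case: H; exists k.
have f0 : near0 [set x | forall k, f k (upd x i 0) = 0].
  apply: filterS (near0_upd i fE) => x /=.
  rewrite mono_cons {2}/upd eqxx !mul0r => /eqP; rewrite psumr_eq0 => [|k _].
    move=> /allP H k; have := H k (mem_index_enum k);
      rewrite sqrf_eq0 => /eqP //.
  exact: sqr_ge0.
have [h hP] : {h : K -> (I -> R) -> R & forall k, agerm (h k) /\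
    near0 [set x | f k x = x i * h k x]}.
  apply: (@choice _ _ (fun k h => agerm h /\ near0 [set x | f k x = x i * h
    x])).
  move=> k; have [|h hg hE] := @agerm_factor_coord _ _ (f k) i (fg k).
    by apply: filterS f0 => x /(_ k).
  by exists h.
have hg k : agerm (h k) by have [] := hP k.
have hE : near0 [set x | forall k, f k x = x i * h k x].
  apply: (@filter_forall _ _ (fun k x => f k x = x i * h k x) (@near0 R I)).
  by move=> k; have [] := hP k.
have shg : agerm (fun x => \sum_k h k x ^+ 2).
  by apply: agerm_sum => k _; exact: agerm_exp.
have fE1 : near0 [set x | x i * \sum_k h k x ^+ 2 = mono s x * u x].
  apply: (@near0_cancel _ _ _ i).
  - by apply: agerm_mul => //; exact: agerm_coord.
  - by apply: agerm_mul => //; exact: agerm_mono.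
  apply: filterS2 hE fE => x /= hE; rewrite mono_cons -mulrA => <-.
  rewrite mulrA mulr_sumr; apply: eq_bigr => k _.
  by rewrite hE exprMn expr2.
(* A factor [x i] remains on the left, so [i] occurs a second time: the sum of squares loses two
   factors while [h] loses one. *)
have is_ : i \in s.
  apply: contrapT => /negP si.
  have := filterI (near0_upd i fE1) (near0_upd i (agerm_neq0 ug u0)).
  case=> r r0 rP.
  have [|/= h1 h2] := rP (fun=> r); first by move=> ?; rewrite gtr0_norm.
  move: h1; rewrite {1}/upd eqxx mul0r => /esym/eqP;
    rewrite mulf_eq0 => /orP[|].
    rewrite /mono prodf_seq_eq0 => /hasP[j js] /=; rewrite /upd.
    have [ji|_] := eqVneq j i; first by move: si; rewrite -ji js.
    by rewrite gt_eqF.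
  rewrite -normr_eq0 gt_eqF// (lt_le_trans _ h2)//.
  by rewrite divr_gt0// normr_gt0.
have [||t [g [gg g0 gE]]] := IH (rem i s) h hg.
- apply: (@near0_cancel _ _ _ i) => //.
    by apply: agerm_mul => //; exact: agerm_mono.
  apply: filterS fE1 => x /= ->; rewrite mulrA; congr (_ * _).
  by rewrite -mono_cons /mono (perm_big _ (perm_to_rem is_)).
- rewrite size_rem//; case: (s) sn is_ => //= _ s' sn _; exact: ltnW.
exists (i :: t), g; split=> //.
by apply: filterS2 hE gE => x /= hE gE k; rewrite hE gE mono_cons mulrA.
Qed.

(** A power vanishes on a coordinate hyperplane only if its base does, so the monomial can be
    divided out of [c] one coordinate at a time. *)
Lemma factor_mono_root (I : eqType) (s : seq I) (e : nat) (c g : (I -> R) -> R)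
  :
  (0 < e)%N -> agerm c -> agerm g ->
  near0 [set x | c x ^+ e = mono s x ^+ e * g x] ->
  exists c', [/\ agerm c', near0 [set x | c x = mono s x * c' x] &
    near0 [set x | c' x ^+ e = g x]].
Proof.
move=> e0 cg gg; elim: s => [|i s IH] in c cg *.
  move=> cE; exists c; split=> //.
    by apply: filterE => x /=; rewrite /mono big_nil mul1r.
  by apply: filterS cE => x /= ->; rewrite /mono big_nil expr1n mul1r.
move=> cE; have [|h hg hE] := @agerm_factor_coord _ _ c i cg.
  apply: filterS (near0_upd i cE) => x /=.
  rewrite mono_cons exprMn {2}/upd eqxx expr0n gtn_eqF// !mul0r => /eqP.
  by rewrite expf_eq0 e0 => /eqP.
have [|c' [c'g hc' c'E]] := IH h hg.
  apply: (@near0_cancel_exp _ _ _ i e).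
  - exact: agerm_exp.
  - by apply: agerm_mul => //; apply: agerm_exp; exact: agerm_mono.
  apply: filterS2 hE cE => x /= hE; rewrite mono_cons exprMn -mulrA => <-.
  by rewrite hE exprMn.
exists c'; split=> //.
by apply: filterS2 hE hc' => x /= -> ->; rewrite mono_cons mulrA.
Qed.

End NormalCrossings.
(** * Lifting sequences along an ultrafilter *)

Section UltrafilterLimits.
Variables (R : realType) (U : set_system nat).
Context {UU : UltraFilter U}.

Lemma ultra_dichotomy (A : set nat) : U A \/ U (~` A).
Proof. exact: in_ultra_setVsetC. Qed.

Lemma ultra_exists (K : finType) (P : K -> set nat) :
  U [set k | exists i, P i k] -> exists i, U (P i).
Proof.
move=> UP; apply: contrapT => H.
have NP i : U (~` P i).
  by have [h|//] := ultra_dichotomy (P i); case: H; exists i.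
have UN : U [set k | forall i, ~ P i k].
  exact: (@filter_forall _ _ (fun i k => ~ P i k) U).
have [k [[i Pik] nP]] := filter_ex (filterI UP UN).
exact: nP Pik.
Qed.

Lemma ultra_lim (u : nat -> R) B : U [set k | `|u k| <= B] ->
  exists l, forall e, 0 < e -> U [set k | `|u k - l| <= e].
Proof.
move=> uB.
have FU : UltraFilter (u @ U).
  split; first exact: fmap_proper_filter.
  move=> G GG UG; apply/predeqP => A; split; last exact: UG.
  move=> GA; have [//|nA] := ultra_dichotomy (u @^-1` A).
  have GnA : G (~` A) by exact: UG.
  by have [y []] := filter_ex (filterI GA GnA).
have [l [_ ul]] : `[- B, B]%classic `&` cluster (u @ U) !=set0.
  apply: (@segment_compact R (- B) B).
  by apply: (@filterS _ U _ _ _ _ uB) => k /=; rewrite in_itv /= ler_norml.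
exists l => e e0.
have ull : u @ U --> l.
  by move: ul; rewrite ultra_cvg_clusterE.
have /cvgrPdist_le/(_ e e0) := ull.
by apply: filterS => k /=; rewrite distrC.
Qed.

(** Convergence to the origin along [U], phrased with [near0] so that identities of germs can be
    evaluated on the sequence. *)
Definition tends I (w : nat -> I -> R) :=
  forall P, near0 P -> U [set k | P (w k)].

Lemma tendsP (I : finType) (w : nat -> I -> R) :
  (forall i e, 0 < e -> U [set k | `|w k i| <= e]) -> tends w.
Proof.
move=> H P [r r0 Pr].
have wr : U [set k | forall i, `|w k i| <= r].
  by apply: (@filter_forall _ _ (fun i k => `|w k i| <= r) U) => i; exact: H.
by apply: filterS wr => k; exact: Pr.
Qed.

Lemma tends_coord I (w : nat -> I -> R) i e : tends w -> 0 < e ->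
  U [set k | `|w k i| <= e].
Proof.
by move=> wt e0; apply: (wt [set x | `|x i| <= e]); exists e => // x; exact.
Qed.

Lemma tends_agerm I (w : nat -> I -> R) f e : tends w -> agerm f -> 0 < e ->
  U [set k | `|f (w k) - f (fun=> 0)| <= e].
Proof.
move=> wt fg e0; apply: (wt [set x | `|f x - f (fun=> 0)| <= e]).
exact: agerm_near.
Qed.

Lemma tends_comp (I : finType) J (w : nat -> J -> R) (a : I -> (J -> R) -> R) :
  (forall i, agerm (a i)) -> (forall i, a i (fun=> 0) = 0) ->
  tends w -> tends (fun k i => a i (w k)).
Proof. by move=> ag a0 wt P /(near0_comp ag a0); exact: wt. Qed.

(* [monomializes F x]: after passing to [U], the sequence [x] lifts through an
   analytic chart in which [F] is in normal form.  Lifting one sequence along a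
   fixed ultrafilter replaces all finite coverings by charts. *)
Definition monomializes (I : finType) (F : (I -> R) -> R) (x : nat -> I -> R) :=
  exists (phi : I -> (I -> R) -> R) (w : nat -> I -> R),
  [/\ forall i, agerm (phi i), forall i, phi i (fun=> 0) = 0, tends w,
      U [set k | phi ^~ (w k) = x k] & normal (fun y => F (phi ^~ y))].

Lemma monomializes_normal (I : finType) (F : (I -> R) -> R) x :
  normal F -> tends x -> monomializes F x.
Proof.
move=> nF xt; exists (fun i y => y i), x; split => //.
- by move=> i; exact: agerm_coord.
- exact: filterE.
Qed.

Lemma monomializes_comp (I : finType) (F : (I -> R) -> R) x
    (phi : I -> (I -> R) -> R) (w : nat -> I -> R) :
  (forall i, agerm (phi i)) -> (forall i, phi i (fun=> 0) = 0) ->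
  U [set k | phi ^~ (w k) = x k] ->
  monomializes (fun y => F (phi ^~ y)) w -> monomializes F x.
Proof.
move=> phig phi0 phiw [psi [v [psig psi0 vt psiv nF]]].
exists (fun i y => phi i (psi ^~ y)), v; split => //.
- by move=> i; exact: agerm_comp.
- by move=> i /=; rewrite (_ : psi ^~ _ = fun=> 0)//; apply/funext.
- by apply: filterS2 phiw psiv => k /= <- <-.
Qed.

Lemma monomializes_ext (I : finType) (F G : (I -> R) -> R) x :
  near0 [set y | F y = G y] -> monomializes F x -> monomializes G x.
Proof.
move=> FG [phi [w [phig phi0 wt phiw nF]]]; exists phi, w; split => //.
by apply: normal_ext nF; exact: (near0_comp phig phi0 FG).
Qed.

Definition monomializable (I : finType) := forall (F : (I -> R) -> R) x,
  agerm F -> ~ near0 [set y | F y = 0] -> tends x -> monomializes F x.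

Lemma agerm_reindex I J (h : I -> J) (f : (I -> R) -> R) : agerm f ->
  agerm (fun x : J -> R => f (x \o h)).
Proof.
case=> r r0 [M fM]; exists r => //; exists M.
apply: abound_comp fM _; first by move=> _; exact: ltW.
by move=> i; exact: abound_coord.
Qed.

Lemma near0_reindex I J (h : I -> J) (P : set (I -> R)) : near0 P ->
  near0 [set x : J -> R | P (x \o h)].
Proof. by case=> r r0 Pr; exists r => // x xr; apply: Pr => i; exact: xr. Qed.

Lemma normal_reindex I J (h : I -> J) (f : (I -> R) -> R) : normal f ->
  normal (fun x : J -> R => f (x \o h)).
Proof.
move=> [s [u [ug u0 fE]]]; exists (map h s), (fun x => u (x \o h)); split => //.
  exact: agerm_reindex.
by apply: filterS (near0_reindex h fE) => x /= ->; rewrite mono_map.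
Qed.

Lemma monomializable_bij (I J : finType) (h : I -> J) (h' : J -> I) :
  cancel h h' -> cancel h' h -> monomializable I -> monomializable J.
Proof.
move=> hK h'K HI F x Fg F0 xt.
have [||w wE|phi [w [phig phi0 wt phiw nF]]] :=
  HI (fun y : I -> R => F (y \o h')) (fun k => x k \o h).
- exact: agerm_reindex.
- move=> /(near0_reindex h) H; apply: F0; apply: filterS H => y /=.
  by rewrite (_ : (y \o h) \o h' = y)//; apply/funext => j /=; rewrite h'K.
- by apply: (xt [set y : J -> R | w (y \o h)]); exact: near0_reindex.
exists (fun j z => phi (h' j) (z \o h)), (fun k => w k \o h'); split.
- by move=> j; exact: agerm_reindex.
- by move=> j; exact: phi0.
- by move=> P /(near0_reindex h') /wt.
- apply: filterS phiw => k /= e; apply/funext => j.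
  rewrite (_ : (w k \o h') \o h = w k); last by apply/funext => i /=;
    rewrite hK.
  by have := congr1 (fun f => f (h' j)) e; rewrite /= h'K.
- exact: (normal_reindex h nF).
Qed.

End UltrafilterLimits.
(** * Monomialization *)

Section Binomials.
Variable R : comNzRingType.

Lemma sum_exprD (n : nat) (c : nat -> R) (s t : R) :
  \sum_(i < n) c i * (s + t) ^+ i =
  \sum_(j < n) (\sum_(i < n) c i * s ^+ (i - j) *+ 'C(i, j)) * t ^+ j.
Proof.
under [RHS]eq_bigr do rewrite mulr_suml.
rewrite exchange_big /=; apply: eq_bigr => i _.
rewrite exprDn mulr_sumr (big_ord_widen n (fun j => c i * (s ^+ (i - j) * t ^+
  j *+ 'C(i, j)))) ?ltn_ord//.
rewrite big_mkcond /=; apply: eq_bigr => j _.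
case: ifP => [_|/negbT]; first by rewrite mulrnAr mulrnAl mulrA.
by rewrite -leqNgt => ij; rewrite bin_small// mulr0n mul0r.
Qed.

Lemma sum_bin_last (d : nat) (c : nat -> R) (s : R) :
  \sum_(i < d.+1) c i * s ^+ (i - d) *+ 'C(i, d) = c d.
Proof.
rewrite big_ord_recr /= subnn binn mulr1 mulr1n big1 ?add0r// => i _.
by rewrite bin_small// mulr0n.
Qed.

(** The factor [s ^+ 2] on the lower terms matters: their product with a unit reaches degree [d] in
    [t], but contributes nothing linear in [s] there. *)
Lemma exprD_last_terms (d : nat) (s t : R) :
  (s + t) ^+ d.+1 = s ^+ 2 * (\sum_(j < d) s ^+ (d.-1 - j) * t ^+ j *+ 'C(d.+1,
    j))
    + d.+1%:R * s * t ^+ d + t ^+ d.+1.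
Proof.
rewrite exprDn !big_ord_recr /= subnn binn mulr1n mul1r subSnn binSn expr1.
congr (_ + _ + _); last by rewrite -mulr_natl mulrA.
rewrite mulr_sumr; apply: eq_bigr => j _; rewrite mulrnAr mulrA -exprD.
by congr (_ ^+ _ * _ *+ _); have := ltn_ord j; lia.
Qed.

End Binomials.

(** * Tschirnhaus translation *)

Section Tschirnhaus.
Variables (R : realType) (I : finType).

(* The vanishing of the coefficient of order [d] of [f (x', s + t)] in [t] is
   an equation [c_d + s e = 0] for [s] with [e 0 = (d + 1) u 0]. *)
Lemma tschirnhaus (d : nat) (f : (option I -> R) -> R) c u :
  (forall j, agerm (c j)) -> agerm u -> c d (fun=> 0) = 0 -> u (fun=> 0) != 0 ->
  expands d.+1 c u f ->
  exists psi c' u', [/\ agerm psi /\ psi (fun=> 0) = 0,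
    forall j : nat, agerm (c' j), agerm u', u' (fun=> 0) != 0 &
    near0 [set x : option I -> R |
      f (ocons (x None + psi (otail x)) (otail x)) =
      \sum_(j < d) c' j (otail x) * x None ^+ j + x None ^+ d.+1 * u' x]].
Proof.
move=> cg ug cd0 u0 fE.
(* The translation is first made by a free amount [s], the variable [Some None], and expanded in
   [t], the variable [None]; [b] below substitutes [psi] for [s]. *)
pose sh (o : option I) (y : option (option I) -> R) :=
  if o is Some i then y (Some (Some i)) else y (Some None) + y None.
have shg o : agerm (sh o).
  case: o => [i|]; first exact: agerm_coord.
  by apply: agerm_add; exact: agerm_coord.
have sh0 o : sh o (fun=> 0) = 0 by case: o => [i|] //=; rewrite addr0.
pose uh y := u (sh ^~ y).
have uhg : agerm uh by exact: agerm_comp.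
have [ucoef [u1 [ucoefg u1g uhE]]] := agerm_expand 1 uhg.
pose P (y : option (option I) -> R) :=
  \sum_(j < d) y (Some None) ^+ (d.-1 - j) * y None ^+ j *+ 'C(d.+1, j).
have Pg : agerm P.
  apply: agerm_sum => j _.
  rewrite (_ : (fun _ => _) = fun y : option (option I) -> R => y (Some None)
    ^+ (d.-1 - j) *
      y None ^+ j * 'C(d.+1, j)%:R); last by apply/funext => y;
        rewrite mulr_natr.
  apply: agerm_mul; last exact: agerm_cst.
  by apply: agerm_mul; apply: agerm_exp; exact: agerm_coord.
have [r [v [rg vg PE]]] := agerm_expand d.+1 (agerm_mul Pg uhg).
pose e (z : option I -> R) := d.+1%:R * ucoef 0%N z + z None * r d z.
have eg : agerm e.
  apply: agerm_add; first by apply: agerm_mul => //; exact: agerm_cst.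
  by apply: agerm_mul => //; exact: agerm_coord.
have uh0 : uh (fun=> 0) = u (fun=> 0).
  by rewrite /uh (_ : sh ^~ _ = fun=> 0)//; apply/funext.
have ucoef0 : ucoef 0%N (fun=> 0) = u (fun=> 0).
  by have := near0_at0 uhE; rewrite /= big_ord1 expr0 mulr1 mul0r addr0 uh0 =>
    ->.
have [|psi [psig psi0 psiE]] := implicit_function (cg d) eg cd0.
  by rewrite /e ucoef0 mul0r addr0 mulf_neq0// pnatr_eq0.
have agerm_at_psi (g : (option I -> R) -> R) : agerm g ->
    agerm (fun x => g (ocons (psi x) x)).
  move=> gg; apply: (@agerm_comp _ _ _ (fun o x => ocons (psi x) x o)) => //.
    by case=> [i|] //=; exact: agerm_coord.
  by case.
pose b (o : option (option I)) (x : option I -> R) :=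
  ocons (x None) (ocons (psi (otail x)) (otail x)) o.
have bg o : agerm (b o).
  by case: o => [[i|]|] /=; [exact: agerm_coord|exact: agerm_otail|exact:
    agerm_coord].
have b0 o : b o (fun=> 0) = 0 by case: o => [[i|]|].
pose c' j (x : I -> R) := \sum_(i < d.+1) c i x * psi x ^+ (i - j) * 'C(i,
  j)%:R +
  psi x ^+ 2 * r j (ocons (psi x) x).
(* The three sources of [t ^+ d.+1]: the top power itself, the term [t ^+ d] times the part of the
   unit divisible by [t], and the remainder of the [s ^+ 2] terms. *)
pose V y := uh y + d.+1%:R * y (Some None) * u1 y + y (Some None) ^+ 2 * v y.
have Vg : agerm V.
  apply: agerm_add; [apply: agerm_add => //|]; apply: agerm_mul => //.
    by apply: agerm_mul; [exact: agerm_cst|exact: agerm_coord].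
  by apply: agerm_exp; exact: agerm_coord.
exists psi, c', (fun x => V (b ^~ x)); split.
- by [].
- move=> j; apply: agerm_add; last first.
    by apply: agerm_mul; [exact: agerm_exp|exact: agerm_at_psi].
  apply: agerm_sum => i _; apply: agerm_mul; last exact: agerm_cst.
  by apply: agerm_mul => //; exact: agerm_exp.
- exact: agerm_comp.
- rewrite (_ : b ^~ _ = fun=> 0); last by apply/funext.
  by rewrite /V uh0 expr0n /= mulr0 !mul0r !addr0.
have fE' : near0 [set y | f (sh ^~ y) =
    \sum_(j < d.+1) c j (otail (sh ^~ y)) * sh None y ^+ j
    + sh None y ^+ d.+1 * uh y].
  exact: (near0_comp shg sh0 fE).
have H1 := near0_comp bg b0 fE'; have H2 := near0_comp bg b0 uhE.
have H3 := near0_comp bg b0 PE.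
apply: filterS2 (near0_otail psiE) (filterI H1 (filterI H2 H3)) => x /= psix
  [fx [uhx Px]].
have -> : ocons (x None + psi (otail x)) (otail x) = sh ^~ (b ^~ x).
  by apply/funext => -[i|] //=; rewrite addrC.
set t := x None; set s := psi (otail x).
have -> : f (sh ^~ (b ^~ x)) = \sum_(j < d.+1) c j (otail x) * (s + t) ^+ j +
    (s + t) ^+ d.+1 * uh (b ^~ x) by exact: fx.
rewrite (sum_exprD _ (fun j => c j (otail x))) exprD_last_terms.
rewrite big_ord_recr /= (sum_bin_last _ (fun j => c j (otail x))).
have bz : otail (b ^~ x) = ocons s (otail x) by apply/funext => -[].
have {}Px : P (b ^~ x) * uh (b ^~ x) = \sum_(j < d) r j (ocons s (otail x)) * t
  ^+ j +
   r d (ocons s (otail x)) * t ^+ d + t ^+ d.+1 * v (b ^~ x).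
  by rewrite Px big_ord_recr /= bz.
have {}uhx : uh (b ^~ x) = ucoef 0%N (ocons s (otail x)) + t * u1 (b ^~ x).
  by rewrite uhx big_ord1 /= bz expr0 mulr1 expr1.
have -> : \sum_(j < d) s ^+ (d.-1 - j) * t ^+ j *+ 'C(d.+1, j) = P (b ^~ x) by
  [].
have -> : \sum_(j < d) c' j (otail x) * t ^+ j =
  \sum_(j < d) (\sum_(i < d.+1) c i (otail x) * s ^+ (i - j) *+ 'C(i, j)) * t
    ^+ j
  + s ^+ 2 * \sum_(j < d) r j (ocons s (otail x)) * t ^+ j.
  rewrite mulr_sumr -big_split; apply: eq_bigr => j _ /=;
    rewrite /c' mulrDl mulrA.
  by congr (_ * _ + _); apply: eq_bigr => i _; rewrite mulr_natr.
have psix' : c d (otail x) + s * (d.+1%:R * ucoef 0%N (ocons s (otail x)) + s *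
  r d (ocons s (otail x))) = 0.
  exact: psix.
rewrite !mulrDl -(mulrA (s ^+ 2)) Px {1}uhx /V.
have -> : (b ^~ x) (Some None) = s by [].
have -> : c d (otail x) = - (s * (d.+1%:R * ucoef 0%N (ocons s (otail x)) + s *
  r d (ocons s (otail x)))).
  by apply/eqP; rewrite -addr_eq0 psix'.
rewrite (exprSr t d); ring.
Qed.

End Tschirnhaus.

(** * Tools for the monomial charts *)

Section ToricStep.
Variable R : realType.

Lemma mono_split (I : eqType) (s : seq I) i (x : I -> R) :
  mono s x = x i ^+ count_mem i s * mono [seq j <- s | j != i] x.
Proof.
elim: s => [|j s IH]; first by rewrite /mono !big_nil mulr1.
rewrite /= mono_cons IH; have [->|ji] := eqVneq j i.
  by rewrite add1n exprS mulrA.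
by rewrite add0n mono_cons mulrCA.
Qed.

Lemma eq_mono (I : eqType) (s : seq I) (x y : I -> R) :
  {in s, x =1 y} -> mono s x = mono s y.
Proof. by move=> xy; apply: eq_big_seq. Qed.

Lemma mono0 (I : Type) (s : seq I) : s <> [::] -> mono s (fun=> 0 : R) = 0.
Proof. by case: s => // i s _; rewrite mono_cons mul0r. Qed.

Lemma normal_comp (I : finType) J (f : (I -> R) -> R) (a : I -> (J -> R) -> R) :
  normal f -> (forall i, normal (a i)) -> (forall i, a i (fun=> 0) = 0) ->
  normal (fun y => f (a ^~ y)).
Proof.
move=> [s [u [ug u0 fE]]] an a0.
have ag i : agerm (a i) by exact: normal_agerm.
apply: (@normal_ext _ _ (fun y => mono s (a ^~ y) * u (a ^~ y))).
  by apply: filterS (near0_comp ag a0 fE) => y /= ->.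
apply: normal_mul; last first.
  apply: normal_unit; first exact: agerm_comp.
  by rewrite (_ : a ^~ _ = fun=> 0)//; apply/funext.
elim: s {fE} => [|i s IH].
  apply: (@normal_ext _ _ (fun=> 1)).
    by apply: filterE => y /=; rewrite /mono big_nil.
  by apply: normal_unit; [exact: agerm_cst|exact: oner_neq0].
apply: normal_ext (normal_mul (an i) IH).
by apply: filterE => y /=; rewrite mono_cons.
Qed.

Lemma normal_scale (I : Type) (c : R) (f : (I -> R) -> R) : c != 0 ->
  normal f -> normal (fun x => c * f x).
Proof.
move=> c0 nf; apply: normal_mul => //.
by apply: normal_unit => //; exact: agerm_cst.
Qed.

Lemma normal_coord_exp (I : Type) (i : I) n : normal (fun x : I -> R => x i ^+
  n).
Proof.
apply: normal_ext (normal_mono R (nseq n i)).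
by apply: filterE => x /=; rewrite mono_nseq.
Qed.

Lemma real_root (a : R) n : (0 < n)%N -> 0 <= a ->
  exists2 r, 0 <= r & r ^+ n = a.
Proof.
move=> n0 a0; exists (a `^ n%:R^-1); first exact: powR_ge0.
rewrite -powR_mulrn ?powR_ge0// -powRrM mulVf ?pnatr_eq0 -?lt0n//.
by rewrite powRr1.
Qed.

Lemma regular0 I (f : (option I -> R) -> R) : agerm f -> f (fun=> 0) != 0 ->
  regular 0 f.
Proof.
move=> fg f0; exists (fun _ _ => 0), f; split => //.
  by move=> j; exact: agerm_cst.
by apply: filterE => x /=; rewrite big_ord0 add0r mul1r.
Qed.

(* A polynomial of degree [d + 1] without term of degree [d] is not
   [u0 (t - z0) ^ (d + 1)] unless [z0 = 0]. *)
Lemma shifted_order_drop (I : eqType) (d : nat) (g : (option I -> R) -> R)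
    (a : nat -> R) (z0 u0 e : R) :
  agerm g -> z0 != 0 -> u0 != 0 -> 0 < e ->
  (forall t, `|t| <= e -> g (ocons t (fun=> 0)) =
     \sum_(j < d) a j * (z0 + t) ^+ j + (z0 + t) ^+ d.+1 * u0) ->
  exists2 d', (d' < d.+1)%N & regular d' g.
Proof.
move=> gg z00 u00 e0 gE.
have [c [u [cg ug gc]]] := agerm_expand d.+1 gg.
have [[j jd cj0]|call0] := pselect (exists2 j, (j < d.+1)%N & c j (fun=> 0) !=
  0).
  exact: regular_lower cg ug gc jd cj0.
pose a' j := if (j < d)%N then a j else if (j == d.+1)%N then u0 else 0.
pose b j := \sum_(i < d.+2) a' i * z0 ^+ (i - j) *+ 'C(i, j).
have aE t : \sum_(j < d) a j * (z0 + t) ^+ j + (z0 + t) ^+ d.+1 * u0 =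
    \sum_(j < d.+1) b j * t ^+ j + t ^+ d.+1 * u0.
  transitivity (\sum_(j < d.+2) a' j * (z0 + t) ^+ j).
    rewrite !big_ord_recr /= {2 3}/a' ltnn ltn_eqF//= mul0r addr0.
    rewrite ltnNge leqnSn eqxx /= [u0 * _]mulrC; congr (_ + _).
    by apply: eq_bigr => j _; rewrite /a' ltn_ord.
  rewrite sum_exprD big_ord_recr /=; congr (_ + _).
  by rewrite sum_bin_last /a' ltnNge leqnSn eqxx /= mulrC.
(* If all the coefficients of [g] below [d.+1] vanished at the origin, [h] would vanish along the
   axis; but its coefficient [b d = (d + 1) u0 z0] is nonzero. *)
pose h (y : option I -> R) :=
  \sum_(j < d.+1) b j * y None ^+ j + y None ^+ d.+1 * (u0 - u y).
have bd : b d != 0.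
  rewrite /b 2!big_ord_recr /= big1 => [|i _];
    last by rewrite bin_small// mulr0n.
  rewrite {1 2}/a' ltnn ltn_eqF// mul0r mul0rn ltnNge leqnSn eqxx /= !add0r.
  by rewrite subSnn expr1 binSn mulrn_eq0 /= mulf_neq0.
have [|||d' _ rd] := @regular_lower _ _ d.+1 h (fun j _ => b j) (fun y => u0 -
  u y) d
  _ _ _ (leqnn _) bd.
- by move=> j; exact: agerm_cst.
- by apply: agerm_sub => //; exact: agerm_cst.
- exact: filterE.
have [r r0 rP] := gc; pose e' := Num.min e r.
have e'0 : 0 < e' by rewrite lt_min e0.
case: (regular_line rd e'0) => t te.
have tr : `|t| <= r by rewrite (le_trans te)// ge_min lexx orbT.
have tp i : `|ocons t (fun _ : I => 0) i| <= r.
  by case: i => [i|] //=; rewrite normr0 ltW.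
have /= := rP _ tp; rewrite gE; last by rewrite (le_trans te)// ge_min lexx.
rewrite aE [X in _ = X + _]big1 => [|j _]; last first.
  rewrite [otail _](_ : _ = fun=> 0)//;
    have [->|cj] := eqVneq (c j (fun=> 0)) 0.
    by rewrite mul0r.
  by case: call0; exists j.
by rewrite add0r /h /= mulrBr addrA => ->; rewrite subrr.
Qed.

End ToricStep.

(** * Toric charts that lower the order in one variable *)

Section Toric.
Variables (R : realType) (U : set_system nat).
Context {UU : UltraFilter U}.

(** The factor [m] in the other variables must become normal in the same chart as [f]; it also
    absorbs the exceptional monomials of the charts. *)
Definition order_step (I : finType) d := forall (f : (option I -> R) -> R)
    (m : (I -> R) -> R) x,
  agerm m -> ~ near0 [set y | m y = 0] -> regular d f -> tends U x ->
  monomializes U (fun y => m (otail y) * f y) x.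

Lemma tends_otail (I : finType) (x : nat -> option I -> R) :
  tends U x -> tends U (fun k => otail (x k)).
Proof. by move=> xt P /near0_otail /xt. Qed.

Section Step.
Variables (I : finType) (d : nat).
Hypothesis lower_orders : forall d', (d' < d.+1)%N -> order_step I d'.

(** Homogeneity of degree [d.+1] in [mono s] and the variable [None] together: a power of [w_i]
    drawn from both factors out of [f]. *)
Definition weighted (s : seq I) c u (f : (option I -> R) -> R) :=
  near0 [set y : option I -> R | f y =
    \sum_(j < d) c j (otail y) * mono s (otail y) ^+ (d.+1 - j) * y None ^+ j
    + y None ^+ d.+1 * u y].

Lemma monomializes_lower d' (m : (I -> R) -> R) f x : (d' < d.+1)%N ->
  normal m -> regular d' f -> tends U x ->
  monomializes U (fun y => m (otail y) * f y) x.
Proof.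
move=> d'd nm rf xt; apply: (lower_orders d'd) => //; first exact: normal_agerm.
exact: normal_not_near0.
Qed.

(* Here the coordinate [t] is at most of the size of [w_i ^ delta], and the
   chart is [t = w_i ^ delta (z0 + z)]. *)
Lemma toric_small_step (s : seq I) (i : I) (C : R)
    (c : nat -> (I -> R) -> R) u f (m : (I -> R) -> R) x :
  (forall s' u' f' (m' : (I -> R) -> R) x', (size s' < size s)%N ->
     agerm u' -> u' (fun=> 0) != 0 -> weighted s' c u' f' -> normal m' ->
     tends U x' -> monomializes U (fun y => m' (otail y) * f' y) x') ->
  i \in s ->
  U [set k | `|x k None| <= C * `|x k (Some i)| ^+ count_mem i s] ->
  (forall j, agerm (c j)) -> agerm u -> u (fun=> 0) != 0 ->
  weighted s c u f -> normal m -> tends U x ->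
  monomializes U (fun y => m (otail y) * f y) x.
Proof.
move=> IH is_ xC cg ug u0 fE nm xt.
set delta := count_mem i s in xC *.
have delta0 : (0 < delta)%N by rewrite -has_count has_pred1.
(* Where [w_i = 0] the bound [xC] forces [t = 0], so any value of the ratio is correct. *)
pose z k := if x k (Some i) == 0 then 0 else x k None / x k (Some i) ^+ delta.
have zC : U [set k | `|z k| <= `|C|].
  apply: filterS xC => k /=; rewrite /z; case: eqP => [_ _|/eqP xi0 h].
    by rewrite normr0.
  rewrite normrM normfV normrX ler_pdivrMr ?exprn_gt0 ?normr_gt0//.
  by rewrite (le_trans h)// ler_wpM2r ?exprn_ge0// ler_norm.
have [z0 zz0] := ultra_lim zC.
pose phi (o : option I) (y : option I -> R) :=
  if o is Some l then y (Some l) else y (Some i) ^+ delta * (z0 + y None).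
have phig o : agerm (phi o).
  case: o => [l|]; first exact: agerm_coord.
  apply: agerm_mul; first by apply: agerm_exp; exact: agerm_coord.
  by apply: agerm_add; [exact: agerm_cst|exact: agerm_coord].
have phi0 o : phi o (fun=> 0) = 0.
  by case: o => [l|] //=; rewrite expr0n gtn_eqF// mul0r.
pose w k := ocons (z k - z0) (otail (x k)).
have wt : tends U w.
  apply: tendsP => -[l|] e e0; first exact: (tends_coord (Some l) xt e0).
  exact: zz0.
apply: (@monomializes_comp _ _ _ _ _ _ phi w) => //.
  apply: filterS xC => k /= xCk; apply/funext => -[l|] //=.
  rewrite addrC subrK /z /otail; case: eqP => [xi0|/eqP xi0].
    move: xCk; rewrite xi0 normr0 expr0n gtn_eqF// !mulr0 normr_le0 => /eqP ->.
    by [].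
  by rewrite mulrC divfK// expf_neq0.
pose s2 := [seq j <- s | j != i].
pose g (y : option I -> R) :=
  \sum_(j < d) c j (otail y) * mono s2 (otail y) ^+ (d.+1 - j) * (z0 + y None)
    ^+ j
  + (z0 + y None) ^+ d.+1 * u (phi ^~ y).
have gg : agerm g.
  have zg : agerm (fun y : option I -> R => z0 + y None).
    by apply: agerm_add; [exact: agerm_cst|exact: agerm_coord].
  apply: agerm_add.
    apply: agerm_sum => j _; apply: agerm_mul; last exact: agerm_exp.
    apply: agerm_mul; first exact: agerm_otail.
    by apply: agerm_exp; apply: agerm_otail; exact: agerm_mono.
  by apply: agerm_mul; [exact: agerm_exp|exact: agerm_comp].
pose m' (x : I -> R) := m x * x i ^+ (delta * d.+1).
have nm' : normal m' by apply: normal_mul => //; exact: normal_coord_exp.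
apply: (@monomializes_ext _ _ _ (fun y => m' (otail y) * g y)).
  apply: filterS (near0_comp phig phi0 fE) => y /= ->.
  rewrite /m' -mulrA; congr (_ * _); rewrite /g mulrDr.
  rewrite exprMn -exprM mulrA; congr (_ + _).
  rewrite mulr_sumr; apply: eq_bigr => j _.
  have jd : (j <= d.+1)%N by rewrite ltnW// ltnS ltnW.
  have -> : (delta * d.+1 = delta * (d.+1 - j) + delta * j)%N.
    by rewrite -mulnDr subnK.
  rewrite (mono_split s i) -/delta -/s2 exprD !exprMn -!exprM.
  by rewrite /otail; ring.
(* If [z0 = 0] the shape persists with fewer factors in [s]. If [z0 != 0] and no factor is left, the
   missing term of degree [d] makes the order drop. If [z0 != 0] and factors remain, only the top
   term survives at the origin and [g] is a unit. *)
have [z00|z00] := eqVneq z0 0.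
  apply: (IH s2 (fun y => u (phi ^~ y)) g m' w) => //.
  - by rewrite size_filter -(count_predC (pred1 i) s) -[ltnLHS]add0n ltn_add2r.
  - exact: agerm_comp.
  - by rewrite (_ : phi ^~ _ = fun=> 0)//; apply/funext.
  - by apply: filterE => y /=; rewrite /g z00 !add0r.
have [s20|s20] := eqVneq s2 [::].
  have [|d' d'd rd] := @shifted_order_drop _ _ d g (fun j => c j (fun=> 0)) z0
      (u (fun=> 0)) 1 gg z00 u0 ltr01.
    move=> t _; rewrite /g s20 /=; congr (_ + _ * _).
      by apply: eq_bigr => j _; rewrite /mono big_nil expr1n mulr1.
    congr u; apply/funext => -[l|] //=.
    by rewrite expr0n gtn_eqF// mul0r.
  exact: (monomializes_lower d'd).
apply: (@monomializes_lower 0%N) => //; apply: regular0 => //.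
rewrite /g /= addr0 big1 => [|j _]; last first.
  rewrite [otail _](_ : _ = fun=> 0)// mono0; last exact/eqP.
  have := ltn_ord j => jd.
  by rewrite expr0n subn_eq0 leqNgt (ltn_trans jd)// mulr0 mul0r.
rewrite add0r mulf_neq0 ?expf_neq0// (_ : phi ^~ _ = fun=> 0)//.
exact/funext.
Qed.

(* Here [t] dominates [w_i ^ delta], and the chart is
   [t = sgn v ^ delta], [w_i = v w'_i]. *)
Lemma toric_large_step (s : seq I) (i : I)
    (c : nat -> (I -> R) -> R) u f (m : (I -> R) -> R) x :
  i \in s ->
  (forall C, U [set k | C * `|x k (Some i)| ^+ count_mem i s < `|x k None|]) ->
  (forall j, agerm (c j)) -> agerm u -> u (fun=> 0) != 0 ->
  weighted s c u f -> normal m -> tends U x ->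
  monomializes U (fun y => m (otail y) * f y) x.
Proof.
move=> is_ xC cg ug u0 fE nm xt.
set delta := count_mem i s in xC *.
have delta0 : (0 < delta)%N by rewrite -has_count has_pred1.
have x0 : U [set k | 0 < `|x k None|].
  by apply: filterS (xC 0) => k /=; rewrite mul0r.
have [sg [sg1 xsg]] : exists sg : R, `|sg| = 1 /\
    U [set k | x k None = sg * `|x k None|].
  have [h|h] := ultra_dichotomy (U := U) [set k | 0 <= x k None].
    exists 1; split; first exact: normr1.
    by apply: filterS h => k /= h; rewrite mul1r ger0_norm.
  exists (-1); split; first exact: normrN1.
  apply: filterS h => k /= /negP; rewrite -ltNge => h.
  by rewrite mulN1r ltr0_norm// opprK.
have [v vP] : {v : nat -> R & forall k, 0 <= v k /\ v k ^+ delta = `|x k None|}.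
  apply: (@choice _ _ (fun k v => 0 <= v /\ v ^+ delta = `|x k None|)) => k.
  by have [r] := real_root delta0 (normr_ge0 (x k None)); exists r.
pose phi (o : option I) (y : option I -> R) :=
  if o is Some l then if l == i then y None * y (Some i) else y (Some l)
  else sg * y None ^+ delta.
have nphi o : normal (phi o).
  rewrite /phi; case: o => [l|].
    case: (l == i); last exact: (normal_coord R (Some l)).
    exact: (normal_mul (normal_coord R None) (normal_coord R (Some i))).
  by apply: normal_scale; rewrite -?normr_gt0 ?sg1//; exact: normal_coord_exp.
have phig o : agerm (phi o) by exact: normal_agerm.
have phi0 o : phi o (fun=> 0) = 0.
  case: o => [l|] /=; first by case: ifP => //; rewrite mul0r.
  by rewrite expr0n gtn_eqF// mulr0.
pose w k (o : option I) :=
  if o is Some l then if l == i then x k (Some i) / v k else x k (Some l) else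
    v k.
have v0 : U [set k | 0 < v k].
  apply: filterS x0 => k /=; have [vk0 <-] := vP k.
  by move=> h; rewrite lt0r vk0 andbT; apply: contraTneq h => ->;
    rewrite expr0n gtn_eqF// ltxx.
have wt : tends U w.
  apply: tendsP => -[l|] e e0 /=.
    have [_|li] := eqVneq l i; last exact: (tends_coord (Some l) xt e0).
    (* For this [C] the domination reads [|w_i|^delta < (e v)^delta]. *)
    apply: filterS2 v0 (xC (e^-1 ^+ delta)) => k /= vk0 xCk.
    rewrite normrM normfV (gtr0_norm vk0) ler_pdivrMr//.
    rewrite -(@ler_pXn2r _ delta) ?nnegrE ?mulr_ge0 ?(ltW e0) ?(ltW vk0)//.
    rewrite exprMn; have [_ ->] := vP k.
    by move: xCk; rewrite exprVn mulrC ltr_pdivrMr ?exprn_gt0// mulrC => /ltW.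
  have ed : 0 < e ^+ delta by rewrite exprn_gt0.
  apply: filterS (tends_coord None xt ed) => k /=.
  have [vk0 <-] := vP k; rewrite ger0_norm//.
  by rewrite ler_pXn2r ?nnegrE// ltW.
apply: (@monomializes_comp _ _ _ _ _ _ phi w) => //.
  apply: filterS2 v0 xsg => k /= vk0 xk; apply/funext => -[l|] /=.
    rewrite eqxx; have [->|//] := eqVneq l i.
    by rewrite mulrC divfK// gt_eqF.
  by have [_ ->] := vP k.
apply: monomializes_normal => //; apply: normal_mul.
  apply: (@normal_comp _ _ _ m (fun l => phi (Some l))) => //.
(* The cofactor of the extracted power of [v]. Its terms with [j < d] still contain [mono s], which
   vanishes at the origin, so [B] is a unit. *)
pose B (y : option I -> R) :=
  \sum_(j < d) c j (otail (phi ^~ y)) * mono s (otail y) ^+ (d.+1 - j) * sg ^+ j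
  + sg ^+ d.+1 * u (phi ^~ y).
have ophi0 : otail (phi ^~ (fun=> 0)) = fun=> 0.
  by apply/funext => l; rewrite /otail phi0.
have nB : normal B.
  apply: normal_unit.
    apply: agerm_add; last by apply: agerm_mul;
      [exact: agerm_cst|exact: agerm_comp].
    apply: agerm_sum => j _; apply: agerm_mul; last exact: agerm_cst.
    apply: agerm_mul.
      by apply: (@agerm_comp _ _ _ (fun l => phi (Some l))) => // l;
        exact: phi0.
    by apply: agerm_exp; apply: agerm_otail; exact: agerm_mono.
  rewrite /B big1 => [|j _]; last first.
    rewrite [otail (fun=> _)](_ : _ = fun=> 0)// mono0; last first.
      by move=> s0; move: is_; rewrite s0.
    have := ltn_ord j => jd.
    by rewrite expr0n subn_eq0 leqNgt (ltn_trans jd)// mulr0 mul0r.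
  rewrite add0r (_ : phi ^~ _ = fun=> 0); last exact/funext.
  by rewrite mulf_neq0// expf_neq0// -normr_gt0 sg1.
apply: (@normal_ext _ _ (fun y => y None ^+ (delta * d.+1) * B y)); last first.
  by apply: normal_mul => //; exact: normal_coord_exp.
apply: filterS (near0_comp phig phi0 fE) => y /= ->.
rewrite /B mulrDr exprMn -exprM; congr (_ + _); last first.
  by rewrite mulrA; congr (_ * _); exact: mulrC.
rewrite mulr_sumr; apply: eq_bigr => j _.
have jd : (j <= d.+1)%N by rewrite ltnW// ltnS ltnW.
have -> : (delta * d.+1 = delta * (d.+1 - j) + delta * j)%N.
  by rewrite -mulnDr subnK.
have -> : mono s (otail (phi ^~ y)) = y None ^+ delta * mono s (otail y).
  rewrite (mono_split s i) [in RHS](mono_split s i) -/delta mulrA -exprMn.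
  rewrite {1}/otail /= eqxx; congr (_ * _); apply: eq_mono => l.
  by rewrite mem_filter /otail /= => /andP[/negbTE -> _].
by rewrite exprD !exprMn -!exprM; ring.
Qed.

(** Induction on the length of [s]. Once [s] is empty, the coefficient [c j] that is nonzero at the
    origin makes the order drop. Otherwise the sequence either satisfies [|t| <= C |w_i|^delta] for
    some [C], or the reverse for every [C]. *)
Lemma toric (s : seq I) (c : nat -> (I -> R) -> R) u f (m : (I -> R) -> R) x :
  (forall j, agerm (c j)) -> (exists2 j, (j < d)%N & c j (fun=> 0) != 0) ->
  agerm u -> u (fun=> 0) != 0 -> weighted s c u f -> normal m -> tends U x ->
  monomializes U (fun y => m (otail y) * f y) x.
Proof.
move=> cg [j jd cj0]; have [n] := ubnP (size s).
elim: n => // n IH in s u f m x *; rewrite ltnS => sn ug u0 fE nm xt.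
case: s => [|i s] in sn fE *.
  pose c' j := if (j < d)%N then c j else fun=> 0.
  have c'g l : agerm (c' l).
    by rewrite /c'; case: ifP => // _; exact: agerm_cst.
  have fE' : expands d.+1 c' u f.
    apply: filterS fE => y /= ->; rewrite big_ord_recr /= /c' ltnn mul0r addr0.
    congr (_ + _); apply: eq_bigr => l _; rewrite ltn_ord /mono big_nil.
    by rewrite expr1n mulr1.
  have c'j0 : c' j (fun=> 0) != 0 by rewrite /c' jd.
  have [d' d'd rd] := regular_lower c'g ug fE' (ltnW jd) c'j0.
  exact: (monomializes_lower d'd).
have is_ : i \in i :: s by rewrite mem_head.
have [[C xC]|nC] := pselect (exists C,
    U [set k | `|x k None| <= C * `|x k (Some i)| ^+ count_mem i (i :: s)]).
  apply: (toric_small_step _ is_ xC cg ug u0) => //.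
  move=> s' u' f' m' x' s's; apply: IH; exact: leq_trans s's sn.
apply: (toric_large_step is_ _ cg ug u0 fE) => // C.
have [h|] := ultra_dichotomy (U := U)
    [set k | `|x k None| <= C * `|x k (Some i)| ^+ count_mem i (i :: s)].
  by case: nC; exists C.
by apply: filterS => k /= /negP; rewrite -ltNge.
Qed.

End Step.
End Toric.

(** * Induction on the order and on the number of variables *)

Section Monomialization.
Variables (R : realType) (U : set_system nat).
Context {UU : UltraFilter U}.

Lemma ultra_signed_roots (w : nat -> R) D : (0 < D)%N ->
  exists (sg : R) (v : nat -> R), [/\ `|sg| = 1,
    forall k, 0 <= v k, forall k, v k ^+ D = `|w k| &
    U [set k | w k = sg * v k ^+ D]].
Proof.
move=> D0.
have [v vP] : {v : nat -> R & forall k, 0 <= v k /\ v k ^+ D = `|w k|}.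
  apply: (@choice _ _ (fun k v => 0 <= v /\ v ^+ D = `|w k|)) => k.
  by have [r] := real_root D0 (normr_ge0 (w k)); exists r.
have [h|h] := ultra_dichotomy (U := U) [set k | 0 <= w k].
  exists 1, v; split; [exact: normr1|by move=> k; have [] := vP k|by move=> k;
    have [] := vP k|].
  apply: filterS h => k /= h; have [_ ->] := vP k.
  by rewrite mul1r ger0_norm.
exists (-1), v; split; [exact: normrN1|by move=> k;
  have [] := vP k|by move=> k; have [] := vP k|].
apply: filterS h => k /= /negP; rewrite -ltNge => h; have [_ ->] := vP k.
by rewrite mulN1r ltr0_norm// opprK.
Qed.

Section LiftChart.
Variables (I : finType) (phi : I -> (I -> R) -> R) (w : nat -> I -> R).
Variable x : nat -> option I -> R.
Hypotheses (phig : forall i, agerm (phi i)) (phi0 : forall i, phi i (fun=> 0) =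
  0).
Hypotheses (wt : tends U w) (phiw : U [set k | phi ^~ (w k) = otail (x k)]).
Hypothesis xt : tends U x.

Definition ochart (o : option I) (y : option I -> R) :=
  if o is Some i then phi i (otail y) else y None.

Definition oseq k := ocons (x k None) (w k).

Lemma agerm_ochart o : agerm (ochart o).
Proof. by case: o => [i|]; [exact: agerm_otail|exact: agerm_coord]. Qed.

Lemma ochart0 o : ochart o (fun=> 0) = 0.
Proof. by case: o => [i|] //; exact: phi0. Qed.

Lemma tends_oseq : tends U oseq.
Proof.
apply: tendsP => -[i|] e e0; first exact: (tends_coord i wt e0).
exact: (tends_coord None xt e0).
Qed.

Lemma monomializes_ochart (F : (option I -> R) -> R) :
  monomializes U (fun y => F (ochart ^~ y)) oseq -> monomializes U F x.
Proof.
apply: monomializes_comp; [exact: agerm_ochart|exact: ochart0|].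
apply: filterS phiw => k /= e; apply/funext => -[i|] //=.
exact: (congr1 (fun f => f i) e).
Qed.

End LiftChart.

Section OrderInduction.
Variable I : finType.
Hypothesis HI : @monomializable R U I.

Lemma monomializes_pow (m : (I -> R) -> R) (f u : (option I -> R) -> R) d x :
  agerm m -> ~ near0 [set y | m y = 0] -> agerm u -> u (fun=> 0) != 0 ->
  near0 [set y | f y = y None ^+ d * u y] -> tends U x ->
  monomializes U (fun y => m (otail y) * f y) x.
Proof.
move=> mg m0 ug u0 fE xt.
have [phi [w [phig phi0 wt phiw nm]]] := HI mg m0 (tends_otail xt).
apply: (monomializes_ochart phig phi0 phiw).
apply: monomializes_normal; last exact: tends_oseq.
have og := agerm_ochart phig; have o0 := ochart0 phi0.
apply: (@normal_ext _ _ (fun y => m (phi ^~ (otail y)) *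
    (y None ^+ d * u (ochart phi ^~ y)))).
  by apply: filterS (near0_comp og o0 fE) => y /= ->.
apply: normal_mul; first exact: (normal_reindex Some nm).
apply: normal_mul; first exact: normal_coord_exp.
apply: normal_unit; first exact: agerm_comp.
by rewrite (_ : ochart phi ^~ _ = fun=> 0)//; apply/funext.
Qed.

Section Reduced.
Variable d : nat.
Hypothesis lower_orders : forall d', (d' < d.+1)%N -> @order_step R U I d'.
Variables (c : nat -> (I -> R) -> R) (u f : (option I -> R) -> R).
Variables (m : (I -> R) -> R) (x : nat -> option I -> R).
Hypotheses (cg : forall j, agerm (c j)) (ug : agerm u) (u0 : u (fun=> 0) != 0).
Hypothesis fE : near0 [set y : option I -> R | f y =
  \sum_(j < d) c j (otail y) * y None ^+ j + y None ^+ d.+1 * u y].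
Hypotheses (mg : agerm m) (m0 : ~ near0 [set y | m y = 0]) (xt : tends U x).

Let D := (d.+1)`!.
Let e j := (D %/ (d.+1 - j))%N.

Let eD j : (j < d)%N -> (e j * (d.+1 - j))%N = D.
Proof.
move=> jd; rewrite divnK// dvdn_fact// subn_gt0 leq_subr andbT.
exact: ltn_trans jd _.
Qed.

Let D0 : (0 < D)%N. Proof. exact: fact_gt0. Qed.

Let e0 j : (j < d)%N -> (0 < e j)%N.
Proof. by move=> /eD h; have := D0; rewrite -h muln_gt0 => /andP[]. Qed.

(* The exponents [e j] make [c_j ^ (e j)] homogeneous of the same weight; the
   power substitution by [D] then allows extracting roots of monomials. *)
Lemma monomializes_reduced : monomializes U (fun y => m (otail y) * f y) x.
Proof.
have [c0|] := pselect (forall j, (j < d)%N -> near0 [set y | c j y = 0]).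
  apply: (@monomializes_pow _ _ u d.+1) => //.
  have cz : near0 [set y | forall j : 'I_d, c j (otail y) = 0].
    apply: (@filter_forall _ _ (fun (j : 'I_d) y => c j (otail y) = 0) (@near0
      R (option I))).
    by move=> j; exact: near0_otail (c0 j (ltn_ord j)).
  apply: filterS2 fE cz => y /= -> cy.
  by rewrite big1 ?add0r// => j _; rewrite cy mul0r.
move=> /existsNP[j0 /not_implyP[j0d cj0]].
(* Normalizing this sum makes the powers [c_j ^+ e j] multiples of one monomial, one of them by a
   unit; the root of that unit is the nonvanishing coefficient that [toric] requires. *)
have sg : agerm (fun y => \sum_(j < d) (c j y ^+ e j) ^+ 2).
  by apply: agerm_sum => j _; apply: agerm_exp; exact: agerm_exp.
have [||phi [w [phig phi0 wt phiw nH]]] := HI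
    (F := fun y => m y * \sum_(j < d) (c j y ^+ e j) ^+ 2) _ _ (tends_otail xt).
- exact: agerm_mul.
- move=> /(near0_mul_eq0 mg sg)[//|] H; apply: cj0.
  apply: filterS H => y /= /eqP; rewrite psumr_eq0 => [|j _];
    last exact: sqr_ge0.
  move=> /allP/(_ (Ordinal j0d) (mem_index_enum _)); rewrite sqrf_eq0 /=.
  by rewrite expf_eq0 => /andP[_ /eqP].
have [nm ns] : normal (fun y => m (phi ^~ y)) /\
    normal (fun y => \sum_(j < d) (c j (phi ^~ y) ^+ e j) ^+ 2).
  apply: normal_factor => //; first exact: agerm_comp.
  exact: (agerm_comp phig phi0 sg).
have [|s [g [gg [j1 gj1] gE]]] := normal_sum_squares _ ns.
  by move=> j; apply: agerm_exp; exact: agerm_comp.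
have [sv svP] : {sv : I -> R * (nat -> R) & forall i, [/\ `|(sv i).1| = 1,
    forall k, 0 <= (sv i).2 k, forall k, (sv i).2 k ^+ D = `|w k i| &
    U [set k | w k i = (sv i).1 * (sv i).2 k ^+ D]]}.
  apply: (@choice _ _ (fun i (sv : R * (nat -> R)) => [/\ `|sv.1| = 1,
    forall k, 0 <= sv.2 k, forall k, sv.2 k ^+ D = `|w k i| &
    U [set k | w k i = sv.1 * sv.2 k ^+ D]])) => i.
  by have [sg' [v h]] := ultra_signed_roots (w ^~ i) D0; exists (sg', v).
pose sgn i := (sv i).1; pose v k i := (sv i).2 k.
have sgn0 i : sgn i != 0 by have [h _ _ _] := svP i; rewrite -normr_gt0 h.
pose pw i (y : I -> R) := sgn i * y i ^+ D.
have npw i : normal (pw i) by apply: normal_scale => //;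
  exact: normal_coord_exp.
have pwg i : agerm (pw i) by exact: normal_agerm.
have pw0 i : pw i (fun=> 0) = 0 by rewrite /pw expr0n gtn_eqF// mulr0.
have vt : tends U v.
  apply: tendsP => i eps eps0.
  have ed : 0 < eps ^+ D by rewrite exprn_gt0.
  apply: filterS (tends_coord i wt ed) => k /=; have [_ v0 <- _] := svP i.
  by rewrite /v ger0_norm// ler_pXn2r ?nnegrE// ltW.
have pwv : U [set k | pw ^~ (v k) = w k].
  have : U [set k | forall i, pw i (v k) = w k i].
    apply: (@filter_forall _ _ (fun i k => pw i (v k) = w k i) U) => i.
    by have [_ _ _ h] := svP i; apply: filterS h => k /= ->.
  by apply: filterS => k /= h; apply/funext.
pose phi2 i y := phi i (pw ^~ y).
have phi2g i : agerm (phi2 i) by exact: agerm_comp.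
have pwz : pw ^~ (fun=> 0) = fun=> 0 by apply/funext.
have phi20 i : phi2 i (fun=> 0) = 0 by rewrite /phi2 pwz.
have phi2v : U [set k | phi2 ^~ (v k) = otail (x k)].
  by apply: filterS2 phiw pwv => k /= <- <-.
apply: (monomializes_ochart phi2g phi20 phi2v).
have [ch chP] : {ch : nat -> (I -> R) -> R & forall j, agerm (ch j) /\
   forall jd : (j < d)%N,
   near0 [set y | c j (phi2 ^~ y) = mono s y ^+ (d.+1 - j) * ch j y] /\
   (g (Ordinal jd) (fun=> 0) != 0 -> ch j (fun=> 0) != 0)}.
  apply: (@choice _ _ (fun j ch => agerm ch /\ forall jd : (j < d)%N,
   near0 [set y | c j (phi2 ^~ y) = mono s y ^+ (d.+1 - j) * ch y] /\
   (g (Ordinal jd) (fun=> 0) != 0 -> ch (fun=> 0) != 0))) => j.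
  have [jd|njd] := pselect (is_true (j < d)%N); last first.
    by exists (fun=> 0); split; [exact: agerm_cst|].
  (* The power substitution turns [mono s] into its [D]-th power up to sign; as
     [D = e j * (d.+1 - j)], this is the [e j]-th power of [mono t]. *)
  pose t := flatten (nseq (d.+1 - j) s).
  pose g' y := mono s sgn * g (Ordinal jd) (pw ^~ y).
  have g'g : agerm g' by apply: agerm_mul; [exact: agerm_cst|exact: agerm_comp].
  have c2g : agerm (fun y => c j (phi2 ^~ y)) by exact: agerm_comp.
  have [|ch [chg chE chg']] := factor_mono_root (s := t) (e0 jd) c2g g'g.
    apply: filterS (near0_comp pwg pw0 gE) => y /(_ (Ordinal jd)) /= ->.
    rewrite mono_flatten_nseq -exprM mulnC eD// /g' mulrA; congr (_ * _).
    by rewrite mulrC /mono -prodrXl -big_split; apply: eq_bigr => i _.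
  exists ch; split => // jd'; rewrite (bool_irrelevance jd' jd); split.
    by apply: filterS chE => y /= ->; rewrite mono_flatten_nseq.
  move=> gj0; have := near0_at0 chg'; rewrite /= /g' pwz => h.
  have : ch (fun=> 0) ^+ e j != 0.
    by rewrite h mulf_neq0// mono_neq0.
  by rewrite expf_eq0 e0.
have og := agerm_ochart phi2g; have o0 := ochart0 phi20.
apply: (toric lower_orders (s := s) (c := ch) (u := fun y => u (ochart phi2 ^~
  y))
  (m := fun y => m (phi2 ^~ y)) (f := fun y => f (ochart phi2 ^~ y))).
- by move=> j; have [] := chP j.
- exists j1 => //; have [_ /(_ (ltn_ord j1))[_]] := chP j1; apply.
  by rewrite (_ : Ordinal _ = j1)//; exact: val_inj.
- exact: agerm_comp.
- by rewrite (_ : ochart phi2 ^~ _ = fun=> 0)//; apply/funext.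
- have chE : near0 [set y | forall j : 'I_d,
      c j (phi2 ^~ (otail y)) = mono s (otail y) ^+ (d.+1 - j) * ch j (otail
        y)].
    apply: (@filter_forall _ _ (fun (j : 'I_d) y => c j (phi2 ^~ (otail y)) =
      mono s (otail y) ^+ (d.+1 - j) * ch j (otail y)) (@near0 R (option I)))
        => j.
    by have [_ /(_ (ltn_ord j))[h _]] := chP j; exact: near0_otail h.
  apply: filterS2 chE (near0_comp og o0 fE) => y /= chy ->; congr (_ + _).
  apply: eq_bigr => j _; congr (_ * _).
  by have := chy j; rewrite /= mulrC => <-.
- exact: normal_comp nm npw pw0.
- exact: tends_oseq.
Qed.

End Reduced.

(** The translation moves only the variable [None], so [m] is untouched; it removes the coefficient
    of degree [d], as the order drop in the toric charts demands. *)
Lemma order_induction d : @order_step R U I d.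
Proof.
elim/ltn_ind: d => -[|d] IH f m x mg m0 [c [u [cg c0 ug u0 fE]]] xt.
  apply: (@monomializes_pow _ _ u 0%N) => //.
  by apply: filterS fE => y /= ->; rewrite big_ord0 add0r.
have [psi [c' [u' [[psig psi0] c'g u'g u'0 fE']]]] :=
  tschirnhaus cg ug (c0 d (ltnSn d)) u0 fE.
pose phi (o : option I) (y : option I -> R) :=
  if o is Some i then y (Some i) else y None + psi (otail y).
have phig o : agerm (phi o).
  case: o => [i|]; first exact: agerm_coord.
  by apply: agerm_add; [exact: agerm_coord|exact: agerm_otail].
have phi0 o : phi o (fun=> 0) = 0.
  by case: o => [i|] //=; rewrite [otail _](_ : _ = fun=> 0)// psi0 addr0.
pose shf (o : option I) (y : option I -> R) :=
  if o is Some i then y (Some i) else y None - psi (otail y).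
have shfg o : agerm (shf o).
  case: o => [i|]; first exact: agerm_coord.
  by apply: agerm_sub; [exact: agerm_coord|exact: agerm_otail].
have shf0 o : shf o (fun=> 0) = 0.
  by case: o => [i|] //=; rewrite [otail _](_ : _ = fun=> 0)// psi0 subr0.
apply: (@monomializes_comp _ _ _ _ _ _ phi (fun k => shf ^~ (x k))) => //.
  by apply: filterE => k /=; apply/funext => -[i|] //=; rewrite subrK.
by apply: (monomializes_reduced IH c'g u'g u'0) => //; exact: tends_comp.
Qed.

(* A shear makes the [None]-axis pass through a point where [F] is nonzero. *)
Lemma monomializable_option : @monomializable R U (option I).
Proof.
move=> F x [rho rho0 [M FM]] Fn0 xt.
pose r := rho / 4; have r0 : 0 < r by rewrite divr_gt0.
have rE : rho = (r + r) + (r + r) by rewrite /r; lra.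
have [p [pr p0 Fp]] : exists p : option I -> R,
    [/\ forall o, `|p o| <= r, p None != 0 & F p != 0].
  apply: contrapT => H; apply: Fn0.
  have TF : near0 [set y : option I -> R | y None * F y = 0].
    exists r => // y yr /=; apply: contrapT => /eqP h; apply: H; exists y.
    by move: h; rewrite mulf_eq0 negb_or => /andP[].
  have Fg : agerm F by exists rho => //; exists M.
  case: (near0_mul_eq0 (agerm_coord R None) Fg TF) => [h|//].
  by case: (near0_coord_neq0 h).
pose a o := p o / p None.
pose phi (o : option I) (y : option I -> R) :=
  if o is Some i then y (Some i) + a (Some i) * y None else y None.
pose shf (o : option I) (y : option I -> R) :=
  if o is Some i then y (Some i) - a (Some i) * y None else y None.
have lin (o : option I) b : agerm (fun y : option I -> R => y o + b * y None).
  apply: agerm_add; first exact: agerm_coord.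
  by apply: agerm_mul; [exact: agerm_cst|exact: agerm_coord].
have phig o : agerm (phi o) by case: o => [i|]; [exact: lin|exact: agerm_coord].
have phi0 o : phi o (fun=> 0) = 0 by case: o => [i|] //=; rewrite mulr0 addr0.
have shfg o : agerm (shf o).
  case: o => [i|]; last exact: agerm_coord.
  rewrite /shf (_ : (fun _ => _) = fun y : option I -> R => y (Some i) + - a
    (Some i) * y None).
    exact: lin.
  by apply/funext => y; rewrite mulNr.
have shf0 o : shf o (fun=> 0) = 0 by case: o => [i|] //=; rewrite mulr0 subr0.
apply: (@monomializes_comp _ _ _ _ _ _ phi (fun k => shf ^~ (x k))) => //.
  by apply: filterE => k /=; apply/funext => -[i|] //=; rewrite subrK.
have pn0 : 0 < `|p None| by rewrite normr_gt0.
(* The parameter [p None] must lie strictly inside the radius for [finite_order]; since every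
   [|p o|] is at most [rho / 4], the shear stays within radius [rho]. *)
have FphiM : abound (fun=> `|p None| + `|p None|) (fun y => F (phi ^~ y)) M.
  have q0 : 0 <= `|p None| + `|p None| by rewrite addr_ge0.
  apply: abound_comp FM _ => //; case=> [i|] /=; last first.
    apply: abound_le (abound_coord _ _) _ => //.
    by rewrite rE lerD// (le_trans (pr _))// lerDl ltW.
  apply: abound_le (abound_add (abound_coord _ _)
    (abound_mul (abound_cst _ _) (abound_coord _ _))) _ => //.
  rewrite normrM normfV mulrDr divfK ?gt_eqF// rE.
  by rewrite lerD// lerD.
have [d rd] : exists d, regular d (fun y => F (phi ^~ y)).
  apply: (@finite_order _ _ (`|p None| + `|p None|) _ M (p None)) => //.
  - exact: addr_gt0.
  - by rewrite ltrDl.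
  - rewrite (_ : phi ^~ _ = p)//; apply/funext => -[i|] //=.
    by rewrite add0r /a divfK.
have := @order_induction d (fun y => F (phi ^~ y)) (fun=> 1) (fun k => shf ^~
  (x k)).
move=> /(_ (agerm_cst _ _) _ rd (tends_comp shfg shf0 xt)) H.
apply: monomializes_ext (H _); first by apply: filterE => y /=; rewrite mul1r.
by move=> /near0_at0 /= /eqP; rewrite oner_eq0.
Qed.

End OrderInduction.

Theorem monomialization (I : finType) : @monomializable R U I.
Proof.
apply: (@monomializable_bij _ _ _ _ _ (@enum_val I predT) enum_rank).
- exact: enum_valK.
- exact: enum_rankK.
elim: #|I| => [|n IH].
  move=> F x Fg Fn0 xt; apply: monomializes_normal => //;
    apply: normal_unit => //.
  apply/eqP => F0; apply: Fn0; apply: filterE => y /=; rewrite -F0; congr F.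
  by apply/funext => -[].
apply: (@monomializable_bij _ _ _ _ _
  (fun o : option 'I_n => oapp (lift ord0) ord0 o) (fun i => unlift ord0 i)).
- by case=> [i|] /=; rewrite ?liftK ?unlift_none.
- by move=> i; case: unliftP => [j ->|->].
- exact: monomializable_option.
Qed.

End Monomialization.
(** * Estimates in a monomial chart *)

Section Euclidean.
Variables (R : realType) (n : nat).
Implicit Types x y z : vec R n.

Lemma enorm_ge0 x : 0 <= enorm x. Proof. exact: sqrtr_ge0. Qed.

Lemma enorm_sqr x : enorm x ^+ 2 = \sum_i x i ^+ 2.
Proof. by rewrite sqr_sqrtr// sumr_ge0// => i _; exact: sqr_ge0. Qed.

Lemma enorm_vscale t x : enorm (vscale t x) = `|t| * enorm x.
Proof.
rewrite /enorm (eq_bigr (fun i => t ^+ 2 * x i ^+ 2)).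
  by rewrite -mulr_sumr sqrtrM ?sqr_ge0// sqrtr_sqr.
by move=> i _; rewrite exprMn.
Qed.

Lemma enorm_vzero : enorm (@vzero R n) = 0.
Proof. by rewrite /enorm big1 ?sqrtr0// => i _; rewrite expr0n. Qed.

Lemma coord_le_enorm x i : `|x i| <= enorm x.
Proof.
rewrite -sqrtr_sqr ler_wsqrtr// (bigD1 i)//= lerDl sumr_ge0// => j _.
exact: sqr_ge0.
Qed.

Lemma enorm_eq0 x : enorm x = 0 -> x = @vzero R n.
Proof.
move=> x0; apply/funext => i; apply/eqP; rewrite -normr_le0 -x0.
exact: coord_le_enorm.
Qed.

Lemma enorm_gt0 x : x <> @vzero R n -> 0 < enorm x.
Proof.
by move=> x0; rewrite lt0r enorm_ge0 andbT; apply/eqP => /enorm_eq0.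
Qed.

Lemma enorm_le_coord x D : (forall i, `|x i| <= D) -> enorm x <= n%:R * D.
Proof.
move=> xD; case: n x xD => [|m] x xD.
  by rewrite /enorm big_ord0 sqrtr0 mul0r.
have D0 : 0 <= D by exact: le_trans (normr_ge0 _) (xD ord0).
rewrite -[leRHS]ger0_norm; last by rewrite mulr_ge0.
rewrite -sqrtr_sqr ler_wsqrtr//.
apply: (@le_trans _ _ (\sum_(i < m.+1) D ^+ 2)).
  by apply: ler_sum => i _; rewrite -real_normK ?num_real// ler_pXn2r ?nnegrE.
rewrite sumr_const card_ord -[leLHS]mulr_natl exprMn ler_wpM2r ?sqr_ge0//.
by rewrite -natrX ler_nat; exact: leq_pmulr.
Qed.

(** Cauchy-Schwarz, from the squares of [|y| x_i - |x| y_i]. *)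
Lemma dotmul_le_enorm x y : \sum_i x i * y i <= enorm x * enorm y.
Proof.
have [x0|xn0] := eqVneq (enorm x) 0.
  by rewrite x0 mul0r (enorm_eq0 x0) big1// => i _; rewrite mul0r.
have [y0|yn0] := eqVneq (enorm y) 0.
  by rewrite y0 mulr0 (enorm_eq0 y0) big1// => i _; rewrite mulr0.
have X : 0 < enorm x by rewrite lt0r xn0 enorm_ge0.
have Y : 0 < enorm y by rewrite lt0r yn0 enorm_ge0.
have key : 0 <= \sum_i (enorm y * x i - enorm x * y i) ^+ 2.
  by apply: sumr_ge0 => i _; exact: sqr_ge0.
have E : \sum_i (enorm y * x i - enorm x * y i) ^+ 2 =
    enorm y ^+ 2 * enorm x ^+ 2 + enorm x ^+ 2 * enorm y ^+ 2
    - 2 * (enorm x * enorm y) * \sum_i x i * y i.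
  rewrite {1}(enorm_sqr x) {2}(enorm_sqr y) !mulr_sumr -big_split -sumrB /=.
  by apply: eq_bigr => i _; ring.
move: key; rewrite E => key.
rewrite -(ler_pM2l (mulr_gt0 X Y)); move: key; lra.
Qed.

Lemma enorm_triangle x y z :
  enorm (vsub x z) <= enorm (vsub x y) + enorm (vsub y z).
Proof.
have D0 : 0 <= enorm (vsub x y) + enorm (vsub y z) by rewrite addr_ge0
  ?enorm_ge0.
rewrite -(@ler_pXn2r _ 2) ?nnegrE ?enorm_ge0// sqrrD !enorm_sqr.
have := dotmul_le_enorm (vsub x y) (vsub y z).
have -> : \sum_i vsub x z i ^+ 2 = \sum_i vsub x y i ^+ 2 + \sum_i vsub y z i
  ^+ 2
    + 2 * \sum_i vsub x y i * vsub y z i.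
  rewrite mulr_sumr -!big_split /=; apply: eq_bigr => i _; rewrite /vsub; ring.
lra.
Qed.

Lemma enorm_vsubC x y : enorm (vsub x y) = enorm (vsub y x).
Proof.
by rewrite /enorm; congr Num.sqrt; apply: eq_bigr => i _; rewrite /vsub; ring.
Qed.

Lemma enorm_vsub0 x : enorm (vsub x (@vzero R n)) = enorm x.
Proof. by congr enorm; apply/funext => i; rewrite /vsub subr0. Qed.

Lemma enorm_vsubxx x : enorm (vsub x x) = 0.
Proof.
by rewrite -[RHS]enorm_vzero; congr enorm; apply/funext => i;
  rewrite /vsub subrr.
Qed.

Lemma enorm_rev_triangle x y : `|enorm x - enorm y| <= enorm (vsub x y).
Proof.
have := enorm_triangle x y (@vzero R n);
  have := enorm_triangle y x (@vzero R n).
by rewrite !enorm_vsub0 (enorm_vsubC y x) => h1 h2; rewrite ler_norml; lra.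
Qed.

Lemma vscale_vsub t x y : vsub (vscale t x) (vscale t y) = vscale t (vsub x y).
Proof. by apply/funext => i; rewrite /vsub /vscale mulrBr. Qed.

Lemma vscaleA s t x : vscale s (vscale t x) = vscale (s * t) x.
Proof. by apply/funext => i; rewrite /vscale mulrA. Qed.

Lemma enorm_normalize_sub x y : 0 < enorm x -> 0 < enorm y ->
  enorm (vsub (vscale (enorm x)^-1 x) (vscale (enorm y)^-1 y)) <=
  2 * enorm (vsub x y) / enorm x.
Proof.
move=> x0 y0.
apply: le_trans (enorm_triangle _ (vscale (enorm x)^-1 y) _) _.
rewrite vscale_vsub enorm_vscale.
have -> : vsub (vscale (enorm x)^-1 y) (vscale (enorm y)^-1 y) =
    vscale ((enorm x)^-1 - (enorm y)^-1) y.
  by apply/funext => i; rewrite /vsub /vscale mulrBl.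
rewrite enorm_vscale ger0_norm ?invr_ge0 ?enorm_ge0//.
have -> : `|(enorm x)^-1 - (enorm y)^-1| * enorm y =
    (enorm x)^-1 * `|enorm x - enorm y|.
  have -> : (enorm x)^-1 - (enorm y)^-1 =
      (enorm x)^-1 * ((enorm y - enorm x) / enorm y).
    by field; rewrite !gt_eqF.
  rewrite !normrM !normfV (gtr0_norm x0) (gtr0_norm y0) distrC.
  by field; rewrite !gt_eqF.
rewrite -mulrDr mulrC ler_pM2r ?invr_gt0// mulr2n mulrDl !mul1r lerD2l.
exact: enorm_rev_triangle.
Qed.

Lemma dist_le x y (A : set (vec R n)) : A y -> dist x A <= enorm (vsub x y).
Proof.
move=> Ay; apply: ge_inf; last by exists y.
by exists 0 => _ [z _ <-]; exact: enorm_ge0.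
Qed.

Lemma dirset_approx (A : set (vec R n)) a : enorm a = 1 ->
  (forall e, 0 < e -> exists y, [/\ A y, y <> @vzero R n, enorm y < e &
     enorm (vsub (vscale (enorm y)^-1 y) a) < e]) ->
  dirset A a.
Proof.
move=> a1 H; split=> //.
have [xs xsP] : {xs : nat -> vec R n & forall k, [/\ A (xs k),
    xs k <> @vzero R n, enorm (xs k) < k.+1%:R^-1 &
    enorm (vsub (vscale (enorm (xs k))^-1 (xs k)) a) < k.+1%:R^-1]}.
  apply: (@choice _ _ (fun k (y : vec R n) => [/\ A y, y <> @vzero R n,
    enorm y < k.+1%:R^-1 &
    enorm (vsub (vscale (enorm y)^-1 y) a) < k.+1%:R^-1])) => k.
  by apply: H; rewrite invr_gt0.
exists xs; split; first by move=> k; have [] := xsP k.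
move=> e e0.
have [N _ NP] := near_infty_natSinv_lt (PosNum e0).
exists N => k Nk; have [_ _ h1 h2] := xsP k.
have /= ke := NP k Nk.
by split; apply: lt_trans ke.
Qed.

End Euclidean.
Section PowerEstimates.
Variable R : realType.

Lemma root_le (b c t : R) B : (0 < B)%N -> 0 <= b -> 0 < c -> c * b ^+ B <= t ->
  b <= c^-1 `^ B%:R^-1 * t `^ B%:R^-1.
Proof.
move=> B0 b0 c0 bt.
have t0 : 0 <= t by apply: le_trans bt; rewrite mulr_ge0 ?exprn_ge0// ltW.
rewrite -powRM ?invr_ge0 ?(ltW c0)//.
have {1}-> : b = (b ^+ B) `^ B%:R^-1.
  by rewrite -powR_mulrn// -powRrM mulfV ?powRr1// pnatr_eq0 -lt0n.
apply: ge0_ler_powR.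
- by rewrite invr_ge0.
- by rewrite nnegrE exprn_ge0.
- by rewrite nnegrE mulr_ge0// invr_ge0 ltW.
- by rewrite mulrC ler_pdivlMr// mulrC.
Qed.

Lemma powR_1D (t e : R) : 0 < t -> t `^ (1 + e) = t * t `^ e.
Proof.
by move=> t0; rewrite powRD ?(gt_eqF t0) ?implybT// powRr1// ltW.
Qed.

Lemma mono_ge0 (I : eqType) (s : seq I) (m : I -> R) : (forall i, 0 <= m i) ->
  0 <= mono s m.
Proof. by move=> m0; apply: prodr_ge0. Qed.

Lemma mono_ge_exp (I : eqType) (s : seq I) (m : I -> R) b : 0 <= b ->
  {in s, forall i, b <= m i} -> b ^+ size s <= mono s m.
Proof.
move=> b0; elim: s => [|i s IH] bm; first by rewrite /mono big_nil.
rewrite mono_cons /= exprS; apply: ler_pM => //; first exact: exprn_ge0.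
  by apply: bm; rewrite mem_head.
by apply: IH => j js; apply: bm; rewrite inE js orbT.
Qed.

Lemma mono_le_coord (I : eqType) (s : seq I) (m : I -> R) i :
  (forall i, 0 <= m i <= 1) -> i \in s -> mono s m <= m i.
Proof.
move=> m01 is_; rewrite /mono (perm_big _ (perm_to_rem is_)) big_cons /=.
have /andP[mi0 mi1] := m01 i; rewrite ler_piMr//.
by apply: prodr_ile1 => j _; exact: m01.
Qed.

End PowerEstimates.

(** * The two distance bounds in one chart *)

Section ChartEstimate.
Variables (R : realType) (n : nat) (I : finType).
Variables (g : 'I_n -> (I -> R) -> R) (s : seq I) (A : set (vec R n)).

(* Both halves of the theorem at the scale of one point [x] of [A]: [x] is
   close to the tangent cone, and the ray through [x] stays close to [A] up to
   the scale [t0]. *)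
Definition cone_like (A : set (vec R n)) (e C t0 : R) (x : vec R n) :=
  (exists2 y, LD A y & enorm (vsub x y) <= C * enorm x `^ (1 + e)) /\
  forall t, enorm x <= t -> t <= t0 -> exists2 y, A y &
    enorm (vsub (vscale (t / enorm x) x) y) <= C * t `^ (1 + e).

Let G w : vec R n := fun k => g k w.
Let f w : vec R n := vscale (mono s w) (G w).

Variables (rho L c : R).
Hypotheses (rho0 : 0 < rho) (rho1 : rho <= 1) (L0 : 0 <= L) (c0 : 0 < c).
Hypothesis s_neq0 : s <> [::].
Hypothesis Glip : forall a b D, (forall i, `|a i| <= rho) ->
  (forall i, `|b i| <= rho) -> 0 <= D -> (forall i, `|a i - b i| <= D) ->
  enorm (vsub (G a) (G b)) <= L * D.
Hypothesis Gge : forall a, (forall i, `|a i| <= rho) -> c <= enorm (G a).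
Hypothesis fA : forall a, (forall i, `|a i| <= rho) -> (forall i, a i != 0) ->
  A (f a).

Let B := size s.
Let B0 : (0 < B)%N. Proof. by rewrite /B; case: s s_neq0. Qed.

Let G0 a : (forall i, `|a i| <= rho) -> 0 < enorm (G a).
Proof. by move=> ar; exact: lt_le_trans c0 (Gge ar). Qed.

Let dir a : vec R n := vscale (enorm (G a))^-1 (G a).

Let enorm_dir a : (forall i, `|a i| <= rho) -> enorm (dir a) = 1.
Proof.
move=> ar; rewrite enorm_vscale ger0_norm ?invr_ge0 ?enorm_ge0// mulVf//.
by rewrite gt_eqF// G0.
Qed.

Let dir_lip a b D : (forall i, `|a i| <= rho) ->
  (forall i, `|b i| <= rho) -> 0 <= D -> (forall i, `|a i - b i| <= D) ->
  enorm (vsub (dir a) (dir b)) <= 2 * L / c * D.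
Proof.
move=> ar br D0 abD; apply: le_trans (enorm_normalize_sub (G0 ar) (G0 br)) _.
have h := Glip ar br D0 abD.
rewrite ler_pdivrMr; last exact: G0.
apply: (@le_trans _ _ (2 * L / c * D * c)).
  by rewrite mulrAC divfK ?gt_eqF// -mulrA ler_pM2l.
by rewrite ler_wpM2l ?Gge// !mulr_ge0// invr_ge0 ltW.
Qed.

Section Point.
Variable w : I -> R.
Hypotheses (wr : forall i, `|w i| <= rho) (fw0 : f w <> @vzero R n).

(** The signs of [w] are frozen and only the absolute values [m] move, so the sign [sigma] of the
    monomial stays the same when a coordinate reaches [0]. *)
Let sgn i : R := if 0 <= w i then 1 else -1.
Let sigma := mono s sgn.
Let v (m : I -> R) i := sgn i * m i.

Let norm_sgn i : `|sgn i| = 1.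
Proof. by rewrite /sgn; case: ifP; rewrite ?normrN1 ?normr1. Qed.

Let norm_sigma : `|sigma| = 1.
Proof. by rewrite /sigma /mono normr_prod big1. Qed.

Let mono_v m : mono s (v m) = sigma * mono s m.
Proof. by rewrite /sigma /mono -big_split. Qed.

Let w_v : w = v (fun i => `|w i|).
Proof.
apply/funext => i; rewrite /v /sgn; case: ifPn => [h|].
  by rewrite mul1r ger0_norm.
by rewrite -ltNge => h; rewrite mulN1r ltr0_norm// opprK.
Qed.

Let v_rho m : (forall i, 0 <= m i <= rho) -> forall i, `|v m i| <= rho.
Proof.
by move=> mr i; rewrite normrM norm_sgn mul1r; have /andP[? ?] := mr i;
  rewrite ger0_norm.
Qed.

Let v_sub m m' i : `|v m i - v m' i| = `|m i - m' i|.
Proof. by rewrite -mulrBr normrM norm_sgn mul1r. Qed.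

Let f_v m : (forall i, 0 <= m i <= rho) ->
  f (v m) = vscale (mono s m * enorm (G (v m))) (vscale sigma (dir (v m))).
Proof.
move=> mr; rewrite /f mono_v /dir !vscaleA; congr vscale.
have h : enorm (G (v m)) != 0 by rewrite gt_eqF// G0//; exact: v_rho.
by field.
Qed.

Let enorm_f m : (forall i, 0 <= m i <= rho) ->
  enorm (f (v m)) = mono s m * enorm (G (v m)).
Proof.
move=> mr; rewrite f_v// 2!enorm_vscale norm_sigma mul1r enorm_dir ?mulr1.
  rewrite ger0_norm// mulr_ge0 ?enorm_ge0// mono_ge0// => i.
  by have /andP[] := mr i.
exact: v_rho.
Qed.

Let wm i : 0 <= `|w i| <= rho. Proof. by rewrite normr_ge0 wr. Qed.

Let p := mono s (fun i => `|w i|).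

Let enorm_fw : enorm (f w) = p * enorm (G w).
Proof. by rewrite {1}w_v enorm_f// -w_v. Qed.

Let p0 : 0 < p.
Proof.
have := enorm_gt0 fw0; rewrite enorm_fw => h.
by rewrite -(pmulr_lgt0 _ (G0 wr)).
Qed.

Let fwE : f w = vscale (enorm (f w)) (vscale sigma (dir w)).
Proof. by rewrite {1}w_v f_v// -w_v -enorm_fw. Qed.

Let e : R := B%:R^-1.
Let K : R := 2 * L / c * c^-1 `^ e.

Let K0 : 0 <= K. Proof. by rewrite !mulr_ge0// ?invr_ge0 ?ltW// powR_gt0//
  invr_gt0. Qed.

Let close_dir a b (D t : R) : (forall i, `|a i| <= rho) ->
  (forall i, `|b i| <= rho) -> 0 <= D -> (forall i, `|a i - b i| <= D) ->
  0 < t -> c * D ^+ B <= t ->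
  enorm (vsub (vscale t (vscale sigma (dir a))) (vscale t (vscale sigma (dir
    b))))
    <= K * t `^ (1 + e).
Proof.
move=> ar br D0 abD t0 Dt.
rewrite !vscale_vsub !enorm_vscale norm_sigma mul1r gtr0_norm// powR_1D//
  mulrCA.
rewrite ler_pM2l//; apply: le_trans (dir_lip ar br D0 abD) _.
rewrite /K -[leRHS]mulrA; apply: ler_wpM2l; last exact: root_le.
by rewrite !mulr_ge0// invr_ge0 ltW.
Qed.

Lemma near_cone : exists2 y, LD A y & enorm (vsub (f w) y) <= K * enorm (f w)
  `^ (1 + e).
Proof.
have [i1 i1s] : exists i, i \in s.
  by case: s s_neq0 => // i s' _; exists i; rewrite mem_head.
have [i0 i0s i0min] : exists2 i0, i0 \in s & {in s, forall i, `|w i0| <= `|w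
  i|}.
  case: (@arg_minP _ _ _ i1 (mem s) (fun i => `|w i|) i1s) => i0 i0s h.
  by exists i0.
(* Choosing the smallest factor bounds the displacement: all [B] factors are at least [|w i0|],
   whence [c |w i0|^B <= |x|]. *)
pose m i := if i == i0 then 0 else `|w i|.
have mr i : 0 <= m i <= rho.
  by rewrite /m; case: ifP => _ //; rewrite lexx ltW.
have mw i : `|w i - v m i| <= `|w i0|.
  rewrite {1}w_v v_sub /m; case: eqP => [->|_]; first by rewrite subr0 normr_id.
  by rewrite subrr normr0.
have fwgt := enorm_gt0 fw0.
exists (vscale (enorm (f w)) (vscale sigma (dir (v m)))); last first.
  rewrite {1}fwE; apply: (close_dir wr (v_rho mr) (normr_ge0 (w i0)) mw fwgt).
  rewrite enorm_fw mulrC; apply: ler_pM => //.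
  - exact: ltW.
  - exact: mono_ge_exp.
  - exact: Gge.
exists (enorm (f w)), (vscale sigma (dir (v m))); last by split;
  rewrite ?enorm_ge0.
apply: dirset_approx.
  by rewrite enorm_vscale norm_sigma mul1r enorm_dir//; exact: v_rho.
move=> eps eps0.
(* [E] dominates both [|G|] on the polydisc and the Lipschitz constant of the direction, so [eta]
   alone controls norm and direction. *)
pose E := enorm (G (fun=> 0)) + L * rho + 2 * L / c + 1.
have E1 : 0 <= enorm (G (fun=> 0)) + L * rho by rewrite addr_ge0 ?enorm_ge0//
  mulr_ge0// ltW.
have E2 : 0 <= 2 * L / c by rewrite !mulr_ge0// invr_ge0 ltW.
have E0 : 0 < E by rewrite /E; lra.
pose eta := Num.min rho (eps / E / 2).
have eta0 : 0 < eta by rewrite lt_min rho0 !divr_gt0.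
have etarho : eta <= rho by rewrite ge_min lexx.
have etaE : eta * E < eps.
  rewrite -ltr_pdivlMr//; apply: (@le_lt_trans _ _ (eps / E / 2)).
    by rewrite ge_min lexx orbT.
  by rewrite ltr_pdivrMr// ltr_pMr ?divr_gt0// ltr1n.
(* All coordinates become nonzero, which puts the point in [A], and the factor [eta] at [i0] makes
   its norm small. *)
pose m' i := if i == i0 then eta else Num.max `|w i| eta.
have m'0 i : 0 < m' i.
  by rewrite /m'; case: ifP => _ //; rewrite lt_max eta0 orbT.
have m'r i : 0 <= m' i <= rho.
  by rewrite ltW//= /m'; case: ifP => _ //; rewrite ge_max wr.
have m'm i : `|m' i - m i| <= eta.
  rewrite /m' /m; case: ifP => _; first by rewrite subr0 ger0_norm// ltW.
  by case: (leP `|w i| eta) => h; have := normr_ge0 (w i); rewrite ler_norml;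
    lra.
have vm'0 i : v m' i != 0.
  by rewrite -normr_gt0 normrM norm_sgn mul1r normr_gt0 gt_eqF.
have mono0' : 0 < mono s m' by apply: prodr_gt0.
have fgt : 0 < enorm (f (v m')).
  by rewrite enorm_f// mulr_gt0// G0//; exact: v_rho.
exists (f (v m')); split.
- by apply: fA => //; exact: v_rho.
- by move=> h; move: fgt; rewrite h enorm_vzero ltxx.
- rewrite enorm_f//; apply: le_lt_trans etaE; apply: ler_pM;
    rewrite ?enorm_ge0//.
  + exact: ltW.
  + apply: le_trans (mono_le_coord _ i0s) _; last by rewrite /m' eqxx.
    by move=> i; have /andP[-> h] := m'r i; rewrite (le_trans h).
  + apply: (@le_trans _ _ (enorm (G (fun=> 0)) + L * rho)); last by rewrite /E;
    lra.
    have := enorm_triangle (G (v m')) (G (fun=> 0)) (@vzero R n).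
    rewrite !enorm_vsub0 => h; apply: le_trans h _; rewrite addrC lerD2l.
    apply: Glip; [exact: v_rho| |exact: ltW|].
    * by move=> i; rewrite normr0 ltW.
    * by move=> i; rewrite subr0; exact: v_rho.
- rewrite {2}f_v// -enorm_f// vscaleA mulVf ?gt_eqF//.
  have -> : vscale 1 (vscale sigma (dir (v m'))) = vscale sigma (dir (v m')).
    by rewrite vscaleA mul1r.
  rewrite vscale_vsub enorm_vscale norm_sigma mul1r.
  apply: le_lt_trans (dir_lip (v_rho m'r) (v_rho mr) (ltW eta0) _) _.
    by move=> i; rewrite v_sub.
  apply: le_lt_trans etaE; rewrite mulrC ler_pM2l// /E; lra.
Qed.

Lemma ray_near t : A (f w) -> enorm (f w) <= t -> t <= c * rho ^+ B ->
  exists2 y, A y & enorm (vsub (vscale (t / enorm (f w)) (f w)) y) <=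
    K * t `^ (1 + e).
Proof.
move=> Afw fwt tt0; have fwgt := enorm_gt0 fw0.
have t_gt0 : 0 < t by exact: lt_le_trans fwt.
(* A path from [w] at [r = 0] to the corner of the polydisc at [r = rho]; capping [r] keeps it in
   the polydisc for every real [r]. *)
pose m r i := Num.max `|w i| (Num.min r rho).
have mr r i : 0 <= m r i <= rho.
  by rewrite /m le_max normr_ge0 /= ge_max wr ge_min lexx orbT.
have max_lip (a x y : R) : `|Num.max a x - Num.max a y| <= `|x - y|.
  have := ler_norm (x - y); have := ler_norm (y - x); rewrite (distrC y).
  by rewrite ler_norml; case: (leP a x) => ?; case: (leP a y) => ?; lra.
have min_lip (a x y : R) : `|Num.min x a - Num.min y a| <= `|x - y|.
  have := ler_norm (x - y); have := ler_norm (y - x); rewrite (distrC y).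
  by rewrite ler_norml; case: (leP x a) => ?; case: (leP y a) => ?; lra.
have m_lip r r' i : `|m r i - m r' i| <= `|r - r'|.
  exact: le_trans (max_lip _ _ _) (min_lip _ _ _).
have m0 : m 0 = fun i => `|w i|.
  by apply/funext => i; rewrite /m; apply/max_idPl; rewrite ge_min normr_ge0.
have m_rho : m rho = fun=> rho.
  by apply/funext => i; rewrite /m minxx; apply/max_idPr; exact: wr.
pose h r := mono s (m r) * enorm (G (v (m r))).
have lip_cont (q : R -> R) (Q : R) : 0 <= Q ->
    (forall r r', `|q r - q r'| <= Q * `|r - r'|) -> continuous q.
  move=> Q0 qlip r; apply/cvgrPdist_le => eps eps0; near=> r'.
  apply: le_trans (qlip _ _) _.
  have : `|r - r'| <= eps / (Q + 1).
    near: r'; have : (fun r' : R => r') @ r --> r by exact: cvg_id.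
    by move/cvgrPdist_le; apply; rewrite divr_gt0// ltr_wpDl.
  rewrite ler_pdivlMr ?ltr_wpDl// => h1; apply: le_trans h1.
  by rewrite mulrC ler_wpM2l// lerDl.
have hc : continuous h.
  have mc i : continuous (fun r => m r i).
    by apply: (@lip_cont _ 1) => // r r'; rewrite mul1r.
  have Gc : continuous (fun r => enorm (G (v (m r)))).
    apply: (@lip_cont _ L) => // r r'.
    apply: le_trans (enorm_rev_triangle _ _) _.
    apply: Glip; [exact: v_rho|exact: v_rho|exact: normr_ge0|].
    by move=> i; rewrite v_sub.
  have moc : continuous (fun r => mono s (m r)).
    elim: (s) => [|i s' IH].
      rewrite (_ : (fun r => _) = fun=> 1); first by move=> r; exact: cvg_cst.
      by apply/funext => r; rewrite /mono big_nil.
    rewrite (_ : (fun r => _) = fun r => m r i * mono s' (m r)); last first.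
      by apply/funext => r; rewrite mono_cons.
    by move=> r; apply: cvgM; [exact: mc|exact: IH].
  by move=> r; apply: cvgM; [exact: moc|exact: Gc].
(* The norm [h] along the path starts at [|x|] and ends at or above [c rho^B], so it takes the value
   [t]. *)
have h0 : h 0 = enorm (f w) by rewrite /h m0 -w_v enorm_fw.
have hrho : c * rho ^+ B <= h rho.
  rewrite /h m_rho mulrC; apply: ler_pM;
    [exact: exprn_ge0 (ltW rho0)|exact: ltW| |].
    by apply: mono_ge_exp => //; exact: ltW.
  by apply: Gge; apply: v_rho => i; rewrite lexx ltW.
have [|r] := @IVT _ h 0 rho t (ltW rho0) (continuous_subspaceT hc).
  by rewrite ge_min le_max h0 fwt (le_trans tt0 hrho) orbT.
rewrite in_itv /= => /andP[r0 rrho] hr.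
(* At [r = 0] coordinates may vanish and [fA] does not apply, but then [t = |x|] and the point
   itself serves. *)
have [r00|rn0] := eqVneq r 0.
  exists (f w) => //.
  have -> : t = enorm (f w) by rewrite -hr r00.
  rewrite divff ?gt_eqF// (_ : vscale 1 (f w) = f w).
    by rewrite enorm_vsubxx mulr_ge0// powR_ge0.
  by apply/funext => i; rewrite /vscale mul1r.
have {}r0 : 0 < r by rewrite lt0r rn0.
have minr : Num.min r rho = r by apply/min_idPl.
exists (f (v (m r))).
  apply: fA; first exact: v_rho.
  move=> i; rewrite -normr_gt0 normrM norm_sgn mul1r normr_gt0 gt_eqF//.
  by rewrite /m minr lt_max r0 orbT.
rewrite f_v// -/(h r) hr {2}fwE vscaleA divfK ?gt_eqF//.
apply: (@close_dir _ _ r) => //.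
- exact: v_rho.
- exact: ltW.
- move=> i; rewrite {1}w_v v_sub; have := m_lip 0 r i.
  by rewrite m0 sub0r normrN (gtr0_norm r0).
- rewrite -hr /h mulrC; apply: ler_pM;
    [exact: exprn_ge0 (ltW r0)|exact: ltW| |].
    by apply: mono_ge_exp => [|i _];
      [exact: ltW|rewrite /m minr le_max lexx orbT].
  by apply: Gge; exact: v_rho.
Unshelve. all: by end_near. Qed.

End Point.

Lemma chart_cone_like : exists e C t0, [/\ 0 < e, 0 < C, 0 < t0 &
  forall w, (forall i, `|w i| <= rho) -> A (f w) -> f w <> @vzero R n ->
    cone_like A e C t0 (f w)].
Proof.
pose e : R := B%:R^-1; pose K : R := 2 * L / c * c^-1 `^ e.
have K0 : 0 <= K by rewrite !mulr_ge0// ?invr_ge0 ?ltW// powR_gt0// invr_gt0.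
have KK x (y : R) : x <= K * y `^ (1 + e) -> x <= (K + 1) * y `^ (1 + e).
  by move=> h; apply: le_trans h _; rewrite ler_wpM2r ?powR_ge0// lerDl.
exists e, (K + 1), (c * rho ^+ B); split.
- by rewrite invr_gt0 ltr0n.
- by rewrite ltr_wpDl.
- by rewrite mulr_gt0// exprn_gt0.
move=> w wr Afw fw0; split.
  by have [y Ay yle] := near_cone wr fw0; exists y => //; exact: KK.
move=> t t1 t2; have [y Ay yle] := ray_near wr fw0 Afw t1 t2.
by exists y => //; exact: KK.
Qed.

End ChartEstimate.

(** * From one chart to sequences of points *)

Section TangentConeCharts.
Variables (R : realType) (n : nat).
Implicit Types A : set (vec R n).

Lemma germ_cone_like (I : finType) (g : 'I_n -> (I -> R) -> R) (s : seq I) A :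
  s <> [::] -> (forall k, agerm (g k)) -> (exists k, g k (fun=> 0) != 0) ->
  near0 [set w | (forall i, w i != 0) -> A (vscale (mono s w) (fun k => g k
    w))] ->
  exists e C t0, [/\ 0 < e, 0 < C, 0 < t0 &
    near0 [set w | let x := vscale (mono s w) (fun k => g k w) in
      A x -> x <> @vzero R n -> cone_like A e C t0 x]].
Proof.
move=> s0 gg [k0 gk0] [r r0 rA].
pose G w : vec R n := fun k => g k w.
have [M [r1 r10 gM]] : exists M, exists2 r1, 0 < r1 &
    forall k, abound (fun=> r1 + r1) (g k) M.
  pose M := \sum_k (`|g k (fun=> 0)| + 1).
  have [k|r1 r10 rM] := @finite_radius _ _ (fun k rho => abound (fun=> rho) (g
    k) M).
    apply: agerm_bound => //; apply: (@lt_le_trans _ _ (`|g k (fun=> 0)| + 1)).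
      by rewrite ltrDl.
    by rewrite /M (bigD1 k)//= lerDl sumr_ge0// => j _; rewrite addr_ge0.
  exists M, (r1 / 2); first by rewrite divr_gt0.
  by move=> k; rewrite -splitr; exact: rM.
have M0 : 0 <= M.
  by apply: (abound_ge0 _ (gM k0)) => _; rewrite addr_ge0// ltW.
pose L := n%:R * (M / r1).
have L0 : 0 <= L by rewrite !mulr_ge0// invr_ge0 ltW.
have Glip a b D : (forall i, `|a i| <= r1) -> (forall i, `|b i| <= r1) ->
    0 <= D -> (forall i, `|a i - b i| <= D) -> enorm (vsub (G a) (G b)) <= L *
      D.
  move=> ar br D0 abD; rewrite /L -mulrA [_ * D]mulrC.
  by apply: enorm_le_coord => k; exact: (abound_lip r10 D0 (gM k)).
pose c := enorm (G (fun=> 0)) / 2.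
have c0 : 0 < c.
  rewrite divr_gt0// (lt_le_trans _ (coord_le_enorm _ k0))//.
  by rewrite normr_gt0.
have L1 : 0 < L + 1 by rewrite ltr_wpDl.
(* The last bound keeps [G] within [c] of its value at the origin, whose norm is [2 c]. *)
pose rho := Num.min (Num.min r1 r) (Num.min 1 (c / (L + 1))).
have rho0 : 0 < rho by rewrite !lt_min r10 r0 ltr01 divr_gt0.
have rho_r1 : rho <= r1 by rewrite !ge_min lexx.
have rho_r : rho <= r by rewrite !ge_min lexx orbT.
have rho1 : rho <= 1 by rewrite !ge_min lexx !orbT.
have rhoc : L * rho <= c.
  have : rho <= c / (L + 1) by rewrite !ge_min lexx !orbT.
  by rewrite ler_pdivlMr// mulrDr mulr1 mulrC; have := rho0; lra.
have up a r' : rho <= r' -> (forall i : I, `|a i| <= rho) -> forall i, `|a i|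
  <= r'.
  by move=> h ar i; exact: le_trans (ar i) h.
have [|||e [C [t0 [e0 C0 t00 H]]]] :=
  @chart_cone_like R n I g s A rho L c rho0 rho1 L0 c0 s0.
- by move=> a b D ar br; apply: Glip; exact: up.
- move=> a ar; suff : c <= enorm (G a) by [].
  have := enorm_rev_triangle (G (fun=> 0)) (G a).
  have : enorm (vsub (G (fun=> 0)) (G a)) <= L * rho.
    apply: Glip; [|exact: up|exact: ltW|].
      by move=> i; rewrite normr0 ltW.
    by move=> i; rewrite sub0r normrN.
  have -> : enorm (G (fun=> 0)) = c + c by rewrite -splitr.
  by rewrite ler_norml => ? /andP[_]; lra.
- by move=> a ar; apply: rA; exact: up.
- by exists e, C, t0; split => //; exists rho.
Qed.

Section Sequences.
Variable U : set_system nat.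
Context {UU : UltraFilter U}.
Variables (A : set (vec R n)) (x : nat -> vec R n).
Hypotheses (xA : U [set k | A (x k)]) (x0 : U [set k | x k <> @vzero R n]).

Definition eventually_cone_like := exists e C t0, [/\ 0 < e, 0 < C, 0 < t0 &
  U [set k | cone_like A e C t0 (x k)]].

(** Normalizing [G] times the sum of squares of [f] achieves both aims in one chart: [f] becomes a
    monomial times a nonvanishing vector, and [G] is nonzero off the coordinate hyperplanes. *)
Lemma cone_like_open_chart (I : finType) (G : (I -> R) -> R)
    (f : 'I_n -> (I -> R) -> R) (w : nat -> I -> R) :
  agerm G -> ~ near0 [set y | G y = 0] ->
  (forall k, agerm (f k)) -> (forall k, f k (fun=> 0) = 0) ->
  near0 [set y | G y != 0 -> A (f ^~ y)] ->
  tends U w -> U [set k | f ^~ (w k) = x k] -> eventually_cone_like.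
Proof.
move=> Gg G0 fg f0 GA wt fw.
have sg : agerm (fun y => \sum_k f k y ^+ 2).
  by apply: agerm_sum => k _; exact: agerm_exp.
have H0 : ~ near0 [set y | G y * \sum_k f k y ^+ 2 = 0].
  move=> /(near0_mul_eq0 Gg sg)[//|] /wt s0.
  have [k [[h1 h2] h3]] := filter_ex (filterI (filterI s0 x0) fw).
  apply: h2; rewrite -h3; apply/funext => i; apply/eqP.
  move: h1 => /= /eqP; rewrite psumr_eq0 => [|j _]; last exact: sqr_ge0.
  by move=> /allP/(_ i (mem_index_enum _)); rewrite sqrf_eq0.
have [phi [v [phig phi0 vt phiv nH]]] := monomialization (agerm_mul Gg sg) H0
  wt.
have [nG ns] : normal (fun y => G (phi ^~ y)) /\
    normal (fun y => \sum_k f k (phi ^~ y) ^+ 2).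
  by apply: normal_factor => //; [exact: agerm_comp|exact: (agerm_comp phig
    phi0 sg)].
have fpg k : agerm (fun y => f k (phi ^~ y)) by exact: agerm_comp.
have [s [g [gg gk gE]]] := normal_sum_squares fpg ns.
have phiz : phi ^~ (fun=> 0) = fun=> 0 by apply/funext.
have s0 : s <> [::].
  move=> s0; have [k] := gk; have := near0_at0 gE; rewrite /= => /(_ k).
  by rewrite phiz f0 s0 /mono big_nil mul1r => <-; rewrite eqxx.
have [|e [C [t0 [e0 C0 t00 H]]]] := @germ_cone_like I g s A s0 gg gk.
  apply: filterS (filterI gE (filterI (normal_neq0 nG) (near0_comp phig phi0
    GA))).
  move=> y [/= gy [Gy GAy]] /Gy /GAy.
  by rewrite (_ : f ^~ _ = vscale (mono s y) (g ^~ y))//; apply/funext => k;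
    rewrite gy.
exists e, C, t0; split => //.
apply: filterS (filterI (vt _ (filterI H gE)) (filterI phiv (filterI fw
  (filterI xA x0)))).
move=> k [/= [Hk gk'] [phk [fk [Ak xk]]]].
have xE : vscale (mono s (v k)) (fun i => g i (v k)) = x k.
  by apply/funext => i; rewrite /vscale -gk' phk -fk.
by rewrite -xE; apply: Hk; rewrite xE.
Qed.

(** Once [F] is normal, its zeros lie on coordinate hyperplanes and the ultrafilter selects one
    containing the sequence; restricting to it makes [F] vanish identically, which is the open
    case. *)
Lemma cone_like_chart (I : finType) (F h : (I -> R) -> R)
    (f : 'I_n -> (I -> R) -> R) (w : nat -> I -> R) :
  agerm F -> agerm h ->
  (forall k, agerm (f k)) -> (forall k, f k (fun=> 0) = 0) ->
  near0 [set y | F y = 0 -> h y != 0 -> A (f ^~ y)] ->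
  tends U w -> U [set k | F (w k) = 0] -> U [set k | h (w k) != 0] ->
  U [set k | f ^~ (w k) = x k] -> eventually_cone_like.
Proof.
move=> Fg hg fg f0 FA wt Fw hw fw.
have h0 : ~ near0 [set y | h y = 0].
  by move=> /wt hz; have [k [/= ->]] := filter_ex (filterI hz hw); rewrite eqxx.
have [F0|F0] := pselect (near0 [set y | F y = 0]).
  apply: (@cone_like_open_chart I h f w) => //.
  by apply: filterS2 F0 FA => y /= Fy; exact.
have Fh0 : ~ near0 [set y | F y * h y = 0].
  by move=> /(near0_mul_eq0 Fg hg)[].
have [phi [v [phig phi0 vt phiv nH]]] := monomialization (agerm_mul Fg hg) Fh0
  wt.
have [[s [u [ug u0 FE]]] nh] : normal (fun y => F (phi ^~ y)) /\
    normal (fun y => h (phi ^~ y)).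
  by apply: normal_factor => //; exact: agerm_comp.
have [i0 i0v] : exists i0, U [set k | i0 \in s /\ v k i0 = 0].
  apply: (@ultra_exists U UU I (fun i k => i \in s /\ v k i = 0)).
  apply: filterS (filterI (vt _ (filterI FE (agerm_neq0 ug u0))) (filterI phiv
    Fw)).
  move=> k [/= [Fk uk] [phk Fwk]].
  move: Fk; rewrite phk Fwk => /esym/eqP; rewrite mulf_eq0 => /orP[|/eqP u0k].
    by rewrite /mono prodf_seq_eq0 => /hasP[i is_ /= /eqP vi]; exists i.
  by move: uk; rewrite u0k normr0 leNgt divr_gt0// normr_gt0.
have i0s : i0 \in s by have [k []] := filter_ex i0v.
(* The restricted chart keeps [i0] as a dummy variable, so the index type does not change. *)
pose psi j (y : I -> R) := phi j (upd y i0 0).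
have psig j : agerm (psi j) by exact: agerm_upd.
have psi0 j : psi j (fun=> 0) = 0.
  rewrite /psi (_ : upd _ _ _ = fun=> 0)//; apply/funext => i.
  by rewrite /upd; case: ifP.
have psiv : U [set k | psi ^~ (v k) = w k].
  apply: filterS2 i0v phiv => k /= [_ vk0] <-; apply/funext => j.
  rewrite /psi; congr phi; apply/funext => i; rewrite /upd.
  by case: eqP => [->|].
apply: (@cone_like_open_chart I (fun y => h (psi ^~ y)) (fun k y => f k (psi ^~
  y)) v) => //.
- exact: agerm_comp.
- move=> /vt hz.
  have [k [/= [h1 h2] h3]] := filter_ex (filterI (filterI hz psiv) hw).
  by move: h3; rewrite /= -h2 h1 eqxx.
- by move=> k; exact: agerm_comp.
- by move=> k; rewrite (_ : psi ^~ _ = fun=> 0)//; apply/funext.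
- apply: filterS2 (near0_upd i0 FE) (near0_comp psig psi0 FA) => y /= Fy; apply.
  rewrite [LHS]Fy /mono; apply/eqP; rewrite mulf_eq0; apply/orP; left.
  by rewrite prodf_seq_eq0; apply/hasP; exists i0 => //=; rewrite /upd eqxx.
- by apply: filterS2 psiv fw => k /= -> ->.
Qed.

End Sequences.
End TangentConeCharts.
(** * Semianalytic and subanalytic sets *)

Section AbsoluteSums.
Variable R : realType.

Lemma has_sum_bounded (M : eqType) (u : M -> R) S : has_sum u S ->
  exists K, forall G : seq M, uniq G -> \sum_(m <- G) `|u m| <= K.
Proof.
move=> /(_ 1 ltr01)[F FP].
pose F' := undup F.
have FF' : {subset F <= F'} by move=> m; rewrite mem_undup.
(* Adding terms outside [F] keeps the sum within [1] of [S], so they contribute at most [2];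
   separating signs bounds their absolute values by [4]. *)
have part (G : seq M) : uniq G -> {in G, forall m, m \notin F} ->
    `|\sum_(m <- G) u m| <= 2.
  move=> Gu GF; have h1 := FP F' (undup_uniq F) FF'.
  have Fu : uniq (F' ++ G).
    rewrite cat_uniq undup_uniq Gu andbT /= -all_predC; apply/allP => m /GF /=.
    by rewrite mem_undup.
  have h2 : `|\sum_(m <- F') u m + \sum_(m <- G) u m - S| < 1.
    rewrite -big_cat; apply: FP => // m mF.
    by rewrite mem_cat FF'.
  move: h1 h2; set a := \sum_(m <- F') _; set b := \sum_(m <- G) _.
  rewrite !ltr_norml ler_norml; lra.
exists (4 + \sum_(m <- F') `|u m|) => G Gu.
rewrite (bigID (fun m => m \in F)) /= addrC; apply: lerD.
  rewrite (bigID (fun m => 0 <= u m)) /=.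
  have half (P : pred M) : `|\sum_(m <- G | (m \notin F) && P m) u m| <= 2.
    rewrite -big_filter; apply: part; first exact: filter_uniq.
    by move=> m; rewrite mem_filter => /andP[/andP[]].
  have -> : (4 : R) = 2 + 2 by lra.
  apply: lerD.
    apply: le_trans (half (fun m => 0 <= u m)); apply: le_trans (ler_norm _).
    by apply: ler_sum => m /andP[_ um]; rewrite ger0_norm.
  apply: le_trans (half (fun m => ~~ (0 <= u m))); rewrite -normrN.
  apply: le_trans (ler_norm _); rewrite -sumrN.
  by apply: ler_sum => m /andP[_]; rewrite -ltNge => um; rewrite ltr0_norm.
rewrite -big_filter.
have sub : {subset [seq m <- G | m \in F] <= F'}.
  by move=> m; rewrite mem_filter mem_undup => /andP[].
have fu : uniq [seq m <- G | m \in F] by exact: filter_uniq.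
rewrite [leRHS](bigID (fun m => m \in [seq m <- G | m \in F])) /=.
rewrite -[X in _ <= X + _]big_filter.
have pe : perm_eq [seq m <- G | m \in F]
    [seq i <- F' | i \in [seq m <- G | m \in F]].
  apply: uniq_perm => //; first by rewrite filter_uniq// undup_uniq.
  move=> m; rewrite [RHS]mem_filter; apply/idP/andP => [h|[]//].
  by split=> //; exact: sub.
by rewrite [leLHS](perm_big _ pe) lerDl sumr_ge0.
Qed.

Lemma has_sum_series (M : countType) (u : M -> R) S : has_sum u S ->
  series (fun k => if @pickle_inv M k is Some m then u m else 0) @ \oo --> S.
Proof.
move=> uS; apply/cvgrPdist_lt => e e0; have [F FP] := uS e e0.
near=> N; rewrite distrC.
have -> : series (fun k => if @pickle_inv M k is Some m then u m else 0) N =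
    \sum_(m <- pmap (@pickle_inv M) (iota 0 N)) u m.
  rewrite /series /= /index_iota subn0; elim: (iota 0 N) => [|k s IH].
    by rewrite !big_nil.
  rewrite big_cons IH /=; case: (@pickle_inv M k) => [m|] /=.
    by rewrite big_cons.
  by rewrite add0r.
apply: FP; first by apply: (pmap_uniq (@pickle_invK M)); exact: iota_uniq.
move=> m mF; rewrite mem_pmap; apply/mapP; exists (pickle m).
  rewrite mem_iota /= add0n.
  have : (\max_(m <- F) (pickle m).+1 <= N)%N by near: N; exact: nbhs_infty_ge.
  apply: leq_trans; exact: (@leq_bigmax_seq _ F xpredT (fun m => (pickle
    m).+1)).
by rewrite pickleK_inv.
Unshelve. all: by end_near. Qed.

End AbsoluteSums.

(** * Lifting sequences through a semianalytic set *)

Section SubanalyticSequences.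
Variable R : realType.

Lemma abound_exp I (r : I -> R) f M n : abound r f M ->
  abound r (fun x => f x ^+ n) (M ^+ n).
Proof.
move=> fM; elim: n => [|n IH]; first exact: abound1.
rewrite exprS (_ : (fun _ => _) = fun x => f x * f x ^+ n).
  exact: abound_mul.
by apply/funext => x; rewrite exprS.
Qed.

Lemma abound_prod I (K : Type) (s : seq K) (r : I -> R)
    (f : K -> (I -> R) -> R) M : (forall k, abound r (f k) (M k)) ->
  abound r (fun x => \prod_(k <- s) f k x) (\prod_(k <- s) M k).
Proof.
move=> fM; elim: s => [|k s IH].
  rewrite big_nil (_ : (fun _ => _) = fun=> 1); first exact: abound1.
  by apply/funext => x; rewrite big_nil.
rewrite big_cons (_ : (fun _ => _) = fun x => f k x * \prod_(l <- s) f l x).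
  exact: abound_mul.
by apply/funext => x; rewrite big_cons.
Qed.

Lemma analytic_agerm n (V : set (vec R n)) (a : vec R n) f :
  analytic_on V f -> V a -> agerm (fun y => f (fun i => a i + y i)).
Proof.
move=> fV /fV[r r0 [c cP]].
(* Dividing by [n + 1] puts the polydisc strictly inside the Euclidean ball, also for [n = 0]. *)
pose rho := r / n.+1%:R; have rho0 : 0 < rho by rewrite divr_gt0.
have ball (y : 'I_n -> R) : (forall i, `|y i| <= rho) ->
    enorm (vsub (fun i => a i + y i) a) < r.
  move=> yr; apply: (@le_lt_trans _ _ (n%:R * rho)).
    by apply: enorm_le_coord => i; rewrite /vsub addrC addKr.
  by rewrite mulrCA gtr_pMr// ltr_pdivrMr// mul1r ltr_nat.
pose t (y : 'I_n -> R) (al : multi_index n) := c al * \prod_(i < n) y i ^+ al i.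
have tP y : (forall i, `|y i| <= rho) -> has_sum (t y) (f (fun i => a i + y i)).
  move=> /ball/cP; rewrite (_ : (fun al => _) = t y)//; apply/funext => al.
  by congr (_ * _); apply: eq_bigr => i _; rewrite addrC addKr.
(* At the corner of the polydisc every monomial attains its largest absolute value, so summability
   there bounds the coefficient norm. *)
have [|K KP] := has_sum_bounded (tP (fun=> rho) _).
  by move=> i; rewrite gtr0_norm.
exists rho => //; exists K.
apply: (@abound_lim _ _ _
  (fun k y => if @pickle_inv (multi_index n) k is Some al then t y al else 0)
  (fun k => if @pickle_inv (multi_index n) k is Some al then `|t (fun=> rho)
    al| else 0)).
- move=> k; case: pickle_inv => [al|]; last exact: abound0.
  have -> : `|t (fun=> rho) al| = `|c al| * \prod_(i < n) rho ^+ al i.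
    rewrite normrM normr_prod; congr (_ * _); apply: eq_bigr => i _.
    by rewrite normrX gtr0_norm.
  apply: abound_mul; first exact: abound_cst.
  by apply: abound_prod => i; apply: abound_exp; exact: abound_coord.
- move=> N; have := KP (pmap (@pickle_inv (multi_index n)) (iota 0 N)).
  move=> /(_ (pmap_uniq (@pickle_invK _) (iota_uniq _ _))).
  apply: le_trans; rewrite /series /= /index_iota subn0.
  elim: (iota 0 N) => [|k s IH]; first by rewrite !big_nil.
  rewrite big_cons /=; case: pickle_inv => [al|] /=; last by rewrite add0r.
  by rewrite big_cons lerD2l.
- by move=> y yr; exact: has_sum_series (tP y yr).
Qed.

Lemma norm_sqrt_sub (a b : R) : 0 <= a -> 0 <= b ->
  `|Num.sqrt a - Num.sqrt b| ^+ 2 <= `|a - b|.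
Proof.
move=> a0 b0; rewrite -{2}(sqr_sqrtr a0) -{2}(sqr_sqrtr b0) subr_sqr normrM
  expr2.
rewrite ler_wpM2l// [leRHS]ger0_norm ?addr_ge0 ?sqrtr_ge0//.
have := sqrtr_ge0 a; have := sqrtr_ge0 b; rewrite ler_norml; lra.
Qed.

Section Sequence.
Variable U : set_system nat.
Context {UU : UltraFilter U}.

(* Strict inequalities [g_j > 0] become equations [g_j = z_j ^ 2] with
   [z_j != 0] in additional variables. *)
Lemma subanalytic_cone_like n (A : set (vec R n)) (x : nat -> vec R n) :
  subanalytic_germ A -> U [set k | A (x k)] ->
  U [set k | x k <> @vzero R n] -> tends U x ->
  eventually_cone_like U A x.
Proof.
move=> [r0 r00 sA] xA x0 xt.
have enx e : 0 < e -> U [set k | enorm (x k) < e].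
  move=> e0; pose rho := e / n.+1%:R; have rho0 : 0 < rho by rewrite divr_gt0.
  apply: (xt [set y | enorm (y : vec R n) < e]); exists rho => // y yr /=.
  apply: (@le_lt_trans _ _ (n%:R * rho)); first exact: enorm_le_coord.
  by rewrite mulrCA gtr_pMr// ltr_pdivrMr// mul1r ltr_nat.
have [U0 [oU0 U00 [m [Y [sY [M YM] YE]]]]] := sA (@vzero R n).
have [rU rU0 rUP] := oU0 _ U00.
have xY : U [set k | exists2 y, Y y & proj_first y = x k].
  apply: filterS (filterI xA (filterI (enx _ r00) (enx _ rU0))).
  move=> k [/= Ak [xr xrU]].
  have : ([set x | A x /\ enorm x < r0] `&` U0) (x k).
    by split => //; apply: rUP; rewrite enorm_vsub0.
  by rewrite YE => -[y]; exists y.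
have [y yP] : {y : nat -> vec R (n + m) & forall k,
    (exists2 y, Y y & proj_first y = x k) -> Y (y k) /\ proj_first (y k) = x k}.
  apply: (@choice _ _ (fun k y => (exists2 y, Y y & proj_first y = x k) ->
    Y y /\ proj_first y = x k)) => k.
  have [[y Yy yx]|h] := pselect (exists2 y, Y y & proj_first y = x k).
    by exists y.
  by exists (@vzero R _) => /h.
have {}xY : U [set k | Y (y k) /\ proj_first (y k) = x k].
  by apply: filterS xY => k /= /yP.
(* The extra coordinates of the lifts need not tend to [0]; boundedness of [Y] gives a limit [b],
   where the semianalytic description is taken. *)
have [b bP] : {b : vec R (n + m) & forall i e, 0 < e ->
    U [set k | `|y k i - b i| <= e]}.
  apply: (@choice _ _ (fun i b => forall e, 0 < e -> U [set k | `|y k i - b| <=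
    e])).
  move=> i; apply: (@ultra_lim R U UU _ M).
  apply: filterS xY => k /= [/YM yM _]; apply: le_trans yM.
  exact: coord_le_enorm.
have yt : tends U (fun k i => y k i - b i) by exact: tendsP.
have bl (i : 'I_n) : b (lshift m i) = 0.
  apply/eqP; rewrite -normr_le0; apply/ler_addgt0Pl => e e0; rewrite addr0.
  have e20 : 0 < e / 2 by rewrite divr_gt0.
  have [k [/= [h1 h2] [_ h3]]] := filter_ex (filterI (filterI
    (bP (lshift m i) _ e20) (tends_coord i xt e20)) xY).
  move: h2; rewrite -h3 /proj_first => h2.
  have := ler_normB (y k (lshift m i)) (y k (lshift m i) - b (lshift m i)).
  rewrite subKr; lra.
have [V [oV Vb [p [q [f [g [fgan YV]]]]]]] := sY b.
have [rV rV0 rVP] := oV _ Vb.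
have near_V : near0 [set z : 'I_(n + m) -> R | V (fun i => b i + z i)].
  pose rho := rV / (n + m).+1%:R; have rho0 : 0 < rho by rewrite divr_gt0.
  exists rho => // z zr; apply: rVP;
    apply: (@le_lt_trans _ _ ((n + m)%:R * rho)).
    by apply: enorm_le_coord => i; rewrite /vsub addrC addKr.
  by rewrite mulrCA gtr_pMr// ltr_pdivrMr// mul1r ltr_nat.
have byk k : (fun i => b i + (y k i - b i)) = y k.
  by apply/funext => i; rewrite addrC subrK.
have [i0 yV] : exists i, U [set k | forall j, f i j (y k) = 0 /\ 0 < g i j (y
  k)].
  apply: (@ultra_exists U UU _ (fun i k => forall j, f i j (y k) = 0 /\ 0 < g i
    j (y k))).
  apply: filterS2 (yt _ near_V) xY => k /=; rewrite byk => Vk [Yk _].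
  have : (Y `&` V) (y k) by split.
  by rewrite YV => -[].
have fg j : agerm (fun z : 'I_(n + m) -> R => f i0 j (fun i => b i + z i)).
  by have [h _] := fgan i0 j; exact: analytic_agerm h Vb.
have gg j : agerm (fun z : 'I_(n + m) -> R => g i0 j (fun i => b i + z i)).
  by have [_ h] := fgan i0 j; exact: analytic_agerm h Vb.
have b0 : (fun i => b i + 0) = b by apply/funext => i; rewrite addr0.
have gc j e : 0 < e -> U [set k | `|g i0 j (y k) - g i0 j b| <= e].
  move=> e0; have := tends_agerm yt (gg j) e0.
  by apply: filterS => k /=; rewrite byk b0.
(* Only a weak inequality survives at [b], so [z0 j] may be [0]; the square roots still converge, by
   [norm_sqrt_sub]. *)
have gb j : 0 <= g i0 j b.
  rewrite leNgt; apply/negP => gb0.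
  have e0 : 0 < - g i0 j b / 2 by rewrite divr_gt0// oppr_gt0.
  have [k [/= h1 /(_ j)[_ h2]]] := filter_ex (filterI (gc j _ e0) yV).
  by move: h1; rewrite ler_norml; lra.
pose J := ('I_(n + m) + 'I_q)%type.
pose z0 j := Num.sqrt (g i0 j b).
pose v k (o : J) := match o with inl i => y k i - b i
  | inr j => Num.sqrt (g i0 j (y k)) - z0 j end.
have vt : tends U v.
  apply: tendsP => -[i|j] e e0 /=; first exact: bP.
  have e2 : 0 < e ^+ 2 by rewrite exprn_gt0.
  apply: filterS2 (gc j _ e2) yV => k /= gk /(_ j)[_ gk0].
  rewrite -(@ler_pXn2r _ 2) ?nnegrE ?(ltW e0)//.
  by apply: le_trans (norm_sqrt_sub (ltW gk0) (gb j)) gk.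
have Jcomp (h : ('I_(n + m) -> R) -> R) : agerm h ->
    agerm (fun w : J -> R => h (fun i => w (inl i))).
  by move=> hg; exact: (@agerm_reindex R _ J (fun i => inl i : J) h hg).
have zg j : agerm (fun w : J -> R => z0 j + w (inr j)).
  by apply: agerm_add; [exact: agerm_cst|exact: agerm_coord].
pose F (w : J -> R) := \sum_j f i0 j (fun i => b i + w (inl i)) ^+ 2 +
  \sum_j (g i0 j (fun i => b i + w (inl i)) - (z0 j + w (inr j)) ^+ 2) ^+ 2.
pose h (w : J -> R) := \prod_j (z0 j + w (inr j)).
apply: (@cone_like_chart R n U UU A x xA x0 J F h
  (fun k w => w (inl (lshift m k))) v) => //.
- apply: agerm_add; apply: agerm_sum => j _; apply: agerm_exp.
    exact: (Jcomp _ (fg j)).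
  apply: agerm_sub; first exact: (Jcomp _ (gg j)).
  exact: agerm_exp.
- by apply: agerm_prod => j _.
- by move=> k; exact: agerm_coord.
- apply: filterS (near0_reindex (fun i => inl i : J) near_V) => w /= Vw Fw0 hw0.
  have sum0 (u : 'I_q -> R) : \sum_j u j ^+ 2 = 0 -> forall j, u j = 0.
    move=> /eqP; rewrite psumr_eq0 => [/allP H j|j _]; last exact: sqr_ge0.
    by have := H j (mem_index_enum _); rewrite sqrf_eq0 => /eqP.
  have [s1 s2] : \sum_j f i0 j (fun i => b i + w (inl i)) ^+ 2 = 0 /\
    \sum_j (g i0 j (fun i => b i + w (inl i)) - (z0 j + w (inr j)) ^+ 2) ^+ 2 =
      0.
    move/eqP: Fw0; rewrite paddr_eq0; try by apply: sumr_ge0 => j _;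
      exact: sqr_ge0.
    by move=> /andP[/eqP ? /eqP ?].
  have : (Y `&` V) (fun i => b i + w (inl i)).
    rewrite YV; split => //; exists i0 => j; split; first exact: (sum0 _ s1).
    have /eqP := sum0 _ s2 j; rewrite subr_eq0 => /eqP ->.
    rewrite lt0r sqr_ge0 andbT sqrf_eq0.
    by move: hw0; rewrite /h prodf_seq_neq0 => /allP/(_ j (mem_index_enum _)).
  move=> [Yw _].
  have : (@proj_first R n m @` Y) (fun k => w (inl (lshift m k))).
    exists (fun i => b i + w (inl i)) => //.
    by apply/funext => k; rewrite /proj_first bl add0r.
  by rewrite -YE => -[[]].
- apply: filterS yV => k /= yk; rewrite /F /v /= byk.
  rewrite !big1 ?addr0// => j _; have [fk gk] := yk j;
    last by rewrite fk expr0n.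
  by rewrite [z0 j + _]addrC subrK sqr_sqrtr ?subrr ?expr0n// ltW.
- apply: filterS yV => k /= yk; rewrite /h /v /=.
  rewrite prodf_seq_neq0; apply/allP => j _ /=; have [fk gk] := yk j.
  by rewrite addrC subrK gt_eqF// sqrtr_gt0.
- apply: filterS xY => k /= [_ <-]; apply/funext => i.
  by rewrite /proj_first /= bl subr0.
Qed.

End Sequence.
End SubanalyticSequences.

(** * Uniform constants and sea-tangle equivalence *)

Section TangentCone.
Variables (R : realType) (n : nat).
Implicit Types (A : set (vec R n)) (x : vec R n).

Lemma powR_le_small (y e e' C C' : R) : 0 < y <= 1 -> e' <= e -> 0 <= C ->
  C <= C' -> C * y `^ (1 + e) <= C' * y `^ (1 + e').
Proof.
move=> y01 ee C0 CC; apply: ler_pM => //; first exact: powR_ge0.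
by apply: ger_powR => //; rewrite lerD2l.
Qed.

Lemma cone_like_weaken A (e e' C C' t0 t0' : R) x : cone_like A e C t0 x ->
  x <> @vzero R n -> enorm x <= 1 -> e' <= e -> 0 <= C -> C <= C' ->
  t0' <= t0 -> t0' <= 1 -> cone_like A e' C' t0' x.
Proof.
move=> [[y Ay yle] H] x0 x1 ee C0 CC tt t1; split.
  exists y => //; apply: le_trans yle _; apply: powR_le_small => //.
  by rewrite enorm_gt0.
move=> t xt tt0; have [|z Az zle] := H t xt; first exact: le_trans tt.
exists z => //; apply: le_trans zle _; apply: powR_le_small => //.
by rewrite (lt_le_trans (enorm_gt0 x0) xt) (le_trans tt0).
Qed.

(** Otherwise each [k] has a counterexample for exponent, scale and radius [1 / (k + 1)] and
    constant [k + 1]. Along an ultrafilter these points satisfy some fixed constants, which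
    [cone_like_weaken] turns into the excluded ones. *)
Lemma uniform_cone_like A : subanalytic_germ A ->
  exists e C t0 r, [/\ 0 < e, 0 < C, 0 < t0, 0 < r &
    forall x, A x -> x <> @vzero R n -> enorm x < r -> cone_like A e C t0 x].
Proof.
move=> sA; apply: contrapT => H.
pose b k : R := k.+1%:R^-1.
have b0 k : 0 < b k by rewrite invr_gt0.
have [x xP] : {x : nat -> vec R n & forall k, [/\ A (x k), x k <> @vzero R n,
    enorm (x k) < b k & ~ cone_like A (b k) k.+1%:R (b k) (x k)]}.
  apply: (@choice _ _ (fun k x => [/\ A x, x <> @vzero R n,
    enorm x < b k & ~ cone_like A (b k) k.+1%:R (b k) x])) => k.
  apply: contrapT => Hk; apply: H; exists (b k), k.+1%:R, (b k), (b k);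
    split => //.
  move=> x Ax x0 xb; apply: contrapT => nc; apply: Hk; exists x; split => //.
have [U [UU NU]] := ultraFilterLemma (F := \oo) _.
have large (e : R) : 0 < e -> U [set k | b k <= e].
  move=> e0; apply: NU; near=> k; apply: ltW.
  by near: k; exact: (near_infty_natSinv_lt (PosNum e0)).
have xt : tends U x.
  apply: tendsP => i e /large; apply: filterS => k /= bke.
  have [_ _ xb _] := xP k; apply: le_trans (coord_le_enorm _ _) _.
  by apply: le_trans bke; exact: ltW.
have [||e [C [t0 [e0 C0 t00 Uc]]]] := @subanalytic_cone_like R U UU n A x sA _
  _ xt.
- by apply: filterE => k; have [] := xP k.
- by apply: filterE => k; have [] := xP k.
have Ci0 : 0 < C^-1 by rewrite invr_gt0.
have [k [/= [h1 [h2 h3]] [h4 h5]]] := filter_ex (filterI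
  (filterI Uc (filterI (large _ e0) (large _ t00)))
  (filterI (large _ Ci0) (large _ ltr01))).
have [Ax x0 xb] := xP k; apply.
apply: (cone_like_weaken h1) => //.
- by apply: ltW; apply: lt_le_trans h5.
- exact: ltW.
- by move: h4; rewrite lef_pV2 ?posrE ?ltr0n.
Unshelve. all: by end_near. Qed.

Lemma LD_vzero A y : LD A y -> LD A (@vzero R n).
Proof.
move=> [t [a Da _]]; exists 0, a => //; split => //.
by apply/funext => i; rewrite /vscale mul0r.
Qed.

Lemma subanalytic_ST_equiv A : subanalytic_germ A ->
  zero_in_closure (A `\ @vzero R n) -> ST_equiv A (LD A).
Proof.
move=> sA A0.
have [e [C [t0 [r [e0 C0 t00 r0 H]]]]] := uniform_cone_like sA.
have LD0 : LD A (@vzero R n).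
  have [x [Ax x0] xr] := A0 r r0.
  by have [[y Ly _] _] := H x Ax x0 xr; exact: LD_vzero Ly.
have d1 : 1 < 1 + e by rewrite ltrDl.
split; first by move=> eps /A0[x [Ax _] xe]; exists x.
split; first by move=> eps eps0; exists (@vzero R n) => //; rewrite enorm_vzero.
exists (1 + e), (1 + e), C, C; split; first by [].
split; last first.
  exists r => // x Ax xr; have [x0|/eqP xn0] := pselect (x = @vzero R n).
    apply: le_trans (dist_le x LD0) _; rewrite x0 enorm_vsubxx.
    by rewrite mulr_ge0 ?powR_ge0// ltW.
  have [[y Ly yle] _] := H x Ax (elimN eqP xn0) xr.
  exact: le_trans (dist_le x Ly) yle.
exists (Num.min t0 1); first by rewrite lt_min t00 ltr01.
move=> x [t [a [a1 [xs [xsA xsc]]] [t_ge0 ->]]].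
rewrite /ST /= enorm_vscale a1 mulr1 ger0_norm// lt_min => /andP[tt0 t1].
(* The slack [eta] pays for replacing [a] by the direction of an actual point of [A]. *)
apply/ler_addgt0Pl => eta eta0.
have [t_eq0|tn0] := eqVneq t 0.
  have [y [Ay _] ye] := A0 eta eta0.
  apply: le_trans (dist_le _ Ay) _.
  rewrite (_ : vscale t a = @vzero R n); last first.
    by apply/funext => i; rewrite /vscale t_eq0 mul0r.
  rewrite enorm_vsubC enorm_vsub0; apply: le_trans (ltW ye) _.
  by rewrite lerDl mulr_ge0 ?powR_ge0// ltW.
have t_gt0 : 0 < t by rewrite lt0r tn0.
(* [del <= t] makes the ray estimate at [y] available at the scale [t]; as [t < 1], the angular
   error moves the point by at most [eta]. *)
pose del := Num.min (Num.min r t) eta.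
have del0 : 0 < del by rewrite !lt_min r0 t_gt0.
have [N /(_ N (leqnn N))[xs1 xs2]] := xsc del del0.
have [Ax x0] := xsA N; set y := xs N in Ax x0 xs1 xs2.
have yr : enorm y < r by apply: lt_le_trans xs1 _; rewrite !ge_min lexx.
have yt : enorm y <= t.
  by apply: le_trans (ltW xs1) _; rewrite !ge_min lexx orbT.
have yeta : enorm (vsub (vscale (enorm y)^-1 y) a) <= eta.
  by apply: le_trans (ltW xs2) _; rewrite ge_min lexx orbT.
have [_ /(_ t yt (ltW tt0))[z Az zle]] := H y Ax x0 yr.
apply: le_trans (dist_le _ Az) _.
apply: le_trans (enorm_triangle _ (vscale (t / enorm y) y) _) _.
apply: lerD => //; rewrite -vscaleA vscale_vsub enorm_vscale enorm_vsubC.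
rewrite gtr0_norm//; apply: le_trans (_ : 1 * eta <= _); last by rewrite mul1r.
by apply: ler_pM => //; [exact: enorm_ge0|exact: ltW].
Qed.

End TangentCone.

(** The accumulation is required of the nonzero points of [A]: for [A = {0}] there is no direction,
    so [LD A] is empty. *)
Theorem theorem4p14 (n : nat) (A : set (vec Rdefinitions.R n)) :
  subanalytic_germ A ->
  zero_in_closure (A `\ @vzero Rdefinitions.R n) ->
  ST_equiv A (LD A).
Proof. exact: subanalytic_ST_equiv. Qed.
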